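(* Suppose $V$ satisfies Assumption (A) and $\min_{x\in\mathbb R^d}V(x)=0$. For every $\tau>0$ and $\varepsilon\in(0,\tau)$ there exists a constant $C_{\tau,\varepsilon,d}>0$ (depending on $\tau,\varepsilon,d$ and $V$, but not on $\sigma$, $K$, $m$) such that for every $\sigma\in(0,1)$ and all integers $K,m\ge1$: $$\mathbb P(V(X_1)>\tau)\le C_{\tau,\varepsilon,d}\exp\Big(-\frac{\tau-\varepsilon}{\sigma}\Big),$$ $$\mathbb P(V(\widetilde Y_{t_K})>\tau)\le C_{\tau,\varepsilon,d}\exp\Big(-\frac{\tau-\varepsilon}{\sigma}\Big)+C^\sharp_{1,\sigma}\sqrt{d(2d+3)s}+C^\sharp_{2,\sigma}\sqrt{\frac{4d}{m}},$$ where $s=1/K$, $C^\sharp_{1,\sigma}=\frac{\gamma_\sigma}{\xi_\sigma}+\frac{\gamma_\sigma^3}{\xi_\sigma^3}$, $C^\sharp_{2,\sigma}=\frac{\gamma_\sigma^2}{\xi_\sigma^2}+\frac{\gamma_\sigma\zeta_\sigma}{\xi_\sigma^2}$.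
   Context: Assumption (A): $V$ is twice continuously differentiable on $\mathbb R^d$ and there is $R>0$ with $V(x)=\|x\|_2^2/2$ for $\|x\|_2>R$. Let $\hat f_\sigma(x)=\exp(-V(x)/\sigma+\|x\|_2^2/(2\sigma))$ and $b(x,t)=\mathbb E_Z[\nabla\hat f_\sigma(x+\sqrt{(1-t)\sigma}Z)]/\mathbb E_Z[\hat f_\sigma(x+\sqrt{(1-t)\sigma}Z)]$, $Z\sim N(0,\mathbf I_d)$. $X$ is the (unique strong) solution of $\mathrm dX_t=\sigma b(X_t,t)\mathrm dt+\sqrt\sigma\,\mathrm dB_t$, $X_0=0$, $t\in[0,1]$. Algorithm: $s=1/K$, $t_k=ks$, $\widetilde Y_{t_0}=0$ and for $k=0,\dots,K-1$, $\widetilde Y_{t_{k+1}}=\widetilde Y_{t_k}+\sigma s\,\tilde b_m(\widetilde Y_{t_k},t_k)+\sqrt{\sigma s}\,\epsilon_{k+1}$, where $\tilde b_m(y,t_k)=\dfrac{\frac1m\sum_{j=1}^m\nabla\hat f_\sigma(y+\sqrt{(1-t_k)\sigma}Z_{k,j})}{\frac1m\sum_{j=1}^m\hat f_\sigma(y+\sqrt{(1-t_k)\sigma}Z_{k,j})}$, with all $\epsilon_k$ and $Z_{k,j}$ i.i.d. $N(0,\mathbf I_d)$ and mutually independent. Constants: $M_{1,R}=\max_{\|x\|_2\le R}\{-V(x)+\|x\|_2^2/2\}$, $M_{2,R}=\max_{\|x\|_2\le R}\|x-\nabla V(x)\|_2$, $M_{3,R}=\max_{\|x\|_2\le R}\|\mathbf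 I_d-\nabla^2V(x)\|_2$ (operator norm), $m_{1,R}=\min_{\|x\|_2\le R}\{-V(x)+\|x\|_2^2/2\}$; $\gamma_\sigma=\{(M_{2,R}/\sigma)^2+M_{3,R}/\sigma\}\exp(M_{1,R}/\sigma)$, $\xi_\sigma=\exp(m_{1,R}/\sigma)$, $\zeta_\sigma=\exp(M_{1,R}/\sigma)$ (so $\gamma_\sigma/\xi_\sigma=\{(M_{2,R}/\sigma)^2+M_{3,R}/\sigma\}\exp((M_{1,R}-m_{1,R})/\sigma)$). *)

(* Defs.v *)
From HB Require Import structures.
From mathcomp Require Import all_boot all_order all_algebra.
From mathcomp Require Import all_classical all_reals all_analysis.
Set Implicit Arguments. Unset Strict Implicit. Unset Printing Implicit Defensive.
Import Order.TTheory GRing.Theory Num.Theory.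
Import numFieldNormedType.Exports.
Local Open Scope classical_set_scope.
Local Open Scope ring_scope.

Section Defs.
Variables (R : realType) (d : nat).
Notation vec := 'rV[R]_d.

Definition enorm (x : vec) : R := Num.sqrt (\sum_(i < d) x 0 i ^+ 2).

Definition ebase (i : 'I_d) : vec := delta_mx 0 i.

Definition partial (i : 'I_d) (f : vec -> R) (x : vec) : R := 'D_(ebase i) f x.

Definition grad (f : vec -> R) (x : vec) : vec := \row_i partial i f x.
Definition hess (f : vec -> R) (x : vec) : 'M[R]_d :=
  \matrix_(i, j) partial j (partial i f) x.

Definition C2 (f : vec -> R) : Prop :=
  (forall i x, derivable f x (ebase i)) /\
  (forall i j x, derivable (partial i f) x (ebase j)) /\
  (forall i j, continuous (partial j (partial i f))).

Definition assumptionA (V : vec -> R) (Rad : R) : Prop :=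
  C2 V /\ 0 < Rad /\ forall x, Rad < enorm x -> V x = enorm x ^+ 2 / 2.

Definition matvec (A : 'M[R]_d) (v : vec) : vec := (A *m v^T)^T.
Definition opnorm (A : 'M[R]_d) : R :=
  sup [set enorm (matvec A v) | v in [set v | enorm v <= 1]].

Definition cball (Rad : R) : set vec := [set x | enorm x <= Rad].

Definition M1 (V : vec -> R) Rad : R :=
  sup [set - V x + enorm x ^+ 2 / 2 | x in cball Rad].
Definition m1 (V : vec -> R) Rad : R :=
  inf [set - V x + enorm x ^+ 2 / 2 | x in cball Rad].
Definition M2 (V : vec -> R) Rad : R :=
  sup [set enorm (x - grad V x) | x in cball Rad].
Definition M3 (V : vec -> R) Rad : R :=
  sup [set opnorm (1%:M - hess V x) | x in cball Rad].

Definition gamma_s V Rad (s : R) : R :=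
  ((M2 V Rad / s) ^+ 2 + M3 V Rad / s) * expR (M1 V Rad / s).
Definition xi_s V Rad (s : R) : R := expR (m1 V Rad / s).
Definition zeta_s V Rad (s : R) : R := expR (M1 V Rad / s).
Definition Csharp1 V Rad s : R :=
  gamma_s V Rad s / xi_s V Rad s + gamma_s V Rad s ^+ 3 / xi_s V Rad s ^+ 3.
Definition Csharp2 V Rad s : R :=
  gamma_s V Rad s ^+ 2 / xi_s V Rad s ^+ 2
  + gamma_s V Rad s * zeta_s V Rad s / xi_s V Rad s ^+ 2.

Definition fhat (V : vec -> R) (s : R) (x : vec) : R :=
  expR (- V x / s + enorm x ^+ 2 / (2 * s)).

Section Prob.
Context {dT : measure_display} {T : measurableType dT} (P : probability T R).

(* X has law N(m, s^2) (s = standard deviation) *)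
Definition has_normal_law (X : T -> R) (m s : R) : Prop :=
  measurable_fun setT X /\
  forall A : set R, measurable A -> P (X @^-1` A) = normal_prob m s A.

Definition mutually_indep (I : eqType) (S : set I) (X : I -> T -> R) : Prop :=
  forall J : seq I, uniq J -> (forall i, i \in J -> S i) ->
  forall A : I -> set R, (forall i, measurable (A i)) ->
    P (\bigcap_(i in [set` J]) (X i @^-1` A i)) =
    (\prod_(i <- J) P (X i @^-1` A i))%E.

Definition std_gauss_vec (W : T -> vec) : Prop :=
  (forall i, has_normal_law (fun w => W w 0 i) 0 1) /\
  mutually_indep setT (fun i w => W w 0 i).

Definition brownian (B : T -> R -> vec) : Prop :=
  {ae P, forall w, B w 0 = 0 /\ continuous (B w)} /\
  forall (n : nat) (t : nat -> R), 0 <= t 0%N ->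
    (forall k, (k < n)%N -> t k < t k.+1) ->
    (forall k (i : 'I_d), (k < n)%N ->
       has_normal_law (fun w => B w (t k.+1) 0 i - B w (t k) 0 i)
         0 (Num.sqrt (t k.+1 - t k))) /\
    mutually_indep [set ki : nat * 'I_d | (ki.1 < n)%N]
      (fun ki w => B w (t ki.1.+1) 0 ki.2 - B w (t ki.1) 0 ki.2).

(* Gaussian expectation E_Z[g(Z)], Z ~ N(0,I_d) realised by W *)
Definition gaussE (W : T -> vec) (g : vec -> R) : R :=
  fine ('E_P[fun w => g (W w)])%E.

Definition drift (W : T -> vec) (V : vec -> R) (s : R) (x : vec) (t : R) : vec :=
  let c := Num.sqrt ((1 - t) * s) in
  (gaussE W (fun z => fhat V s (x + c *: z)))^-1 *:
  \row_i gaussE W (fun z => grad (fhat V s) (x + c *: z) 0 i).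

Definition solves_sde W V s (B : T -> R -> vec) (X : T -> R -> vec) : Prop :=
  {ae P, forall w, forall t, 0 <= t <= 1 ->
    X w t = s *: (\row_i \int[lebesgue_measure]_(u in `[0, t]) drift W V s (X w u) u 0 i)
            + Num.sqrt s *: B w t}.
End Prob.

(* index of the algorithm's Gaussian inputs: eps_k and Z_{k,j} *)
Inductive noise_idx := Eps of nat | Zn of nat & nat.
Definition noise_idx_code (a : noise_idx) : nat + nat * nat :=
  match a with Eps k => inl k | Zn k j => inr (k, j) end.
Definition noise_idx_decode (a : nat + nat * nat) : noise_idx :=
  match a with inl k => Eps k | inr (k, j) => Zn k j end.
Lemma noise_idx_codeK : cancel noise_idx_code noise_idx_decode.
Proof. by case. Qed.
HB.instance Definition _ := Equality.copy noise_idx (can_type noise_idx_codeK).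

(* \tilde b_m(y, t_k) with sample Z_{k,0..m-1} (paper's j = 1..m) *)
Definition btilde (V : vec -> R) (s : R) (K m : nat) (Zk : nat -> vec) (y : vec) (k : nat) : vec :=
  let tk := k%:R / K%:R in
  let c := Num.sqrt ((1 - tk) * s) in
  (m%:R^-1 * \sum_(j < m) fhat V s (y + c *: Zk j))^-1 *:
  (m%:R^-1 *: \sum_(j < m) grad (fhat V s) (y + c *: Zk j)).

Fixpoint Ytilde (V : vec -> R) (s : R) (K m : nat) (eps : nat -> vec)
  (Z : nat -> nat -> vec) (k : nat) : vec :=
  match k with
  | 0 => 0
  | k'.+1 => let y := Ytilde V s K m eps Z k' in
      y + (s / K%:R) *: btilde V s K m (Z k') y k' + Num.sqrt (s / K%:R) *: eps k
  end.
End Defs.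

(* Main.v *)
Require Import Defs.
From HB Require Import structures.
From mathcomp Require Import all_boot all_order all_algebra.
From mathcomp Require Import all_classical all_reals all_analysis.
From mathcomp Require Import measurable_realfun lebesgue_Rintegral.
From mathcomp Require Import ring lra.
Set Implicit Arguments. Unset Strict Implicit. Unset Printing Implicit Defensive.
Import Order.TTheory GRing.Theory Num.Theory.
Import numFieldNormedType.Exports.
Local Open Scope classical_set_scope.
Local Open Scope ring_scope.

(** Write v = |x|^2/2 - V, which vanishes outside a ball, f = exp (v / sigma), and
    let g be a Lipschitz cutoff with 1{V > tau} <= g <= 1{V > tau - eps/3}. The ratio
    u_c(x) = E[(g f)(x + c Z)] / E[f(x + c Z)] taken at c = sqrt((1 - t) sigma) is a
    martingale along the diffusion. By a Cameron-Martin shift, one Euler step with the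
    exact drift changes its mean by O(K^(-3/2)) only: the likelihood ratio of the
    Gaussian step and of the f-tilted step is 1 up to second order and has mean 1, and
    the Lipschitz bound on u gains one more factor. Telescoping from u at time 0 to
    u_0 = g bounds E g(Y_K) by u_{sqrt sigma}(0), plus K step errors, plus the L^1
    error O(m^(-1/2)) of the Monte Carlo drift. Driven by Brownian increments, the
    chain converges almost surely to X_1, because the drift is Lipschitz, so that
    E g(X_1) <= u_{sqrt sigma}(0). The latter is the Gibbs mass of g, which Laplace's
    method bounds. The error constants are polynomial in 1/sigma times
    exp (2 (M1 - m1) / sigma); for small sigma they are absorbed by the higher powers
    of gamma/xi in Csharp1 and Csharp2, and for other sigma, or for coarse steps, the
    right-hand side is at least 1. *)

(** * Gaussian integrals *)

(** The drift is the logarithmic gradient of the smoothed f. The Cameron-Martin ratio of the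
    Gaussian step and the ratio of the f-tilted step therefore have the same linear term c <b, z>,
    where c is the standard deviation of the step. The quadratic error c^2 meets a further factor c,
    and K errors of order K^(-3/2) leave K^(-1/2), the power of the step size in the statement. The
    noise is additive, so along almost every path the diffusion solves an ordinary integral
    equation. A discrete Gronwall argument then compares it with the Euler chain that uses the same
    increments, and all Gaussian estimates concern discrete chains. Independence is given as a
    product formula for finitely many scalar variables. Conditioning is therefore done on finite
    lists of scalar noises, and Gaussian vectors are integrated one coordinate at a time. The
    constant must be fixed before sigma, K, m and the probability space. Gaussian moments are thus
    numbers that depend on d alone, and errors are compared with powers of M2 / sigma. When M2 = 0
    these powers vanish, so every error constant must vanish as well. *)

Section density.
Local Open Scope ereal_scope.
Context d (T : measurableType d) (R : realType).
Variables (mu nu : {measure set T -> \bar R}) (g : T -> R).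
Hypothesis g0 : forall x, (0 <= g x)%R.
Hypothesis mg : measurable_fun setT g.
Hypothesis nuE : forall A, measurable A -> nu A = \int[mu]_(x in A) (g x)%:E.
Import HBNNSimple.

(** Monotone convergence along simple approximations of [f] reduces the claim to indicators, where
    it is [nuE]. *)
Lemma ge0_integral_density (f : T -> \bar R) :
  measurable_fun setT f -> (forall x, 0 <= f x) ->
  \int[nu]_x f x = \int[mu]_x (f x * (g x)%:E).
Proof.
move=> mf f0; pose h := nnsfun_approx measurableT mf.
have fE x : f x = lim ((EFin \o h n) x @[n --> \oo]).
  by apply/esym/cvg_lim => //; exact: cvg_nnsfun_approx.
have gE : measurable_fun setT (fun x => (g x)%:E) by exact/measurable_EFinP.
have mh n : measurable_fun setT (EFin \o h n).
  by apply/measurable_EFinP; exact/measurable_funP.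
have -> : \int[nu]_x f x = lim (\int[nu]_x (EFin \o h n) x @[n --> \oo]).
  under eq_integral do rewrite fE.
  apply: monotone_convergence => //.
  - by move=> n x _ /=; rewrite lee_fin.
  - by move=> x _ a b ab; rewrite lee_fin; exact/lefP/nd_nnsfun_approx.
have -> : \int[mu]_x (f x * (g x)%:E) =
    lim (\int[mu]_x ((EFin \o h n) x * (g x)%:E) @[n --> \oo]).
  have fg x : f x * (g x)%:E = lim (((EFin \o h n) x * (g x)%:E) @[n --> \oo]).
    apply/esym/cvg_lim => //; apply: cvgeZr => //.
    exact: cvg_nnsfun_approx.
  under eq_integral do rewrite fg.
  apply: monotone_convergence => //.
  - by move=> n; apply: emeasurable_funM.
  - by move=> n x _ /=; rewrite mule_ge0 // lee_fin.
  - by move=> x _ a b ab; rewrite lee_wpmul2r ?lee_fin//; exact/lefP/nd_nnsfun_approx.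
suff -> : (fun n => \int[nu]_x (EFin \o h n) x) =
    (fun n => \int[mu]_x ((EFin \o h n) x * (g x)%:E)) by [].
apply/funext => n.
have indich r : measurable_fun setT (fun x => (r * \1_(h n @^-1` [set r]) x)%:E).
  by apply/measurable_EFinP; exact: measurable_funM.
transitivity (\int[nu]_x
   (\sum_(y \in range (h n)) (y * \1_(h n @^-1` [set y]) x)%:E)).
  by apply: eq_integral => t _; rewrite /= fimfunE -fsumEFin.
rewrite ge0_integral_fsum//; last by move=> y x _; exact: nnfun_muleindic_ge0.
transitivity (\int[mu]_x (\sum_(y \in range (h n))
    ((y * \1_(h n @^-1` [set y]) x)%:E * (g x)%:E))); last first.
  apply: eq_integral => x _.
  rewrite -ge0_mule_fsuml => [|y]; last exact: nnfun_muleindic_ge0.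
  by rewrite fsumEFin // -(fimfunE _ x).
rewrite ge0_integral_fsum//; last 2 first.
  - by move=> y; apply: emeasurable_funM.
  - move=> y x _; rewrite mule_ge0 ?lee_fin ?g0// -lee_fin nnfun_muleindic_ge0//.
apply: eq_fsbigr => r /set_mem [x0 _ <-].
rewrite integralZl_indic_nnsfun// integral_indic// setIT nuE//.
under [RHS]eq_integral do rewrite EFinM -muleA.
rewrite ge0_integralZl//; last 3 first.
- by apply: emeasurable_funM => //; apply/measurable_EFinP; exact: measurable_indic.
- by move=> x _; rewrite mule_ge0// lee_fin.
- by rewrite lee_fin.
congr (_ * _); rewrite integral_mkcond; apply: eq_integral => x _.
by rewrite patchE indicE; case: ifP => _; rewrite ?mul1e ?mul0e.
Qed.

End density.

Section gauss1.
Context {R : realType}.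
Local Open Scope ereal_scope.
Local Notation mu := (@lebesgue_measure R).
Local Notation N01 := (normal_prob 0 1 : probability _ R).

Lemma ge0_integral_normal (m s : R) (f : R -> \bar R) :
  measurable_fun setT f -> (forall x, 0 <= f x) ->
  \int[normal_prob m s]_x f x = \int[mu]_x (f x * (normal_pdf m s x)%:E).
Proof.
move=> mf f0; apply: (ge0_integral_density (mu := mu)) => //.
- by move=> x; exact: normal_pdf_ge0.
- exact: measurable_normal_pdf.
Qed.

Let aff (a s : R) : measurableTypeR R -> measurableTypeR R := fun z => (a + s * z)%R.

Let measurable_aff a s : measurable_fun setT (aff a s).
Proof. by apply: measurable_funD => //; exact: measurable_funM. Qed.

(** The right-hand side is a measure in [A] with the value of Lebesgue measure on half-open
    intervals; uniqueness extends the equality. *)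
Lemma lebesgue_measure_affine (a s : R) (A : set R) : (0 < s)%R -> measurable A ->
  mu A = s%:E * pushforward mu (aff a s) A.
Proof.
move=> s0 mA.
pose nu : {measure set (measurableTypeR R) -> \bar R} :=
  mscale (NngNum (ltW s0)) (measure_function_pushforward__canonical__measure_function_Measure mu (measurable_aff a s)).
rewrite (_ : _ * _ = nu A)//.
apply: lebesgue_measure_unique => // _ [[x y]] _ <-.
rewrite /nu/= /mscale/= /pushforward.
have -> : (aff a s) @^-1` `]x, y]%classic = `]((x - a) / s)%R, ((y - a) / s)%R]%classic.
  apply/seteqP; split => z /=; rewrite !in_itv/= ltr_pdivrMr// ler_pdivlMr// ltrBlDl lerBrDl mulrC//.
rewrite !lebesgue_measure_itv/= !lte_fin ltr_pM2r ?invr_gt0// ltrD2r.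
case: ifPn => _; last by rewrite mule0.
by rewrite -!EFinB -EFinM; congr EFin; field; rewrite gt_eqF.
Qed.

Lemma ge0_integral_affine (a s : R) (f : R -> \bar R) : (0 < s)%R ->
  measurable_fun setT f -> (forall x, 0 <= f x) ->
  \int[mu]_x f x = s%:E * \int[mu]_z f (a + s * z)%R.
Proof.
move=> s0 mf f0.
transitivity (s%:E * \int[pushforward mu (aff a s)]_x f x); last first.
  congr (_ * _).
  by rewrite (ge0_integral_pushforward (measurable_aff a s) mu (D := setT) (f := f)).
rewrite -(ge0_integral_mscale (measure_function_pushforward__canonical__measure_function_Measure mu (measurable_aff a s)) measurableT (NngNum (ltW s0)))//.
apply: eq_measure_integral => A mA _; exact: (lebesgue_measure_affine a s0).
Qed.

Lemma integral_normal_cst (m s : R) (x : \bar R) : \int[normal_prob m s]__ x = x.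
Proof.
apply: (etrans (integral_cst _ measurableT _)).
rewrite [X in _ * X](_ : _ = 1) ?mule1//.
exact: (@probability_setT _ _ _ (normal_prob m s)).
Qed.

Lemma normal_pdf_affine (m s z : R) : (0 < s)%R ->
  (normal_pdf m s (m + s * z) * s = normal_pdf 0 1 z)%R.
Proof.
move=> s0; rewrite !normal_pdfE ?oner_neq0 ?gt_eqF// /normal_peak /normal_fun.
have -> : ((- (m + s * z - m) ^+ 2 / (s ^+ 2 *+ 2) = - (z - 0) ^+ 2 / (1 ^+ 2 *+ 2)))%R.
  by field; rewrite gt_eqF.
rewrite -mulrA mulrC -mulrA [in RHS]mulrC; congr (_ * _)%R.
rewrite -mulrnAr sqrtrM ?sqr_ge0// sqrtr_sqr ger0_norm ?ltW//.
by rewrite invfM mulrA divff ?gt_eqF// mul1r expr1n mul1r.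
Qed.

Lemma ge0_integral_normal_affine (m s : R) (f : R -> \bar R) : (0 < s)%R ->
  measurable_fun setT f -> (forall x, 0 <= f x) ->
  \int[normal_prob m s]_x f x = \int[N01]_z f (m + s * z)%R.
Proof.
move=> s0 mf f0.
have mphi : measurable_fun setT (fun z : R => (m + s * z)%R).
  by apply: measurable_funD => //; exact: measurable_funM.
have mf' : measurable_fun setT (fun z => f (m + s * z)%R).
  exact: (measurableT_comp mf mphi).
have f'0 z : 0 <= f (m + s * z)%R by exact: f0.
apply: (etrans (ge0_integral_normal m s mf f0)); apply/esym.
apply: (etrans (ge0_integral_normal 0 1 mf' f'0)); apply/esym.
rewrite (ge0_integral_affine m s0); last 2 first.
- apply: emeasurable_funM => //; apply/measurable_EFinP; exact: measurable_normal_pdf.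
- by move=> x; rewrite mule_ge0// lee_fin normal_pdf_ge0.
rewrite -ge0_integralZl//; last 3 first.
- apply: emeasurable_funM; first exact: measurableT_comp mphi.
  apply/measurable_EFinP; apply: measurableT_comp => //; exact: measurable_normal_pdf.
- by move=> x _; rewrite mule_ge0// lee_fin normal_pdf_ge0.
- by rewrite lee_fin ltW.
apply: eq_integral => z _.
by rewrite -(normal_pdf_affine m _ s0) EFinM [in RHS]muleA [in RHS]muleC.
Qed.

(** The Cameron-Martin formula on the line: the exponential is the ratio of the densities of N(a, 1)
    and N(0, 1). *)
Lemma ge0_integral_normal_shift (a : R) (f : R -> \bar R) :
  measurable_fun setT f -> (forall x, 0 <= f x) ->
  \int[N01]_z f (z + a)%R = \int[N01]_z (f z * (expR (a * z - a ^+ 2 / 2))%:E).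
Proof.
move=> mf f0.
transitivity (\int[normal_prob a 1]_x f x).
  rewrite (ge0_integral_normal_affine a ltr01 mf f0).
  by apply: eq_integral => z _; rewrite mul1r addrC.
have mexp : measurable_fun setT (fun z : R => expR (a * z - a ^+ 2 / 2)).
  apply: measurableT_comp => //; apply: measurable_funB => //; exact: measurable_funM.
rewrite (ge0_integral_normal a 1 mf f0).
rewrite (ge0_integral_normal 0 1 (f := fun z => f z * (expR (a * z - a ^+ 2 / 2))%:E)); last 2 first.
- by apply: emeasurable_funM => //; exact/measurable_EFinP.
- by move=> x; rewrite mule_ge0// lee_fin expR_ge0.
apply: eq_integral => z _; rewrite -muleA -EFinM; congr (_ * EFin _).
rewrite !normal_pdfE ?oner_neq0// mulrCA; congr (_ * _)%R.
by rewrite /normal_fun -expRD; congr expR; field.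
Qed.

(** Bayes' formula for Z and aZ + bY with Z, Y independent standard Gaussians. The right-hand side
    is the law of the sum times the conditional law of Z given the sum, found by completing the
    square in [z]. *)
Lemma normal_pdf_conv (a b y z : R) : (0 < a)%R -> (0 < b)%R ->
  let c : R := Num.sqrt (a ^+ 2 + b ^+ 2)%R in
  (normal_pdf 0 1 z * normal_pdf (a * z) b y =
   normal_pdf 0 c y * normal_pdf (a * y / c ^+ 2) (b / c) z)%R.
Proof.
move=> a0 b0 c.
have c2 : (c ^+ 2 = a ^+ 2 + b ^+ 2)%R by rewrite sqr_sqrtr// addr_ge0// sqr_ge0.
have c0 : (0 < c)%R by rewrite sqrtr_gt0 addr_gt0// exprn_gt0.
rewrite !normal_pdfE ?oner_neq0 ?gt_eqF ?divr_gt0// mulrACA [RHS]mulrACA.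
have pkE s : (0 < s)%R -> (normal_peak s = s^-1 * (Num.sqrt (pi *+ 2))^-1)%R.
  move=> s0; rewrite /normal_peak -mulrnAr sqrtrM ?sqr_ge0// sqrtr_sqr ger0_norm ?ltW//.
  by rewrite invfM.
congr (_ * _)%R.
  rewrite !pkE ?divr_gt0//.
  have : (Num.sqrt (pi *+ 2) != 0 :> R)%R by rewrite gt_eqF// sqrtr_gt0 mulrn_wgt0// pi_gt0.
  move: (Num.sqrt _ : R) => q q0; field; rewrite q0 !gt_eqF//.
rewrite /normal_fun -!expRD; congr expR.
have : (a ^+ 2 = c ^+ 2 - b ^+ 2)%R by rewrite c2 addrK.
move: (c) c0 {c2} => {}c c0 a2.
have -> : (- (y - a * z) ^+ 2 = - (y ^+ 2 + z ^+ 2 * (c ^+ 2 - b ^+ 2) - 2 * a * y * z))%R.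
  by rewrite -a2; ring.
have -> : (- (z - a * y / c ^+ 2) ^+ 2 = - (z ^+ 2 + (c ^+ 2 - b ^+ 2) * y ^+ 2 / c ^+ 4 - 2 * a * y * z / c ^+ 2))%R.
  by rewrite -a2; field; rewrite gt_eqF.
by field; rewrite !gt_eqF.
Qed.

Lemma ge0_integral_normal_conv (a b : R) (f : R -> \bar R) : (0 <= a)%R -> (0 <= b)%R ->
  measurable_fun setT f -> (forall x, 0 <= f x) ->
  \int[N01]_z \int[N01]_y f (a * z + b * y)%R =
  \int[N01]_z f (Num.sqrt (a ^+ 2 + b ^+ 2) * z)%R.
Proof.
move=> a0 b0 mf f0.
(* A Gaussian of variance 0 has no density, so [a = 0] and [b = 0] are settled directly. *)
move: a0; rewrite le_eqVlt => /predU1P[<-|a0].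
  transitivity (\int[N01]_z \int[N01]_y f (b * y)%R).
    by apply: eq_integral => z _; apply: eq_integral => y _; rewrite mul0r add0r.
  by rewrite integral_normal_cst expr0n add0r sqrtr_sqr ger0_norm.
move: b0; rewrite le_eqVlt => /predU1P[<-|b0].
  apply: eq_integral => z _.
  rewrite expr0n addr0 sqrtr_sqr ger0_norm ?ltW//.
  transitivity (\int[N01]_y f (a * z)%R).
    by apply: eq_integral => y _; rewrite mul0r addr0.
  exact: integral_normal_cst.
set c := Num.sqrt _.
have c0 : (0 < c)%R by rewrite sqrtr_gt0 addr_gt0// exprn_gt0.
transitivity (\int[N01]_z \int[normal_prob (a * z) b]_y f y).
  by apply: eq_integral => z _; rewrite (ge0_integral_normal_affine (a * z) b0 mf f0).
transitivity (\int[mu]_z \int[mu]_y (f y * (normal_pdf 0 1 z * normal_pdf (a * z) b y)%:E)).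
  rewrite (ge0_integral_normal 0 1 (f := fun z => \int[normal_prob (a * z) b]_y f y)); last 2 first.
  - rewrite [X in measurable_fun _ X](_ : _ = fun z => \int[N01]_y f (a * z + b * y)%R); last first.
      by apply/funext => z; rewrite (ge0_integral_normal_affine (a * z) b0 mf f0).
    apply: (@measurable_fun_fubini_tonelli_F _ _ _ _ _ N01 (fun p : R * R => f (a * p.1 + b * p.2)%R)) => //.
    by apply: measurableT_comp => //; apply: measurable_funD; apply: measurable_funM.
  - by move=> z; apply: integral_ge0.
  apply: eq_integral => z _.
  rewrite (ge0_integral_normal (a * z) b mf f0).
  rewrite -ge0_integralZr//.
  - apply: eq_integral => y _; rewrite -muleA -EFinM; congr (_ * EFin _).
    by rewrite mulrC.
  - by apply: emeasurable_funM => //; apply/measurable_EFinP; exact: measurable_normal_pdf.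
  - by move=> y _; rewrite mule_ge0// lee_fin normal_pdf_ge0.
  - by rewrite lee_fin normal_pdf_ge0.
have H z y : f y * (normal_pdf 0 1 z * normal_pdf (a * z) b y)%:E =
   f y * (normal_pdf 0 c y)%:E * (normal_pdf (a * y / c ^+ 2) (b / c) z)%:E.
  by rewrite normal_pdf_conv// EFinM muleA.
pose G (p : measurableTypeR R * measurableTypeR R) :=
  f p.2 * (normal_pdf 0 1 p.1 * normal_pdf (a * p.1) b p.2)%:E.
apply: (etrans (@fubini_tonelli _ _ _ _ _ mu mu G _ _)); last first.
- transitivity (\int[normal_prob 0 c]_y f y); last first.
    by rewrite (ge0_integral_normal_affine 0 c0 mf f0); apply: eq_integral => z _; rewrite add0r.
  rewrite (ge0_integral_normal 0 c mf f0); apply: eq_integral => y _.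
  transitivity (\int[mu]_z (f y * (normal_pdf 0 c y)%:E * (normal_pdf (a * y / c ^+ 2) (b / c) z)%:E)).
    by apply: eq_integral => z _; exact: H.
  rewrite ge0_integralZl//.
  - by rewrite integral_normal_pdf mule1.
  - by apply/measurable_EFinP; exact: measurable_normal_pdf.
  - by move=> z _; rewrite lee_fin normal_pdf_ge0.
  - by rewrite mule_ge0// lee_fin normal_pdf_ge0.
- by move=> p; rewrite mule_ge0// lee_fin mulr_ge0// normal_pdf_ge0//.
- apply: emeasurable_funM; first exact: measurableT_comp.
  apply/measurable_EFinP; apply: measurable_funM.
    by apply: measurableT_comp => //; exact: measurable_normal_pdf.
  rewrite [X in measurable_fun _ X](_ : _ = fun p : R * R => (normal_peak b * normal_fun 0 b (p.2 - a * p.1))%R); last first.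
    by apply/funext => p; rewrite normal_pdfE ?gt_eqF// /normal_fun subr0.
  apply: measurable_funM => //.
  apply: measurableT_comp; first exact: measurable_normal_fun.
  by apply: measurable_funB => //; apply: measurable_funM.
Qed.

End gauss1.

(** * Functions of random vectors *)

Section vec.
Context {R : realType} {d : nat}.
Notation vec := 'rV[R]_d.
Implicit Types (x y : vec) (c : R).
Notation e_ i := (delta_mx 0 i : 'rV[R]_d).

(** The l1 norm suits estimates made coordinate by coordinate, and exp (k |x|_1) factorises over the
    coordinates. *)
Definition n1 x : R := \sum_i `|x 0 i|.

Lemma n1_ge0 x : 0 <= n1 x. Proof. exact: sumr_ge0. Qed.

Lemma n1D x y : n1 (x + y) <= n1 x + n1 y.
Proof.
by rewrite /n1 -big_split/=; apply: ler_sum => i _; rewrite mxE ler_normD.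
Qed.

Lemma n1Z c x : n1 (c *: x) = `|c| * n1 x.
Proof. by rewrite /n1 mulr_sumr; apply: eq_bigr => i _; rewrite mxE normrM. Qed.

Lemma n1N x : n1 (- x) = n1 x.
Proof. by rewrite -scaleN1r n1Z normrN1 mul1r. Qed.

Lemma n1B x y : n1 (x - y) = n1 (y - x).
Proof. by rewrite -n1N opprB. Qed.

Lemma n10 : n1 0 = 0.
Proof. by rewrite /n1 big1// => i _; rewrite mxE normr0. Qed.

Lemma ler_coord_n1 x i : `|x 0 i| <= n1 x.
Proof. by rewrite /n1 (bigD1 i)//= lerDl sumr_ge0. Qed.

Lemma n1_dist_add x y z : n1 (x - z) <= n1 (x - y) + n1 (y - z).
Proof. by rewrite -{1}(subrK y x) -addrA n1D. Qed.

Lemma coord_sum_delta (a : vec) (l : seq 'I_d) (j : 'I_d) : uniq l ->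
  (\sum_(i <- l) a 0 i *: e_ i) 0 j = if j \in l then a 0 j else 0.
Proof.
elim: l => [|i l IH] /=; first by rewrite big_nil mxE.
move=> /andP[il ul]; rewrite big_cons !mxE IH// inE eqxx/= [j == i]eq_sym.
case: eqVneq => [<-|ij] /=; first by rewrite (negbTE il) mulr1 addr0.
by rewrite mulr0 add0r.
Qed.

Lemma sum_delta_enum (a : vec) : \sum_(i <- enum 'I_d) a 0 i *: e_ i = a.
Proof.
by apply/rowP => j; rewrite coord_sum_delta ?enum_uniq// mem_enum.
Qed.

Definition vmeas {dT} {T : measurableType dT} (Y : T -> vec) :=
  forall i, measurable_fun setT (fun w => Y w 0 i).

(* Measurability tested on all random vectors: no sigma-algebra on ['rV[R]_d] is needed. *)
Definition mfv (f : vec -> \bar R) := forall dT (T : measurableType dT) (Y : T -> vec),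
  vmeas Y -> measurable_fun setT (fun w => f (Y w)).

Definition mfr (f : vec -> R) := forall dT (T : measurableType dT) (Y : T -> vec),
  vmeas Y -> measurable_fun setT (fun w => f (Y w)).

Definition lip (L : R) (f : vec -> R) := forall x y, `|f x - f y| <= L * n1 (x - y).

Section vmeas.
Context {dT} {T : measurableType dT}.
Implicit Types X Y : T -> vec.

Lemma vmeas_cst x : vmeas (fun _ : T => x).
Proof. by move=> i; exact: measurable_cst. Qed.

Lemma vmeasD X Y : vmeas X -> vmeas Y -> vmeas (fun w => X w + Y w).
Proof.
move=> mX mY i; rewrite (_ : (fun _ => _) = (fun w => X w 0 i + Y w 0 i)).
  exact: measurable_funD.
by apply/funext => w; rewrite mxE.
Qed.

Lemma vmeasZ (h : T -> R) X : measurable_fun setT h -> vmeas X ->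
  vmeas (fun w => h w *: X w).
Proof.
move=> mh mX i; rewrite (_ : (fun _ => _) = (fun w => h w * X w 0 i)).
  exact: measurable_funM.
by apply/funext => w; rewrite mxE.
Qed.

Lemma vmeasN X : vmeas X -> vmeas (fun w => - X w).
Proof.
move=> mX; rewrite (_ : (fun _ => _) = (fun w => -1 *: X w)).
  exact: vmeasZ.
by apply/funext => w; rewrite scaleN1r.
Qed.

End vmeas.

Lemma vmeas_comp dT dT' (T : measurableType dT) (T' : measurableType dT')
    (g : T' -> T) (Y : T -> vec) : measurable_fun setT g -> vmeas Y ->
  vmeas (Y \o g).
Proof. by move=> mg mY i; exact: (measurableT_comp (mY i) mg). Qed.

Let rnd (n : nat) (v : 'rV[int]_d) : vec := \row_i ((v 0 i)%:~R / n.+1%:R).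

(** Rounding [Y] down to the grid of mesh 1/(n+1) gives a vector with countably many values, so [f]
    of it is measurable. These approximations converge pointwise because [f] is Lipschitz. *)
Lemma lip_mfr L f : lip L f -> mfr f.
Proof.
move=> Lf dT T Y mY.
pose fl n w : 'rV[int]_d := \row_i (Num.floor (n.+1%:R * Y w 0 i)).
have mfl n v : measurable [set w | fl n w = v].
  rewrite (_ : [set _ | _] = \bigcap_(i in [set: 'I_d])
      (fun w => Y w 0 i) @^-1` `[(v 0 i)%:~R / n.+1%:R, ((v 0 i)%:~R + 1) / n.+1%:R[%classic).
    apply: fin_bigcap_measurable => // i _.
    by rewrite -[X in measurable X]setTI; apply: mY.
  have H w i : Num.floor (n.+1%:R * Y w 0 i) == v 0 i =
      (Y w 0 i \in `[(v 0 i)%:~R / n.+1%:R, ((v 0 i)%:~R + 1) / n.+1%:R[).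
    rewrite in_itv/= ler_pdivrMr// ltr_pdivlMr// -intrD1 ![_ * n.+1%:R]mulrC.
    apply/eqP/idP => [<-|]; first exact: floor_itv.
    by move/floor_def.
  apply/seteqP; split => w /=.
    move=> flv i _.
    suff : Num.floor (n.+1%:R * Y w 0 i) == v 0 i by rewrite H.
    by rewrite -flv mxE.
  by move=> h; apply/rowP => i; rewrite mxE; apply/eqP; rewrite H; exact: h.
apply: (@measurable_fun_cvg _ _ _ setT (fun n w => f (rnd n (fl n w)))).
  move=> n _ B mB; rewrite setTI.
  rewrite (_ : _ @^-1` _ = \bigcup_(v in [set: 'rV[int]_d])
     (if pselect (B (f (rnd n v))) then [set w | fl n w = v] else set0)).
    apply: countable_bigcupT_measurable => // v.
    by case: pselect => h; [exact: mfl|exact: measurable0].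
  apply/seteqP; split => w /=.
    by move=> h; exists (fl n w) => //; case: pselect => h'.
  by case=> v _; case: pselect => h //= ->.
move=> w _; apply/cvgrPdist_le => e e0.
have L0 : 0 <= `|L| * d%:R + 1 by rewrite addr_ge0// mulr_ge0.
near=> n.
have H : n1 (Y w - rnd n (fl n w)) <= d%:R / n.+1%:R.
  rewrite /n1 (le_trans (y := \sum_(i < d) n.+1%:R^-1))//; last first.
    by rewrite sumr_const card_ord mulr_natl.
  apply: ler_sum => i _; rewrite !mxE.
  rewrite -[X in `|X - _|](mulKf (x := n.+1%:R))// mulrC -mulrBl normrM.
  rewrite [X in _ * X]ger0_norm// ler_piMl//.
  have /andP[h1 h2] := floor_itv (n.+1%:R * Y w 0 i).
  by rewrite ger0_norm ?subr_ge0// lerBlDl ltW//; move: h2; rewrite intrD.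
rewrite (le_trans (Lf _ _))//.
rewrite (le_trans (y := `|L| * (d%:R / n.+1%:R)))//.
  by rewrite (le_trans (ler_wpM2r (n1_ge0 _) (ler_norm L)))// ler_wpM2l.
rewrite mulrA ler_pdivrMr// -ler_pdivrMl//.
rewrite (le_trans _ (ltW (_ : n%:R < n.+1%:R)))//; last by rewrite ltr_nat.
near: n.
exact: nbhs_infty_ger.
Unshelve. all: by end_near. Qed.

Lemma mfr_mfv f : mfr f -> mfv (EFin \o f).
Proof. by move=> mf dT T Y mY; apply/measurable_EFinP; exact: mf. Qed.

Lemma mfr_cst c : mfr (fun=> c).
Proof. by move=> dT T Y mY; exact: measurable_cst. Qed.

Lemma mfrD f g : mfr f -> mfr g -> mfr (fun x => f x + g x).
Proof. by move=> mf mg dT T Y mY; apply: measurable_funD; [exact: mf|exact: mg]. Qed.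

Lemma mfrB f g : mfr f -> mfr g -> mfr (fun x => f x - g x).
Proof. by move=> mf mg dT T Y mY; apply: measurable_funB; [exact: mf|exact: mg]. Qed.

Lemma mfrM f g : mfr f -> mfr g -> mfr (fun x => f x * g x).
Proof. by move=> mf mg dT T Y mY; apply: measurable_funM; [exact: mf|exact: mg]. Qed.

Lemma mfr_comp (g : R -> R) f : measurable_fun setT g -> mfr f -> mfr (fun x => g (f x)).
Proof. by move=> mg mf dT T Y mY; apply: measurableT_comp => //; exact: mf. Qed.

Lemma mfr_coord i : mfr (fun x => x 0 i).
Proof. by move=> dT T Y mY; exact: mY. Qed.

Lemma mfr_sum (I : Type) (s : seq I) (F : I -> vec -> R) : (forall i, mfr (F i)) ->
  mfr (fun x => \sum_(i <- s) F i x).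
Proof. by move=> mF dT T Y mY; apply: measurable_sum => i; exact: mF. Qed.

Lemma mfr_affine f c x : mfr f -> mfr (fun z => f (x + c *: z)).
Proof.
move=> mf dT T Y mY; apply: (mf _ _ (fun w => x + c *: Y w)).
by apply: vmeasD; [exact: vmeas_cst|apply: vmeasZ => //; exact: measurable_cst].
Qed.

Lemma mfr_n1 : mfr n1.
Proof. by apply: mfr_sum => i; apply: (@mfr_comp (fun t : R => `|t|)) => //; exact: mfr_coord. Qed.

End vec.

(** * Gaussian smoothing *)

Section gaussop.
Context {R : realType} {d : nat}.
Notation vec := 'rV[R]_d.
Implicit Types (x y : vec) (c a b : R).
Notation e_ i := (delta_mx 0 i : 'rV[R]_d).
Local Open Scope ereal_scope.

Definition gau : probability (measurableTypeR R) R :=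
  normal_prob (0%R : R) 1%R.

Lemma gau_cst (x : \bar R) : \int[gau]__ x = x.
Proof. exact: integral_normal_cst. Qed.

Lemma gau_shift (a : R) (f : R -> \bar R) :
  measurable_fun setT f -> (forall t : R, 0 <= f t) ->
  \int[gau]_z f (z + a)%R = \int[gau]_z (f z * (expR (a * z - a ^+ 2 / 2))%:E).
Proof. exact: ge0_integral_normal_shift. Qed.

Lemma gau_conv (a b : R) (f : R -> \bar R) : (0 <= a)%R -> (0 <= b)%R ->
  measurable_fun setT f -> (forall t : R, 0 <= f t) ->
  \int[gau]_z \int[gau]_t f (a * z + b * t)%R =
  \int[gau]_z f (Num.sqrt (a ^+ 2 + b ^+ 2) * z)%R.
Proof. exact: ge0_integral_normal_conv. Qed.

Lemma gau_pdf (f : R -> \bar R) : measurable_fun setT f -> (forall t : R, 0 <= f t) ->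
  \int[gau]_z f z = \int[lebesgue_measure]_t (f t * (normal_pdf 0 1 t)%:E).
Proof. exact: ge0_integral_normal. Qed.

(* Otherwise unification unfolds the normal density. *)
Global Opaque gau.

(** Averaging over one coordinate at a time takes the place of a Gaussian measure on vectors: each
    property of [gsm] follows by induction on a list of coordinates from its one-dimensional
    case. *)
Definition smooth c (i : 'I_d) (f : vec -> \bar R) x : \bar R :=
  \int[gau]_z f (x + (c * z) *: e_ i)%R.

Lemma mfv_line f x i c : mfv f -> measurable_fun setT (fun z : R => f (x + (c * z) *: e_ i)%R).
Proof.
move=> mf; apply: (mf _ _ (fun z : R => x + (c * z) *: e_ i)%R).
apply: vmeasD; first exact: vmeas_cst.
by apply: vmeasZ; [exact: measurable_funM|exact: vmeas_cst].
Qed.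

Lemma mfv_line2 dT (T : measurableType dT) (Y : T -> vec) f i c : mfv f -> vmeas Y ->
  measurable_fun setT (fun p : T * measurableTypeR R => f (Y p.1 + (c * p.2) *: e_ i)%R).
Proof.
move=> mf mY; apply: (mf _ _ (fun p : T * measurableTypeR R => Y p.1 + (c * p.2) *: e_ i)%R).
apply: vmeasD; first exact: (vmeas_comp (g := fst) _ mY).
by apply: vmeasZ; [exact: measurable_funM|exact: vmeas_cst].
Qed.

Lemma smooth_ge0 c i f x : (forall y, 0 <= f y) -> 0 <= smooth c i f x.
Proof. by move=> f0; apply: integral_ge0. Qed.

Lemma mfv_smooth c i f : mfv f -> (forall y, 0 <= f y) -> mfv (smooth c i f).
Proof.
move=> mf f0 dT T Y mY.
apply: (@measurable_fun_fubini_tonelli_F _ _ _ _ _ gau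
  (fun p : T * measurableTypeR R => f (Y p.1 + (c * p.2) *: e_ i)%R)) => //.
exact: (mfv_line2 i c mf mY).
Qed.

Lemma smoothC a b i j f : mfv f -> (forall y, 0 <= f y) ->
  smooth a i (smooth b j f) = smooth b j (smooth a i f).
Proof.
move=> mf f0; apply/funext => x; rewrite /smooth.
transitivity (\int[gau]_z \int[gau]_y f (x + (b * y) *: e_ j + (a * z) *: e_ i)%R).
  by apply: eq_integral => z _; apply: eq_integral => y _; rewrite addrAC.
apply/esym.
pose F (p : measurableTypeR R * measurableTypeR R) := f (x + (b * p.1) *: e_ j + (a * p.2) *: e_ i)%R.
apply: (etrans (@fubini_tonelli _ _ _ _ _ gau gau F _ _)) => //.
apply: (@mfv_line2 _ _ (fun z : R => x + (b * z) *: e_ j)%R) => //.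
apply: vmeasD; first exact: vmeas_cst.
by apply: vmeasZ; [exact: measurable_funM|exact: vmeas_cst].
by move=> p; exact: f0.
Qed.

Lemma smooth_conv a b i f : (0 <= a)%R -> (0 <= b)%R -> mfv f -> (forall y, 0 <= f y) ->
  smooth a i (smooth b i f) = smooth (Num.sqrt (a ^+ 2 + b ^+ 2)) i f.
Proof.
move=> a0 b0 mf f0; apply/funext => x; rewrite /smooth.
have mg : measurable_fun setT (fun t : R => f (x + t *: e_ i)%R).
  have := @mfv_line f x i 1%R mf.
  by under eq_fun do rewrite mul1r.
apply: (etrans _ (gau_conv a0 b0 mg (fun t => f0 _))).
apply: eq_integral => z _; apply: eq_integral => y _.
by rewrite -addrA scalerDl.
Qed.

Definition smooths c (l : seq 'I_d) f := foldr (smooth c) f l.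

Lemma smooths_ge0 c l f x : (forall y, 0 <= f y) -> 0 <= smooths c l f x.
Proof. by elim: l x => [|i l IH] x f0 //=; apply: smooth_ge0 => y; exact: IH. Qed.

Lemma mfv_smooths c l f : mfv f -> (forall y, 0 <= f y) -> mfv (smooths c l f).
Proof.
move=> mf f0; elim: l => [|i l IH] //=.
by apply: mfv_smooth => // y; exact: smooths_ge0.
Qed.

Lemma smooth_smoothsC a b i l f : mfv f -> (forall y, 0 <= f y) ->
  smooths a l (smooth b i f) = smooth b i (smooths a l f).
Proof.
move=> mf f0; elim: l => [|j l IH] //=; rewrite IH smoothC//.
- exact: mfv_smooths.
- by move=> y; exact: smooths_ge0.
Qed.

Lemma smooths_conv a b l f : (0 <= a)%R -> (0 <= b)%R -> mfv f -> (forall y, 0 <= f y) ->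
  smooths a l (smooths b l f) = smooths (Num.sqrt (a ^+ 2 + b ^+ 2)) l f.
Proof.
move=> a0 b0 mf f0; elim: l => [|i l IH] //=.
rewrite smooth_smoothsC ?IH ?smooth_conv//.
- exact: mfv_smooths.
- by move=> y; exact: smooths_ge0.
- exact: mfv_smooths.
- by move=> y; exact: smooths_ge0.
Qed.

(** Smoothing along [l] moves only the coordinates in [l]. Factors that depend on the other
    coordinates thus behave as constants. *)
Lemma smooths_local c l f g x :
  (forall y, (forall i, i \notin l -> y 0%R i = x 0%R i) -> f y = g y) ->
  smooths c l f x = smooths c l g x.
Proof.
elim: l x => [|i l IH] x fg /=; first exact: fg.
apply: eq_integral => z _; apply: IH => y Hy; apply: fg => j.
rewrite inE negb_or => /andP[ji jl].
by rewrite Hy// !mxE eqxx/= (negbTE ji) mulr0 addr0.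
Qed.

Lemma smooths_scale c l f k x : mfv f -> (forall y, 0 <= f y) -> 0 <= k ->
  smooths c l (fun y => k * f y) x = k * smooths c l f x.
Proof.
move=> mf f0 k0; elim: l x => [|i l IH] x //=.
rewrite /smooth -ge0_integralZl//.
- by apply: eq_integral => z _; exact: IH.
- by apply: mfv_line; exact: mfv_smooths.
- by move=> z _; exact: smooths_ge0.
Qed.

(** The centre [X] is kept apart from [x] because the induction moves [x] along the coordinates
    already treated, while the exponent must go on referring to the original centre. *)
Lemma smooths_shift c l f (a x X : vec) : (0 < c)%R -> uniq l ->
  mfv f -> (forall y, 0 <= f y) -> (forall i, i \in l -> x 0%R i = X 0%R i) ->
  smooths c l f (x + \sum_(i <- l) a 0%R i *: e_ i)%R =
  smooths c l (fun y => (expR (\sum_(i <- l)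
    (a 0 i * (y 0 i - X 0 i) / c ^+ 2 - a 0 i ^+ 2 / (2 * c ^+ 2))))%:E * f y) x.
Proof.
move=> c0 + mf f0; elim: l x => [|i l IH] x /=.
  by move=> _ _; rewrite !big_nil expR0 mul1e addr0.
move=> /andP[il ul] xX.
have cN0 : c != 0%R by rewrite gt_eqF.
pose g (t : R) := smooths c l f (x + \sum_(i <- l) a 0%R i *: e_ i + (c * t) *: e_ i)%R.
have mg : measurable_fun setT g by apply: mfv_line; exact: mfv_smooths.
have g0 t : 0 <= g t by exact: smooths_ge0.
transitivity (\int[gau]_z g (z + a 0 i / c)%R).
  apply: eq_integral => z _; congr (smooths _ _ _ _).
  rewrite big_cons mulrDr scalerDl [(c * (a 0 i / c))%R]mulrC divfK// -!addrA.
  by congr (_ + _)%R; rewrite addrC -addrA.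
apply: (etrans (gau_shift _ mg g0)).
apply: eq_integral => z _.
pose x' : vec := (x + (c * z) *: e_ i)%R.
have x'X j : j \in l -> x' 0%R j = X 0%R j.
  move=> jl; rewrite !mxE eqxx/=; have ji : (j == i) = false.
    by apply/negbTE/eqP => ji; rewrite -ji jl in il.
  by rewrite ji mulr0 addr0 xX// inE jl orbT.
rewrite /g addrAC -/x' (IH x' ul x'X) muleC -smooths_scale//; last 2 first.
- move=> dT T Y mY; apply: emeasurable_funM; last exact: mf.
  apply/measurable_EFinP; apply: measurableT_comp => //.
  apply: measurable_sum => j.
  apply: measurable_funB => //; apply: measurable_funM => //.
  by apply: measurable_funM => //; apply: measurable_funB.
- by move=> y; rewrite mule_ge0// lee_fin expR_ge0.
apply: smooths_local => y Hy.
rewrite muleA -EFinM -expRD big_cons.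
suff -> : (a 0 i / c * (z : R) - (a 0 i / c) ^+ 2 / 2 =
  a 0 i * (y 0 i - X 0 i) / c ^+ 2 - a 0 i ^+ 2 / (2 * c ^+ 2))%R by [].
rewrite Hy// !mxE !eqxx/= mulr1 xX ?inE ?eqxx//.
rewrite addrAC subrr add0r; move: (a 0%R i) (z : R) cN0 => a' z' cN0'.
by field.
Qed.

Lemma smooths_prod c l (k : 'I_d -> R -> \bar R) x : uniq l ->
  (forall i, measurable_fun setT (k i)) -> (forall i t, 0 <= k i t) ->
  smooths c l (fun y => \prod_(i <- l) k i (y 0%R i)) x =
  \prod_(i <- l) \int[gau]_z k i (x 0 i + c * z)%R.
Proof.
move=> + mk k0; elim: l x => [|i l IH] x /=; first by rewrite !big_nil.
move=> /andP[il ul]; rewrite big_cons.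
have p0 y : 0 <= \prod_(j <- l) k j (y 0%R j) by exact: prode_ge0.
have mp : mfv (fun y => \prod_(j <- l) k j (y 0%R j)).
  move=> dT T Y mY; elim: (l) => [|j s IHs].
    by under eq_fun do rewrite big_nil; exact: measurable_cst.
  under eq_fun do rewrite big_cons.
  by apply: emeasurable_funM => //; exact: (measurableT_comp (mk j) (mY j)).
transitivity (\int[gau]_z (k i (x 0 i + c * z)%R *
   \prod_(j <- l) \int[gau]_z k j (x 0 j + c * z)%R)).
  apply: eq_integral => z _.
  transitivity (k i (x 0 i + c * z)%R *
     smooths c l (fun y => \prod_(j <- l) k j (y 0%R j)) (x + (c * z) *: e_ i)%R).
    rewrite -smooths_scale//; apply: smooths_local => y Hy.
    by rewrite big_cons Hy// !mxE !eqxx/= mulr1.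
  rewrite IH//; congr (_ * _); rewrite !big_seq; apply: eq_bigr => j jl.
  apply: eq_integral => t _; congr (k j (_ + _)%R).
  rewrite !mxE eqxx/= (_ : (j == i) = false) ?mulr0 ?addr0//.
  by apply/negbTE/eqP => ji; rewrite -ji jl in il.
rewrite ge0_integralZr//.
- by apply: (measurableT_comp (mk i)); apply: measurable_funD.
- by apply: prode_ge0 => j _; exact: integral_ge0.
Qed.

(* [gsm c f x] is E f(x + c Z) for Z standard Gaussian, one coordinate after the other. *)
Definition gsm c f := smooths c (enum 'I_d) f.

Lemma gsm_ge0 c f x : (forall y, 0 <= f y) -> 0 <= gsm c f x.
Proof. exact: smooths_ge0. Qed.

Lemma mfv_gsm c f : mfv f -> (forall y, 0 <= f y) -> mfv (gsm c f).
Proof. exact: mfv_smooths. Qed.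

Lemma gsm_conv a b f : (0 <= a)%R -> (0 <= b)%R -> mfv f -> (forall y, 0 <= f y) ->
  gsm a (gsm b f) = gsm (Num.sqrt (a ^+ 2 + b ^+ 2)) f.
Proof. exact: smooths_conv. Qed.

Lemma gsm_shift c f (a x : vec) : (0 < c)%R -> mfv f -> (forall y, 0 <= f y) ->
  gsm c f (x + a)%R =
  gsm c (fun y => (expR (\sum_i
    (a 0 i * (y 0 i - x 0 i) / c ^+ 2 - a 0 i ^+ 2 / (2 * c ^+ 2))))%:E * f y) x.
Proof.
move=> c0 mf f0; rewrite -{1}(sum_delta_enum a) /gsm.
rewrite (@smooths_shift c _ f a x x c0 (enum_uniq _) mf f0 (fun _ _ => erefl)).
by apply: smooths_local => y _; rewrite big_enum.
Qed.

Lemma gsm_prod c (k : 'I_d -> R -> \bar R) x :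
  (forall i, measurable_fun setT (k i)) -> (forall i t, 0 <= k i t) ->
  gsm c (fun y => \prod_i k i (y 0%R i)) x =
  \prod_i \int[gau]_z k i (x 0 i + c * z)%R.
Proof.
move=> mk k0; rewrite -[RHS]big_enum -smooths_prod// ?enum_uniq//.
by apply: smooths_local => y _; rewrite big_enum.
Qed.

End gaussop.

(** * Conditioning on past noise *)

Section conditioning.
Context {R : realType} {dT : measure_display} {T : measurableType dT}.
Variables (P : probability T R) (I : eqType) (S : set I) (xi : I -> T -> R).
Hypothesis xi_law : forall a, S a -> has_normal_law P (xi a) 0 1.
Hypothesis xi_indep : mutually_indep P S xi.
Local Open Scope ereal_scope.

(** Rectangles in the noises listed in [L]: a pi-system made of the very events for which
    [mutually_indep] gives a product formula. *)
Definition past (L : seq I) : set (set T) :=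
  [set B | exists2 A : I -> set R, (forall i, measurable (A i)) &
           B = \bigcap_(i in [set` L]) (xi i @^-1` A i)].

Notation TL L := (g_sigma_algebraType (past L)).

(** Measurability for the sigma-algebra generated by the noises in [L]; [TL L] is [T] equipped with
    it. *)
Definition pmeas (L : seq I) (h : T -> R) := measurable_fun setT (h : TL L -> R).

Lemma past_setI L : setI_closed (past L).
Proof.
move=> _ _ [A mA ->] [B mB ->]; exists (fun i => A i `&` B i).
  by move=> i; exact: measurableI.
apply/seteqP; split => [w [hA hB] i iL|w h].
  by split; [exact: hA|exact: hB].
by split => i iL; have [] := h i iL.
Qed.

Lemma past_setT L : past L setT.
Proof. by exists (fun=> setT) => //; rewrite bigcapT. Qed.

Lemma past_mono L L' : {subset L <= L'} -> past L `<=` past L'.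
Proof.
move=> LL' _ [A mA ->]; exists (fun i => if i \in L then A i else setT).
  by move=> i; case: ifP.
apply/seteqP; split => [w h i _|w h i iL].
  by case: ifP => // iL; exact: h.
by have := h i (LL' _ iL); rewrite /preimage /=; move: (iL) => /= ->.
Qed.

Lemma pmeas_mono L L' h : {subset L <= L'} -> pmeas L h -> pmeas L' h.
Proof.
move=> LL' mh _ B mB; have := mh measurableT B mB.
apply: sub_sigma_algebra2.
exact: past_mono.
Qed.

Lemma pmeas_xi L a : a \in L -> pmeas L (xi a).
Proof.
move=> aL _ B mB; rewrite setTI; apply: sub_sigma_algebra.
exists (fun i => if i == a then B else setT).
  by move=> i; case: ifP.
apply/seteqP; split => [w h i iL|w h]; first by case: eqP => // ->.
by have := h a aL; rewrite eqxx.
Qed.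

Lemma past_measurable L : (forall a, a \in L -> S a) ->
  measurable_fun setT (id : T -> TL L).
Proof.
move=> LS _ B; rewrite setTI preimage_id.
apply: smallest_sub; first exact: sigma_algebra_measurable.
move=> _ [A mA ->].
apply: fin_bigcap_measurable => // i iL.
rewrite -[X in measurable X]setTI.
by have [mxi _] := xi_law (LS i iL); exact: mxi.
Qed.

Lemma pmeas_measurable L h : (forall a, a \in L -> S a) -> pmeas L h ->
  measurable_fun setT h.
Proof. by move=> LS mh; exact: (measurableT_comp mh (past_measurable LS)). Qed.

(** As functions of [A], both sides are finite measures that agree on the rectangles of [past L],
    hence on the sigma-algebra they generate. *)
Lemma past_indep L a (A : set T) (C : set R) : uniq (a :: L) ->
  (forall i, i \in a :: L -> S i) -> measurable C -> <<s past L >> A ->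
  P (A `&` xi a @^-1` C) = P A * gau C.
Proof.
move=> uaL aLS mC mA.
have Sa : S a by apply: aLS; rewrite mem_head.
have LS i : i \in L -> S i by move=> iL; apply: aLS; rewrite inE iL orbT.
have [mxi lawxi] := xi_law Sa.
have mxiC : measurable (xi a @^-1` C) by rewrite -[X in measurable X]setTI; exact: mxi.
have mid := past_measurable LS.
pose m1 : {measure set (TL L) -> \bar R} :=
  measure_function_pushforward__canonical__measure_function_Measure (mrestr P mxiC) mid.
pose k : {nonneg R} := NngNum (fine_ge0 (measure_ge0 gau C)).
pose m2 : {measure set (TL L) -> \bar R} :=
  mscale k (measure_function_pushforward__canonical__measure_function_Measure P mid).
have gC : k%:num%:E = gau C by rewrite /= fineK// fin_num_measure.
have m12 : m1 A = m2 A.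
  apply: (@measure_unique _ R (TL L) (past L) (fun=> setT)) => //.
  - exact: past_setI.
  - by move=> _; exact: past_setT.
  - by rewrite bigcup_const//; exists 0%N.
  - move=> _ [D mD ->]; rewrite /m1 /m2 /= /mscale/= /pushforward /mrestr preimage_id gC.
    have -> : (\bigcap_(i in [set` L]) xi i @^-1` D i) `&` xi a @^-1` C =
       \bigcap_(i in [set` a :: L]) xi i @^-1` (if i == a then C else D i).
      apply/seteqP; split => [w [h1 h2] i /=|w h].
        rewrite inE; case: eqP => [->//|_ /= iL]; exact: h1.
      split => [i iL|]; last by have := h a (mem_head _ _); rewrite eqxx.
      have := h i; rewrite /= inE iL orbT => /(_ isT).
      by case: eqP => // ia; move: uaL; rewrite /= -ia; move: (iL) => /= ->.
    rewrite (xi_indep uaL aLS); last by move=> i; case: ifP.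
    rewrite big_cons eqxx lawxi//.
    rewrite (_ : normal_prob 0 1 C = gau C)//; congr (_ * _).
    rewrite (xi_indep (J := L))//; last by case/andP: uaL.
    rewrite !big_seq; apply: eq_bigr => i iL.
    by case: eqP => // ia; move: uaL; rewrite /= -ia iL.
  - move=> _; rewrite /m1/= /pushforward/= /mrestr preimage_id setTI.
    by rewrite (le_lt_trans (probability_le1 P mxiC))// ltry.
have : m1 A = P (A `&` xi a @^-1` C) by [].
have : m2 A = k%:num%:E * P A by [].
by move=> m2E m1E; rewrite -m1E m12 m2E gC muleC.
Qed.

(** By [past_indep] the joint law of the past and of [xi a] is the product of their laws, and
    Tonelli's theorem integrates [xi a] first. *)
Lemma cond1 L a (F : T * R -> \bar R) : uniq (a :: L) ->
  (forall i, i \in a :: L -> S i) ->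
  measurable_fun setT (F : TL L * measurableTypeR R -> \bar R) -> (forall p, 0 <= F p) ->
  \int[P]_w F (w, xi a w) = \int[P]_w \int[gau]_z F (w, z).
Proof.
move=> uaL aLS mF F0.
have Sa : S a by apply: aLS; rewrite mem_head.
have LS i : i \in L -> S i by move=> iL; apply: aLS; rewrite inE iL orbT.
have [mxi lawxi] := xi_law Sa.
have mid := past_measurable LS.
pose g (w : T) : TL L * measurableTypeR R := (w, xi a w).
have mg : measurable_fun setT g by apply/measurable_fun_pair.
pose PL : probability (TL L) R :=
  distribution P (mfun_Sub (mem_set mid : (id : T -> TL L) \in mfun)).
transitivity (\int[pushforward P g]_p F p).
  by rewrite (ge0_integral_pushforward mg P (D := setT)).
transitivity (\int[PL \x gau]_p F p).
  apply: eq_measure_integral => X mX _.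
  pose m' : {measure set (TL L * measurableTypeR R) -> \bar R} :=
    measure_function_pushforward__canonical__measure_function_Measure P mg.
  apply/esym; apply: (product_measure_unique (m' := m')) => // A C mA mC.
  have m'E : m' (A `*` C) = P (A `&` xi a @^-1` C) by [].
  have mA' : <<s past L>> (A : set T) by exact: mA.
  have mC' : measurable (C : set R) by exact: mC.
  by rewrite m'E (past_indep uaL aLS mC' mA').
apply: (etrans (@fubini_tonelli1 _ _ (TL L) (measurableTypeR R) R PL gau F _ _)) => //.
apply: (etrans (ge0_integral_pushforward mid P (D := setT) _ _ _)) => //.
- exact: measurable_fun_fubini_tonelli_F.
- by move=> w _; exact: integral_ge0.
Qed.

Section vector.
Context {d : nat}.
Notation vec := 'rV[R]_d.
Notation e_ i := (delta_mx 0%R i : 'rV[R]_d).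
Variable A : 'I_d -> I.
Hypothesis Ainj : injective A.

Definition pvmeas (L : seq I) (Y : T -> vec) := forall i, pmeas L (fun w => Y w 0%R i).

Lemma pvmeas_mono L L' Y : {subset L <= L'} -> pvmeas L Y -> pvmeas L' Y.
Proof. by move=> LL' mY i; exact: pmeas_mono (mY i). Qed.

(** One coordinate is split off per step, and the others are integrated with it added to the past;
    [cond1] then integrates it. The weight [al] is what later makes covariances accessible. *)
Lemma cond_coords (l : seq 'I_d) (L : seq I) (al : T -> R) (Y : T -> vec) c (f : vec -> \bar R) :
  uniq l -> uniq L -> (forall a, a \in L -> S a) ->
  (forall i, i \in l -> S (A i) /\ A i \notin L) ->
  pmeas L al -> (forall w, 0 <= al w)%R -> pvmeas L Y -> mfv f -> (forall y, 0 <= f y) ->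
  \int[P]_w ((al w)%:E * f (Y w + \sum_(i <- l) (c * xi (A i) w) *: e_ i)%R) =
  \int[P]_w ((al w)%:E * smooths c l f (Y w)).
Proof.
move=> + + + + + al0 + mf f0.
elim: l L Y => [|i l IH] L Y /=.
  by move=> _ _ _ _ _ _; apply: eq_integral => w _; rewrite big_nil addr0.
move=> /andP[il ul] uL LS lS mal mY.
have [SAi AiL] := lS i (mem_head _ _).
have uL' : uniq (A i :: L) by rewrite /= AiL.
have LS' a : a \in A i :: L -> S a.
  by rewrite inE => /predU1P[->//|]; exact: LS.
have sub : {subset L <= A i :: L} by move=> a aL; rewrite inE aL orbT.
pose Y' w : vec := (Y w + (c * xi (A i) w) *: e_ i)%R.
have mY' : pvmeas (A i :: L) Y'.
  apply: (@vmeasD _ _ _ (TL (A i :: L))); first exact: pvmeas_mono mY.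
  apply: (@vmeasZ _ _ _ (TL (A i :: L))); last exact: vmeas_cst.
  by apply: measurable_funM => //; exact: (pmeas_xi (mem_head _ _)).
transitivity (\int[P]_w ((al w)%:E * f (Y' w + \sum_(j <- l) (c * xi (A j) w) *: e_ j)%R)).
  by apply: eq_integral => w _; rewrite big_cons addrA.
rewrite (IH (A i :: L))//; last 2 first.
- move=> j jl; have jil : j \in i :: l by rewrite inE jl orbT.
  have [SAj AjL] := lS j jil; split => //.
  by rewrite inE negb_or AjL andbT (inj_eq Ainj); apply: contraNneq il => <-.
- exact: pmeas_mono mal.
pose F (p : T * R) := (al p.1)%:E * smooths c l f (Y p.1 + (c * p.2) *: e_ i)%R.
transitivity (\int[P]_w \int[gau]_z F (w, z)); last first.
  apply: eq_integral => w _; rewrite /F/= ge0_integralZl//.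
  - by apply: mfv_line; exact: mfv_smooths.
  - by move=> z _; exact: smooths_ge0.
  - by rewrite lee_fin.
rewrite -(@cond1 L (A i) F)//; last first.
  by move=> p; rewrite mule_ge0// ?lee_fin//; exact: smooths_ge0.
apply: emeasurable_funM.
  by apply/measurable_EFinP; exact: (measurableT_comp mal measurable_fst).
apply: (@mfv_line2 _ _ _ (TL L)); last exact: mY.
exact: mfv_smooths.
Qed.

Definition noisevec (w : T) : vec := (\row_i xi (A i) w)%R.

(** The conditional expectation of f(Y + c Z) given the past is [gsm c f] at [Y], expressed by
    integration against weights known from the past. *)
Lemma cond_vec (L : seq I) (al : T -> R) (Y : T -> vec) c (f : vec -> \bar R) :
  uniq L -> (forall a, a \in L -> S a) ->
  (forall i, S (A i) /\ A i \notin L) ->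
  pmeas L al -> (forall w, 0 <= al w)%R -> pvmeas L Y -> mfv f -> (forall y, 0 <= f y) ->
  \int[P]_w ((al w)%:E * f (Y w + c *: noisevec w)%R) =
  \int[P]_w ((al w)%:E * gsm c f (Y w)).
Proof.
move=> uL LS AS mal al0 mY mf f0.
rewrite /gsm -(cond_coords c (enum_uniq 'I_d) uL LS _ mal al0 mY)//.
apply: eq_integral => w _; congr (_ * f (_ + _)%R).
rewrite -{1}(sum_delta_enum (c *: noisevec w)).
by apply: eq_bigr => i _; rewrite !mxE.
Qed.

End vector.

End conditioning.

(** * Expectations *)

Section expect.
Context {R : realType} {dT : measure_display} {T : measurableType dT}.
Variable P : probability T R.
Implicit Types (F G : T -> R) (c : R).

Definition integ F := P.-integrable setT (EFin \o F).
Local Notation E F := (Rintegral P setT F%R).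

Lemma integ_meas F : integ F -> measurable_fun setT F.
Proof. by move=> /integrableP[mF _]; apply/measurable_EFinP. Qed.

Lemma E_fin F : integ F -> (E F)%:E = (\int[P]_w (F w)%:E)%E.
Proof. by move=> iF; rewrite fineK//; exact: integrable_fin_num. Qed.

Lemma integ_intro F : measurable_fun setT F -> (\int[P]_w (`|F w|)%:E < +oo)%E -> integ F.
Proof. by move=> mF Foo; apply/integrableP; split => //; apply/measurable_EFinP. Qed.

Lemma integ_le F G : measurable_fun setT F -> (forall w, `|F w| <= G w) -> integ G -> integ F.
Proof.
move=> mF FG iG; apply: le_integrable iG => //; first exact/measurable_EFinP.
by move=> w _ /=; rewrite lee_fin (le_trans (FG w))// ler_norm.
Qed.

Lemma integ_cst c : integ (fun=> c).
Proof. exact: finite_measure_integrable_cst. Qed.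

Lemma integ_bdd F c : measurable_fun setT F -> (forall w, `|F w| <= c) -> integ F.
Proof. by move=> mF Fc; apply: (integ_le mF Fc); exact: integ_cst. Qed.

Lemma integD F G : integ F -> integ G -> integ (fun w => F w + G w).
Proof. by move=> iF iG; exact: (integrableD measurableT iF iG). Qed.

Lemma integZ c F : integ F -> integ (fun w => c * F w).
Proof. by move=> iF; exact: (integrableZl measurableT c iF). Qed.

Lemma integN F : integ F -> integ (fun w => - F w).
Proof. by move=> iF; exact: (integrableN iF). Qed.

Lemma integB F G : integ F -> integ G -> integ (fun w => F w - G w).
Proof. by move=> iF iG; apply: integD => //; exact: integN. Qed.

Lemma integ_sum (I : Type) (s : seq I) (F : I -> T -> R) : (forall i, integ (F i)) ->
  integ (fun w => \sum_(i <- s) F i w).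
Proof.
move=> iF; elim: s => [|i s IH].
  by under eq_fun do rewrite big_nil; exact: integ_cst.
by under eq_fun do rewrite big_cons; exact: integD.
Qed.

Lemma integ_abs F : integ F -> integ (fun w => `|F w|).
Proof.
move=> iF; apply: (@integ_le _ (fun w => `|F w|)) => //.
- by apply: measurableT_comp => //; exact: integ_meas.
- by move=> w; rewrite normr_id.
- exact: (integrable_norm iF).
Qed.

Lemma E_le F G : integ F -> integ G -> (forall w, F w <= G w) -> E F <= E G.
Proof. by move=> iF iG FG; apply: le_Rintegral => //. Qed.

Lemma E_cst c : E (fun=> c) = c.
Proof. by rewrite Rintegral_cst// [X in fine X](@probability_setT _ _ _ P) mulr1. Qed.

Lemma E_ge0 F : (forall w, 0 <= F w) -> 0 <= E F.
Proof. by move=> F0; apply: Rintegral_ge0. Qed.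

Lemma E_add F G : integ F -> integ G -> E (fun w => F w + G w) = E F + E G.
Proof. by move=> iF iG; rewrite RintegralD. Qed.

Lemma E_sub F G : integ F -> integ G -> E (fun w => F w - G w) = E F - E G.
Proof. by move=> iF iG; rewrite RintegralB. Qed.

Lemma E_scale c F : integ F -> E (fun w => c * F w) = c * E F.
Proof. by move=> iF; rewrite RintegralZl. Qed.

Lemma E_sum (I : Type) (s : seq I) (F : I -> T -> R) : (forall i, integ (F i)) ->
  E (fun w => \sum_(i <- s) F i w) = \sum_(i <- s) E (F i).
Proof.
move=> iF; elim: s => [|i s IH].
  rewrite big_nil -[RHS](E_cst 0); congr (Rintegral _ _ _).
  by apply/funext => w; rewrite big_nil.
rewrite big_cons -IH -E_add//; last exact: integ_sum.
by congr (Rintegral _ _ _); apply/funext => w; rewrite big_cons.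
Qed.

Lemma E_abs F : integ F -> `|E F| <= E (fun w => `|F w|).
Proof. by move=> iF; apply: le_normr_Rintegral. Qed.

Lemma E_abs_le F G : measurable_fun setT F -> integ G -> (forall w, `|F w| <= G w) -> `|E F| <= E G.
Proof.
move=> mF iG FG; have iF := integ_le mF FG iG.
by rewrite (le_trans (E_abs iF))//; apply: E_le => //; exact: integ_abs.
Qed.

Lemma E_abs_le_cst F c : measurable_fun setT F -> (forall w, `|F w| <= c) -> `|E F| <= c.
Proof. by move=> mF Fc; rewrite -(E_cst c); apply: E_abs_le => //; exact: integ_cst. Qed.

End expect.

(** * Gaussian moments and standard Gaussian vectors *)

Section gaussmoments.
Context {R : realType}.

(** The Cameron-Martin formula applied to the constant function 1. *)
Lemma gau_exp (k : R) : (\int[gau]_z (expR (k * z))%:E = (expR (k ^+ 2 / 2))%:E)%E.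
Proof.
have H := @gau_shift R k (fun=> 1%E) (measurable_cst _) (fun _ => lee01).
rewrite gau_cst in H.
transitivity (\int[gau]_z ((expR (k ^+ 2 / 2))%:E * (1 * (expR (k * z - k ^+ 2 / 2))%:E)))%E.
  by apply: eq_integral => z _; rewrite mul1e -EFinM -expRD addrC subrK.
rewrite ge0_integralZl//.
- by rewrite -H mule1.
- apply/measurable_funeM/measurable_EFinP; apply: measurableT_comp => //.
  by apply: measurable_funB => //; exact: measurable_funM.
Qed.

Lemma gau_exp_abs (k : R) : (\int[gau]_z (expR (k * `|z|))%:E < +oo)%E.
Proof.
have m1 (a : R) : measurable_fun setT (fun z : R => (expR (a * z))%:E).
  by apply/measurable_EFinP; apply: measurableT_comp => //; exact: measurable_funM.
apply: (@le_lt_trans _ _ (\int[gau]_z ((expR (k * z))%:E + (expR (- k * z))%:E))%E).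
  apply: ge0_le_integral => //.
  - apply/measurable_EFinP; apply: measurableT_comp => //.
    by apply: measurable_funM => //; exact: measurableT_comp.
  - by apply: emeasurable_funD; exact: m1.
  - move=> z _; rewrite -EFinD lee_fin.
    have [z0|z0] := leP 0 z; first by rewrite ger0_norm// lerDl expR_ge0.
    by rewrite ltr0_norm// mulrN mulNr lerDr expR_ge0.
rewrite ge0_integralD//; first by rewrite !gau_exp lte_add_pinfty// ltry.
- exact: m1.
- exact: m1.
Qed.

Context {d : nat}.
Notation vec := 'rV[R]_d.

(** The mean of f(Z) as a number tied to no probability space, so that constants built from it can
    be fixed before the space is given. *)
Definition gE (f : vec -> R) : R := fine (gsm 1 (EFin \o f) 0).

Lemma mfr_exp_n1 (k : R) : mfr (fun x : vec => expR (k * n1 x)).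
Proof.
apply: (@mfr_comp _ _ (fun t : R => expR (k * t))); last exact: mfr_n1.
by apply: measurableT_comp => //; exact: measurable_funM.
Qed.

Lemma gsm_exp_n1 (k : R) : (gsm 1 (EFin \o (fun x : vec => expR (k * n1 x))) 0 < +oo)%E.
Proof.
rewrite (_ : _ \o _ = fun x : vec => \prod_i (expR (k * `|x 0%R i|))%:E)%E; last first.
  apply/funext => x /=; rewrite prodEFin; congr EFin.
  by rewrite /n1 mulr_sumr expR_sum.
rewrite (@gsm_prod R d 1 (fun _ t => (expR (k * `|t|))%:E) 0)//; last first.
  move=> i; apply/measurable_EFinP; apply: measurableT_comp => //.
  by apply: measurable_funM => //; exact: measurableT_comp.
rewrite (eq_bigr (fun=> \int[gau]_z (expR (k * `|z|))%:E)%E); last first.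
  by move=> i _; apply: eq_integral => z _; rewrite mxE mul1r add0r.
have := gau_exp_abs k; have : (0 <= \int[gau]_z (expR (k * `|z|))%:E)%E.
  by apply: integral_ge0 => z _; rewrite lee_fin expR_ge0.
case: (\int[gau]_z (expR (k * `|z|))%:E)%E => [r| |]// _ _.
by rewrite prodEFin ltry.
Qed.

End gaussmoments.

Section W.
Context {R : realType} {d : nat} {dT : measure_display} {T : measurableType dT}.
Variables (P : probability T R) (W : T -> 'rV[R]_d).
Hypothesis hW : std_gauss_vec P W.
Notation vec := 'rV[R]_d.
Local Notation E F := (Rintegral P setT F%R).
Local Notation integ := (integ P).

Lemma gaussEE (g : vec -> R) : gaussE P W g = E (fun w => g (W w)).
Proof. by rewrite /gaussE unlock. Qed.

Lemma vmeasW : vmeas W.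
Proof. by move=> i; case: hW => /(_ i)[]. Qed.

(** This is [cond_vec] with an empty past, the noises being the coordinates of [W]. *)
Lemma integral_W c x (f : vec -> \bar R) : mfv f -> (forall y, 0 <= f y)%E ->
  (\int[P]_w f (x + c *: W w)%R = gsm c f x)%E.
Proof.
move=> mf f0; case: hW => law ind.
have H := @cond_vec R dT T P _ setT (fun i w => W w 0 i) (fun a _ => law a) ind d id
  (@inj_id _) [::] (fun=> 1) (fun=> x) c f isT.
transitivity (\int[P]_w (1 * f (x + c *: noisevec (fun i w => W w 0 i) id w)%R))%E.
  apply: eq_integral => w _; rewrite mul1e; congr (f (_ + _ *: _)).
  by apply/rowP => i; rewrite mxE.
rewrite H//; last first.
- by move=> i; exact: measurable_cst.
- exact: measurable_cst.
under eq_integral do rewrite mul1e.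
by rewrite integral_cst// [X in (_ * X)%E]probability_setT mule1.
Qed.

Lemma measW (f : vec -> R) : mfr f -> measurable_fun setT (fun w => f (W w)).
Proof. by move=> mf; exact: mf vmeasW. Qed.

Lemma E_gE (f : vec -> R) : mfr f -> (forall y, 0 <= f y) -> E (fun w => f (W w)) = gE f.
Proof.
move=> mf f0; rewrite /gE /Rintegral -(integral_W 1 0 (mfr_mfv mf))//.
by congr fine; apply: eq_integral => w _; rewrite /= add0r scale1r.
Qed.

Lemma integ_exp_n1 k : integ (fun w => expR (k * n1 (W w))).
Proof.
apply: integ_intro; first exact: (measW (mfr_exp_n1 k)).
under eq_integral do rewrite ger0_norm ?expR_ge0//.
have := @gsm_exp_n1 R d k; rewrite -(integral_W 1 0 (mfr_mfv (mfr_exp_n1 k)))//=.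
by under eq_integral do rewrite add0r scale1r.
Qed.

Lemma integ_expdom (f : vec -> R) K k : mfr f -> (forall x, `|f x| <= K * expR (k * n1 x)) ->
  integ (fun w => f (W w)).
Proof.
move=> mf fK; apply: (integ_le (G := fun w => K * expR (k * n1 (W w)))) => //.
  exact: measW.
by apply: integZ; exact: integ_exp_n1.
Qed.

Lemma E_conv (a b : R) (x : vec) (f : vec -> R) K : 0 <= a -> 0 <= b -> mfr f -> (forall y, `|f y| <= K) ->
  E (fun w => E (fun w' => f (x + a *: W w + b *: W w'))) =
  E (fun w => f (x + Num.sqrt (a ^+ 2 + b ^+ 2) *: W w)).
Proof.
move=> a0 b0 mf fK.
(* The rules for [gsm] concern nonnegative functions; the added constant is subtracted at the
   end. *)
pose h y := f y + K.
have h0 y : 0 <= h y by rewrite /h -lerBlDr sub0r; have := fK y; rewrite ler_norml => /andP[].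
have mh : mfr h by apply: mfrD => //; exact: mfr_cst.
have hK y : `|h y| <= K + K by rewrite (le_trans (ler_normD _ _))// lerD// ger0_norm// (le_trans _ (fK y)).
have mfa c (y : vec) : measurable_fun setT (fun w => f (y + c *: W w)).
  exact: (measW (mfr_affine c y mf)).
have mha c (y : vec) : measurable_fun setT (fun w => h (y + c *: W w)).
  exact: (measW (mfr_affine c y mh)).
have ifa c (y : vec) : integ (fun w => f (y + c *: W w)) by exact: integ_bdd (fun w => fK _).
have iha c (y : vec) : integ (fun w => h (y + c *: W w)) by exact: integ_bdd (fun w => hK _).
have EhE c (y : vec) : E (fun w => h (y + c *: W w)) = E (fun w => f (y + c *: W w)) + K.
  by rewrite -[in RHS](E_cst P K) -E_add//; exact: integ_cst.
have gh c (y : vec) : gsm c (EFin \o h) y = (E (fun w => h (y + c *: W w)))%:E.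
  by rewrite E_fin// -integral_W//; exact: mfr_mfv.
have mp : mfr (fun y => E (fun w => h (y + b *: W w))).
  move=> dT' T' Y mY; apply/measurable_EFinP.
  rewrite (_ : _ \o _ = fun w => gsm b (EFin \o h) (Y w)); last by apply/funext => w; rewrite gh.
  by apply: mfv_gsm => //; exact: mfr_mfv.
have H : E (fun w => E (fun w' => h (x + a *: W w + b *: W w'))) =
  E (fun w => h (x + Num.sqrt (a ^+ 2 + b ^+ 2) *: W w)).
  apply: EFin_inj; rewrite -gh -gsm_conv//; last exact: mfr_mfv.
  rewrite E_fin; last first.
    apply: (@integ_bdd _ _ _ P _ (K + K)); first exact: (measW (mfr_affine a x mp)).
    by move=> w; apply: E_abs_le_cst.
  rewrite -integral_W; first by apply: eq_integral => w _; rewrite gh.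
  - by apply: mfv_gsm => //; exact: mfr_mfv.
  - by move=> y; apply: gsm_ge0.
move: H; rewrite EhE => /(congr1 (fun t => t - K)); rewrite addrK => <-.
rewrite -[in X in _ = _ - X](E_cst P K) -E_sub//; last 2 first.
- apply: (@integ_bdd _ _ _ P _ (K + K)); first exact: (measW (mfr_affine a x mp)).
  by move=> w; apply: E_abs_le_cst.
- exact: integ_cst.
by congr (Rintegral _ _ _); apply/funext => w; rewrite EhE addrK.
Qed.

Lemma E_shift c (a x : vec) (f : vec -> R) K : 0 < c -> mfr f -> (forall y, 0 <= f y <= K) ->
  E (fun w => f (x + a + c *: W w)) =
  E (fun w => f (x + c *: W w) *
    expR (\sum_i (a 0 i / c * W w 0 i - (a 0 i / c) ^+ 2 / 2))).
Proof.
move=> c0 mf fK; rewrite /Rintegral; congr fine.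
have f0 y : 0 <= f y by case/andP: (fK y).
rewrite (@integral_W c (x + a) (EFin \o f))//; last exact: mfr_mfv.
rewrite gsm_shift//; last exact: mfr_mfv.
rewrite -integral_W.
- apply: eq_integral => w _; rewrite EFinM muleC; congr (_ * (expR _)%:E)%E.
  apply: eq_bigr => i _; rewrite !mxE.
  by field; rewrite gt_eqF.
- move=> dT' T' Y mY; apply: emeasurable_funM; last exact: mfr_mfv.
  apply/measurable_EFinP; apply: measurableT_comp => //.
  apply: measurable_sum => i.
  apply: measurable_funB => //; apply: measurable_funM => //.
  by apply: measurable_funM => //; apply: measurable_funB.
- by move=> y; rewrite mule_ge0// lee_fin// expR_ge0.
Qed.

Lemma ler_n1_exp (x : vec) : n1 x <= expR (n1 x).
Proof. by rewrite (le_trans _ (expR_ge1Dx _))// lerDr. Qed.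

Lemma integ_n1 : integ (fun w => n1 (W w)).
Proof.
apply: (@integ_expdom _ 1 1); first exact: mfr_n1.
by move=> x; rewrite !mul1r ger0_norm ?n1_ge0// ler_n1_exp.
Qed.

Lemma integ_n1_sq : integ (fun w => n1 (W w) ^+ 2).
Proof.
apply: (@integ_expdom (fun x => n1 x ^+ 2) 1 2).
  by apply: (@mfr_comp _ _ (fun t => t ^+ 2)); [exact: measurable_funX|exact: mfr_n1].
move=> x; rewrite mul1r ger0_norm ?sqr_ge0// mulrC expRM_natr.
by rewrite lerXn2r ?nnegrE ?n1_ge0 ?expR_ge0// ler_n1_exp.
Qed.

Lemma integ_coord i : integ (fun w => W w 0 i).
Proof.
apply: (integ_le (G := fun w => n1 (W w))); [exact: vmeasW| |exact: integ_n1].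
by move=> w; exact: ler_coord_n1.
Qed.

Lemma E_exp_coord i k : E (fun w => expR (k * W w 0 i)) = expR (k ^+ 2 / 2).
Proof.
have H := @E_shift 1 (k *: delta_mx 0 i) 0 (fun=> 1) 1 ltr01 (mfr_cst _) _.
have {H} : 1 = E (fun w => expR (- (k ^+ 2 / 2)) * expR (k * W w 0 i)).
  rewrite -{1}(E_cst P 1) H; last by move=> _; rewrite ler01 lexx.
  congr (Rintegral _ _ _); apply/funext => w; rewrite mul1r -expRD; congr expR.
  rewrite (bigD1 i)//= big1 ?addr0; last first.
    move=> j ji; rewrite !mxE eqxx/= (negbTE ji) mulr0 divr1 mul0r expr0n/=.
    by rewrite mul0r subrr.
  by rewrite !mxE !eqxx/= mulr1 divr1 addrC.
rewrite E_scale => [H|]; last first.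
  apply: (@integ_expdom (fun x => expR (k * x 0 i)) 1 `|k|).
    apply: (@mfr_comp _ _ (fun t => expR (k * t))); last exact: mfr_coord.
    by apply: measurableT_comp => //; exact: measurable_funM.
  move=> x; rewrite mul1r ger0_norm ?expR_ge0// ler_expR.
  by rewrite (le_trans (ler_norm _))// normrM ler_wpM2l// ler_coord_n1.
by rewrite -[LHS]mul1r -[in LHS](expRxMexpNx_1 (k ^+ 2 / 2)) -mulrA -H mulr1.
Qed.

Lemma expR_le_1D2x (s : R) : 0 <= s <= 1 / 2 -> expR s <= 1 + 2 * s.
Proof.
move=> /andP[s0 s1].
have h : 1 - s <= expR (- s) by have := expR_ge1Dx (- s).
have s1' : 0 < 1 - s by lra.
rewrite -[s in expR s]opprK expRN.
rewrite (le_trans (y := (1 - s)^-1))//; first by rewrite lef_pV2// posrE ?expR_gt0.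
rewrite -[(1 - s)^-1]mul1r ler_pdivrMr//; nra.
Qed.

(** The moment generating function decides: with m the mean, 1 + k m <= exp (k^2 / 2) <= 1 + k^2 for
    |k| <= 1. The choice k = m / (1 + |m|) then forces m^2 |m| <= 0. *)
Lemma E_coord i : E (fun w => W w 0 i) = 0.
Proof.
set m := (X in X = 0).
have key k : `|k| <= 1 -> k * m <= k ^+ 2.
  move=> k1.
  have k2 : k ^+ 2 <= 1 by rewrite -real_normK ?num_real// exprn_ile1.
  have : 1 + k * m <= expR (k ^+ 2 / 2).
    rewrite -(E_exp_coord i) /m -E_scale; last exact: integ_coord.
    rewrite -[X in X + _](E_cst P) -E_add; last 2 first.
    - exact: integ_cst.
    - by apply: integZ; exact: integ_coord.
    apply: E_le => //.
    - by apply: integD; [exact: integ_cst|apply: integZ; exact: integ_coord].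
    - apply: (@integ_expdom (fun x => expR (k * x 0 i)) 1 `|k|).
        apply: (@mfr_comp _ _ (fun t => expR (k * t))); last exact: mfr_coord.
        by apply: measurableT_comp => //; exact: measurable_funM.
      move=> x; rewrite mul1r ger0_norm ?expR_ge0// ler_expR.
      by rewrite (le_trans (ler_norm _))// normrM ler_wpM2l// ler_coord_n1.
    - by move=> w; exact: expR_ge1Dx.
  have k20 : 0 <= k ^+ 2 by exact: sqr_ge0.
  have : expR (k ^+ 2 / 2) <= 1 + 2 * (k ^+ 2 / 2).
    by apply: expR_le_1D2x; apply/andP; split; lra.
  lra.
have m1 : 0 < 1 + `|m| by rewrite ltr_pwDl.
have H : `|m / (1 + `|m|)| <= 1.
  by rewrite normrM normfV [`|1 + _|]ger0_norm ?(ltW m1)// ler_pdivrMr// mul1r lerDr ler01.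
have := key _ H.
rewrite mulrAC exprMn exprVn -expr2 ler_pdivlMr ?exprn_gt0//.
rewrite (expr2 (1 + _)) mulrA divfK ?gt_eqF// mulrDr mulr1 gerDl => h.
apply/eqP; rewrite -normr_eq0.
have : m ^+ 2 * `|m| = 0.
  by apply/eqP; rewrite eq_le h mulr_ge0// sqr_ge0.
by move/eqP; rewrite mulf_eq0 sqrf_eq0 normr_eq0 orbb.
Qed.

End W.

(** * One Euler step *)

Section expbounds.
Context {R : realType}.
Implicit Types (v r s q t : R).

Lemma expR_taylor2 v r : `|v| <= r -> `|expR v - 1 - v| <= v ^+ 2 * expR r.
Proof.
move=> vr.
have h1 : 0 <= expR v - 1 - v by have := expR_ge1Dx v; lra.
rewrite ger0_norm//.
have h2 : expR v - 1 <= v * expR v.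
  have := expR_ge1Dx (- v); rewrite -(ler_pM2r (expR_gt0 v)) expRN mulVf ?gt_eqF ?expR_gt0//.
  by lra.
have h3 : expR v - 1 - v <= v * (expR v - 1) by rewrite mulrBr mulr1 lerB.
apply: (le_trans h3).
have [v0|v0] := leP 0 v.
  rewrite (le_trans (ler_wpM2l v0 h2))// expr2 mulrA ler_wpM2l ?mulr_ge0//.
  by rewrite ler_expR (le_trans _ vr)// ler_norm.
have : 1 <= expR r by rewrite -expR0 ler_expR (le_trans _ vr).
have := expR_ge1Dx v; have := sqr_ge0 v; move: (expR v) (expR r) => a b.
move=> v2 va b1; nra.
Qed.

(** Here exp (s - q) is a Cameron-Martin ratio: [e] is the size of the drift per unit of noise, [t]
    the l1 norm of the noise, [n] the dimension. The correction [q] is already of order e^2, so only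
    [s] survives at first order. *)
Lemma exp_drift_bound (e t n s q : R) : 0 <= e <= 1 -> 0 <= t -> 0 <= n ->
  `|s| <= e * t -> 0 <= q <= e ^+ 2 * n / 2 ->
  `|expR (s - q) - 1 - s| <= e ^+ 2 * ((t + n) ^+ 2 * expR (t + n) + n).
Proof.
move=> /andP[e0 e1] t0 n0 st /andP[q0 qn].
have qn' : q <= e * n.
  rewrite (le_trans qn)// expr2 -!mulrA ler_wpM2l//.
  by rewrite mulrA ler_pdivrMr// mulrC; nra.
have sq : `|s - q| <= e * (t + n).
  by rewrite (le_trans (ler_normB _ _))// mulrDr lerD// ger0_norm.
have sq' : `|s - q| <= t + n.
  by rewrite (le_trans sq)// ler_piMl// addr_ge0.
have h := expR_taylor2 sq'.
rewrite (_ : expR _ - 1 - s = (expR (s - q) - 1 - (s - q)) - q); last by ring.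
rewrite (le_trans (ler_normB _ _))// mulrDr lerD//.
  rewrite (le_trans h)// mulrA ler_wpM2r ?expR_ge0//.
  by rewrite -exprMn -real_normK ?num_real// lerXn2r// nnegrE// mulr_ge0// addr_ge0.
rewrite ger0_norm// (le_trans qn)// ler_pdivrMr//.
have : 0 <= e ^+ 2 * n by rewrite mulr_ge0// sqr_ge0.
lra.
Qed.

End expbounds.

Section kappa.
Context {R : realType} (d : nat).
Notation vec := 'rV[R]_d.
Implicit Types (x y : vec) (c t : R).

(* The moments E|Z|_1 and E|Z|_1^2 of a standard Gaussian vector Z. *)
Definition m1d : R := gE (fun x : vec => n1 x).
Definition m2d : R := gE (fun x : vec => n1 x ^+ 2).

(* Growth in [t] = |z|_1 of the error [rho z] of a step, once the factor
   [c0 ^+ 2 * (B ^+ 2 + L / xi)] is taken out. *)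
Definition kappa (t : R) : R :=
  (t + d%:R) ^+ 2 * expR (t + d%:R) + d%:R + (t ^+ 2 + m2d + m1d * t).

(** The extra factor [n1 x] comes from the Lipschitz increment of [ufun] that multiplies [rho] in
    [one_step]. *)
Definition Kd : R := gE (fun x : vec => n1 x * kappa (n1 x)).

Lemma m1d_ge0 : 0 <= m1d.
Proof. by apply/fine_ge0/gsm_ge0 => y; rewrite lee_fin n1_ge0. Qed.

Lemma m2d_ge0 : 0 <= m2d.
Proof. by apply/fine_ge0/gsm_ge0 => y; rewrite lee_fin sqr_ge0. Qed.

Lemma kappa_ge0 t : 0 <= t -> 0 <= kappa t.
Proof.
move=> t0; have := m1d_ge0; have := m2d_ge0 => h1 h2.
apply: addr_ge0.
  by apply: addr_ge0 => //; apply: mulr_ge0; [exact: sqr_ge0|exact: expR_ge0].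
by apply: addr_ge0; [apply: addr_ge0 => //; exact: sqr_ge0|exact: mulr_ge0].
Qed.

Lemma Kd_ge0 : 0 <= Kd.
Proof.
by apply/fine_ge0/gsm_ge0 => y; rewrite lee_fin mulr_ge0 ?n1_ge0// kappa_ge0// n1_ge0.
Qed.

Lemma measurable_kappa : measurable_fun setT kappa.
Proof.
apply: measurable_funD.
  apply: measurable_funD => //; apply: measurable_funM.
    by apply: measurable_funX; exact: measurable_funD.
  by apply: measurableT_comp => //; exact: measurable_funD.
apply: measurable_funD; last exact: measurable_funM.
by apply: measurable_funD => //; exact: measurable_funX.
Qed.

Lemma mfr_kappa : mfr (fun x : vec => n1 x * kappa (n1 x)).
Proof.
apply: (@mfr_comp _ _ (fun t => t * kappa t)); last exact: mfr_n1.
by apply: measurable_funM => //; exact: measurable_kappa.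
Qed.

(** With e = exp t, both t and 1 are at most e, so each summand is at most a constant times e^4.
    This makes the moment [Kd] finite. *)
Lemma kappa_exp_bound : exists K, forall t, 0 <= t -> t * kappa t <= K * expR (4 * t).
Proof.
exists ((1 + d%:R) ^+ 2 * expR d%:R + d%:R + (1 + m2d + m1d)) => t t0.
have h1 := m1d_ge0; have h2 := m2d_ge0.
have d0 : 0 <= d%:R :> R by [].
rewrite mulrC (_ : 4 * t = t * 4)%R; last by rewrite mulrC.
rewrite expRM_natr /kappa expRD.
have := expR_ge1Dx t; have := @expR_ge0 _ (d%:R : R).
set e := expR t; set k := expR d%:R => k0 et.
have te : t <= e by lra.
have e1 : 1 <= e by lra.
have e0 : 0 <= e by lra.
have te2 : t + d%:R <= (1 + d%:R) * e by nra.
have tee : t * e <= e ^+ 2 by nra.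
have e2 : e <= e ^+ 2 by nra.
have e3 : e ^+ 2 <= e ^+ 4 by exact: ler_weXn2l.
have e4 : e ^+ 3 <= e ^+ 4 by exact: ler_weXn2l.
rewrite !mulrDl; apply: lerD; first apply: lerD.
- have : (t + d%:R) ^+ 2 <= ((1 + d%:R) * e) ^+ 2.
    by rewrite lerXn2r ?nnegrE ?mulr_ge0 ?addr_ge0.
  rewrite exprMn => h.
  rewrite (_ : (t + d%:R) ^+ 2 * (e * k) * t = k * ((t + d%:R) ^+ 2 * (t * e))); last by ring.
  rewrite (_ : (1 + d%:R) ^+ 2 * k * e ^+ 4 = k * ((1 + d%:R) ^+ 2 * e ^+ 2 * e ^+ 2)); last by ring.
  by rewrite ler_wpM2l// ler_pM ?sqr_ge0 ?mulr_ge0.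
- by rewrite ler_wpM2l//; lra.
- apply: lerD; first apply: lerD.
  + rewrite mul1r -exprSr (le_trans _ e4)// lerXn2r//.
  + by rewrite ler_wpM2l//; lra.
  + rewrite -mulrA ler_wpM2l// -expr2 (le_trans _ e3)// lerXn2r//.
Qed.

End kappa.

Section onestep.
Context {R : realType} {d : nat} {dT : measure_display} {T : measurableType dT}.
Variables (P : probability T R) (W : T -> 'rV[R]_d).
Hypothesis hW : std_gauss_vec P W.
Notation vec := 'rV[R]_d.
Implicit Types (x y : vec) (c t : R).
Local Notation E F := (Rintegral P setT F%R).
Local Notation integ := (integ P).

Lemma E_m1 : E (fun w => n1 (W w)) = m1d d.
Proof. by apply: (E_gE hW) => [|x]; [exact: mfr_n1|exact: n1_ge0]. Qed.

Lemma mfr_n1_sq : mfr (fun x : vec => n1 x ^+ 2).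
Proof. by apply: (@mfr_comp _ _ (fun t => t ^+ 2)); [exact: measurable_funX|exact: mfr_n1]. Qed.

Lemma E_m2 : E (fun w => n1 (W w) ^+ 2) = m2d d.
Proof. by apply: (E_gE hW mfr_n1_sq) => x; exact: sqr_ge0. Qed.

Lemma E_Kd : E (fun w => n1 (W w) * kappa d (n1 (W w))) = Kd d.
Proof.
rewrite /Kd -(E_gE hW (@mfr_kappa R d))// => x.
by rewrite mulr_ge0 ?n1_ge0// kappa_ge0// n1_ge0.
Qed.

Lemma integ_kappa : integ (fun w => n1 (W w) * kappa d (n1 (W w))).
Proof.
have [K hK] := @kappa_exp_bound R d.
apply: (@integ_expdom _ _ _ _ _ _ hW (fun x => n1 x * kappa d (n1 x)) K 4 (@mfr_kappa R d)) => x.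
rewrite ger0_norm ?mulr_ge0 ?n1_ge0 ?kappa_ge0 ?n1_ge0//.
exact/hK/n1_ge0.
Qed.

Section smoothed.
Variables (F : vec -> R) (K M : R).
Hypotheses (FK : lip K F) (FM : forall x, `|F x| <= M).

Lemma meas_sm c x : measurable_fun setT (fun w => F (x + c *: W w)).
Proof. exact: (measW hW (mfr_affine c x (lip_mfr FK))). Qed.

Lemma integ_sm c x : integ (fun w => F (x + c *: W w)).
Proof. exact: (integ_bdd P (meas_sm c x) (fun w => FM _)). Qed.

Lemma E_sm_lip c : lip K (fun x => E (fun w => F (x + c *: W w))).
Proof.
move=> x y; rewrite -E_sub; [|exact: integ_sm|exact: integ_sm].
apply: E_abs_le_cst => [|w].
  by apply: measurable_funB; exact: meas_sm.
by rewrite (le_trans (FK _ _))// opprD addrACA subrr addr0.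
Qed.

Lemma E_sm_lipc c c' x : 0 <= K ->
  `|E (fun w => F (x + c *: W w)) - E (fun w => F (x + c' *: W w))| <= K * `|c - c'| * m1d d.
Proof.
move=> K0; rewrite -E_sub; [|exact: integ_sm|exact: integ_sm].
rewrite -E_m1 -(E_scale _ (integ_n1 hW)).
apply: E_abs_le => [||w].
- by apply: measurable_funB; exact: meas_sm.
- by apply: integZ; exact: integ_n1.
- rewrite (le_trans (FK _ _))// opprD addrACA subrr add0r -scalerBl n1Z.
  by rewrite mulrA.
Qed.

Lemma E_sm_bound c x : `|E (fun w => F (x + c *: W w))| <= M.
Proof. by apply: E_abs_le_cst => [|w]; [exact: meas_sm|exact: FM]. Qed.

End smoothed.

(** In the application [f] is [fhat] and [D] its gradient. [B] bounds the logarithmic derivatives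
    [D i / f], and [L] serves both as Lipschitz constant of the gradient and in the second-order
    Taylor remainder. *)
Variables (f g : vec -> R) (D : 'I_d -> vec -> R) (xi zeta B L Lf Lg : R).
Hypotheses (xi0 : 0 < xi) (fb : forall x, xi <= f x <= zeta) (flip : lip Lf f)
  (glip : lip Lg g) (g01 : forall x, 0 <= g x <= 1)
  (Dlip : forall i, lip L (D i)) (DB : forall i x, `|D i x| <= B * f x)
  (B0 : 0 <= B) (L0 : 0 <= L) (Lf0 : 0 <= Lf) (Lg0 : 0 <= Lg)
  (taylor : forall x y, `|f (x + y) - f x - \sum_i D i x * y 0 i| <= L * n1 y ^+ 2).

(* [bdrift] is the drift of the diffusion, and [ufun] the ratio u_c of the header. *)
Definition phi c x := E (fun w => f (x + c *: W w)).
Definition hfun c x := E (fun w => g (x + c *: W w) * f (x + c *: W w)).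
Definition Dm c i x := E (fun w => D i (x + c *: W w)).
Definition bdrift c x : vec := \row_i (Dm c i x / phi c x).
Definition ufun c x := hfun c x / phi c x.
(** A Lipschitz constant of [ufun]: the numerator contributes [Lg * zeta + Lf], the denominator
    another [Lf] because the quotient is at most 1. *)
Definition Lu := (Lg * zeta + 2 * Lf) / xi.

Let f0 x : 0 <= f x. Proof. by have /andP[+ _] := fb x; apply: le_trans; exact: ltW. Qed.
Let fz x : `|f x| <= zeta. Proof. by rewrite ger0_norm//; case/andP: (fb x). Qed.
Let zeta0 : 0 <= zeta. Proof. by rewrite (le_trans _ (fz 0)). Qed.
Let Lu0 : 0 <= Lu. Proof. by rewrite divr_ge0 ?addr_ge0 ?mulr_ge0// ltW. Qed.

Let gf := fun x => g x * f x.

Let gflip : lip (Lg * zeta + Lf) gf.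
Proof.
move=> x y; rewrite /gf (_ : _ - _ = (g x - g y) * f x + g y * (f x - f y)); last by ring.
rewrite (le_trans (ler_normD _ _))// [leRHS]mulrDl; apply: lerD; rewrite normrM.
  by rewrite mulrAC ler_pM.
rewrite -[leRHS]mul1r ler_pM//.
by have /andP[? ?] := g01 y; rewrite ger0_norm.
Qed.

Let gfz x : `|gf x| <= zeta.
Proof.
have /andP[? ?] := g01 x.
by rewrite normrM -[leRHS]mul1r ler_pM// ger0_norm.
Qed.

Let Dz i x : `|D i x| <= B * zeta.
Proof. by rewrite (le_trans (DB i x))// ler_wpM2l//; case/andP: (fb x). Qed.

Lemma phi_bounds c x : xi <= phi c x <= zeta.
Proof.
have i1 := integ_sm flip fz c x.
apply/andP; split.
  rewrite -(E_cst P xi); apply: E_le => // [|w]; first exact: integ_cst.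
  by case/andP: (fb (x + c *: W w)).
rewrite -(E_cst P zeta); apply: E_le => // [|w]; first exact: integ_cst.
by case/andP: (fb (x + c *: W w)).
Qed.

Let phi0 c x : 0 < phi c x. Proof. by case/andP: (phi_bounds c x) => + _; exact: lt_le_trans. Qed.

Lemma phi_lip c : lip Lf (phi c). Proof. exact: (E_sm_lip flip fz). Qed.

Lemma ufun_range c x : 0 <= ufun c x <= 1.
Proof.
rewrite divr_ge0 ?(ltW (phi0 _ _))//=; last first.
  by apply: E_ge0 => w; rewrite mulr_ge0//; case/andP: (g01 (x + c *: W w)).
rewrite ler_pdivrMr// mul1r; apply: E_le => [||w].
- exact: (integ_sm gflip gfz).
- exact: (integ_sm flip fz).
- by rewrite ler_piMl//; case/andP: (g01 (x + c *: W w)).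
Qed.

Lemma ufun_lip c : lip Lu (ufun c).
Proof.
move=> x y; have px := phi0 c x; have py := phi0 c y.
have hlip := E_sm_lip gflip gfz c x y; have plip := phi_lip c y x.
rewrite (_ : ufun c x - ufun c y = ((hfun c x - hfun c y) + ufun c y * (phi c y - phi c x)) / phi c x); last first.
  by rewrite /ufun; field; rewrite !gt_eqF.
rewrite normrM normfV [X in _ / X]gtr0_norm// ler_pdivrMr//.
apply: (@le_trans _ _ ((Lg * zeta + 2 * Lf) * n1 (x - y))).
  rewrite (le_trans (ler_normD _ _))// (_ : 2 * Lf = Lf + Lf); last by ring.
  rewrite addrA mulrDl; apply: lerD => //; rewrite normrM n1B -[leRHS]mul1r ler_pM//.
  by have /andP[? ?] := ufun_range c y; rewrite ger0_norm.
have h : 1 <= phi c x / xi by rewrite ler_pdivlMr// mul1r; case/andP: (phi_bounds c x).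
have -> : Lu * n1 (x - y) * phi c x = (Lg * zeta + 2 * Lf) * n1 (x - y) * (phi c x / xi).
  by rewrite /Lu; field; rewrite gt_eqF.
by rewrite ler_peMr// mulr_ge0 ?n1_ge0// addr_ge0// mulr_ge0.
Qed.

(** The pointwise bound |D| <= B f survives averaging, so the drift is bounded without any factor
    zeta / xi. *)
Lemma bdrift_bound c x i : `|bdrift c x 0 i| <= B.
Proof.
rewrite mxE normrM normfV [X in _ / X]gtr0_norm// ler_pdivrMr//.
rewrite -E_scale; last exact: (integ_sm flip fz).
apply: E_abs_le => [||w].
- exact: (meas_sm (@Dlip i)).
- by apply: integZ; exact: (integ_sm flip fz).
- exact: DB.
Qed.

Let Dm_lip c i : lip L (Dm c i).
Proof. exact: (E_sm_lip (@Dlip i) (Dz i)). Qed.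

Let Dm_bound c i x : `|Dm c i x| <= B * zeta.
Proof. exact: (E_sm_bound (@Dlip i) (Dz i)). Qed.

Let phi_taylor c x y : `|phi c (x + y) - phi c x - \sum_i Dm c i x * y 0 i| <= L * n1 y ^+ 2.
Proof.
have iD i : integ (fun w => y 0 i * D i (x + c *: W w)).
  by apply: integZ; exact: (integ_sm (@Dlip i) (Dz i)).
have -> : \sum_i Dm c i x * y 0 i = E (fun w => \sum_i y 0 i * D i (x + c *: W w)).
  rewrite E_sum//; apply: eq_bigr => i _; rewrite E_scale 1?mulrC//.
  exact: (integ_sm (@Dlip i) (Dz i)).
rewrite -E_sub; [|exact: (integ_sm flip fz)|exact: (integ_sm flip fz)].
rewrite -E_sub; last 2 first.
- by apply: integB; exact: (integ_sm flip fz).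
- exact: integ_sum.
apply: E_abs_le_cst => [|w].
  apply: measurable_funB; first by apply: measurable_funB; exact: (meas_sm flip).
  by apply: measurable_sum => i; apply: measurable_funM => //; exact: (meas_sm (@Dlip i)).
rewrite (_ : x + y + c *: W w = (x + c *: W w) + y); last by rewrite addrAC.
rewrite (eq_bigr (fun i => D i (x + c *: W w) * y 0 i)); last by move=> i _; rewrite mulrC.
exact: taylor.
Qed.

Section step.
Variables (c0 c' : R) (x : vec).
Hypotheses (c00 : 0 < c0) (c'0 : 0 <= c') (c0B : c0 * B <= 1).
(** [c0] is the standard deviation of the step, [c'] that of the noise remaining after it, and [c]
    that of the noise remaining before it. *)
Let c := Num.sqrt (c0 ^+ 2 + c' ^+ 2).
Let b := bdrift c x.
Let Fx := phi c x.

Let phi_conv : Fx = E (fun w => phi c' (x + c0 *: W w)).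
Proof. by rewrite /Fx /phi /c -(E_conv hW x (ltW c00) c'0 (lip_mfr flip) fz). Qed.

Let Dm_conv i : Dm c i x = E (fun w => Dm c' i (x + c0 *: W w)).
Proof. by rewrite /Dm /c -(E_conv hW x (ltW c00) c'0 (lip_mfr (@Dlip i)) (Dz i)). Qed.

Let hfun_conv : hfun c x = E (fun w => hfun c' (x + c0 *: W w)).
Proof. by rewrite /hfun /c -(E_conv hW x (ltW c00) c'0 (lip_mfr gflip) gfz). Qed.

Let phiz c1 y : `|phi c1 y| <= zeta.
Proof. by rewrite ger0_norm ?(ltW (phi0 _ _))//; case/andP: (phi_bounds c1 y). Qed.

Let iphi : integ (fun w => phi c' (x + c0 *: W w)).
Proof. exact: (integ_sm (phi_lip c') (phiz c')). Qed.

(** The linear term of the Taylor expansion has mean 0; it is subtracted under the expectation, and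
    the remainder is quadratic. *)
Let phi_step : `|Fx - phi c' x| <= L * c0 ^+ 2 * m2d d.
Proof.
have iD i : integ (fun w => Dm c' i x * c0 * W w 0 i).
  by apply: integZ; exact: integ_coord.
have h0 : E (fun w => \sum_i Dm c' i x * c0 * W w 0 i) = 0.
  rewrite E_sum// big1// => i _; rewrite E_scale ?E_coord ?mulr0//.
  exact: integ_coord.
rewrite -[Fx - _]subr0 -h0 phi_conv -[X in _ - X - _](E_cst P).
rewrite -E_sub; [|exact: iphi|exact: integ_cst].
rewrite -E_sub; last 2 first.
- by apply: integB; [exact: iphi|exact: integ_cst].
- exact: integ_sum.
rewrite -E_m2 -E_scale; last exact: (integ_n1_sq hW).
apply: E_abs_le => [||w].
- apply: measurable_funB; last by apply: measurable_sum => i; exact: (integ_meas (iD i)).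
  by apply: measurable_funB => //; exact: (integ_meas iphi).
- by apply: integZ; exact: integ_n1_sq.
- rewrite (eq_bigr (fun i => Dm c' i x * (c0 *: W w) 0 i)); last first.
    by move=> i _; rewrite mxE mulrA.
  rewrite (le_trans (phi_taylor _ _ _))// n1Z exprMn real_normK ?num_real//.
  by rewrite mulrA.
Qed.

Let Dm_step i : `|Dm c' i x - Dm c i x| <= L * c0 * m1d d.
Proof.
have iDm : integ (fun w => Dm c' i (x + c0 *: W w)).
  exact: (integ_sm (Dm_lip c' i) (Dm_bound c' i)).
rewrite Dm_conv -[X in X - _](E_cst P) -E_sub//; last exact: integ_cst.
rewrite -E_m1 -E_scale; last exact: (integ_n1 hW).
apply: E_abs_le => [||w].
- by apply: measurable_funB => //; exact: (integ_meas iDm).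
- by apply: integZ; exact: integ_n1.
- rewrite (le_trans (Dm_lip _ _ _ _))// opprD addrA subrr add0r n1N n1Z gtr0_norm//.
  by rewrite mulrA.
Qed.

(** Taylor's formula holds at level [c'], whereas [Fx] and [b] belong to level [c]. Changing the
    level costs c0^2 in the value ([phi_step]) and c0 in the gradient ([Dm_step]), which is
    multiplied by a displacement of order c0. *)
Let phi_expand z : `|phi c' (x + c0 *: z) - Fx - c0 * Fx * \sum_i b 0 i * z 0 i|
  <= c0 ^+ 2 * L * (n1 z ^+ 2 + m2d d + m1d d * n1 z).
Proof.
have -> : c0 * Fx * \sum_i b 0 i * z 0 i = \sum_i Dm c i x * (c0 *: z) 0 i.
  rewrite mulr_sumr; apply: eq_bigr => i _; rewrite !mxE.
  by rewrite /Fx; field; rewrite gt_eqF.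
pose S1 := \sum_i Dm c' i x * (c0 *: z) 0 i.
pose S2 := \sum_i (Dm c' i x - Dm c i x) * (c0 *: z) 0 i.
have SS : \sum_i Dm c i x * (c0 *: z) 0 i = S1 - S2.
  by rewrite -sumrB; apply: eq_bigr => i _; rewrite -mulrBl opprB addrC subrK.
rewrite SS.
have h1 := phi_taylor c' x (c0 *: z).
have h2 : `|S2| <= c0 ^+ 2 * L * (m1d d * n1 z).
  rewrite (le_trans (ler_norm_sum _ _ _))//.
  rewrite (_ : _ * (m1d d * n1 z) = \sum_i L * c0 * m1d d * (c0 * `|z 0 i|)); last first.
    by rewrite -mulr_sumr -mulr_sumr /n1; ring.
  apply: ler_sum => i _; rewrite normrM ler_pM// mxE normrM gtr0_norm//.
have h3 := phi_step.
rewrite n1Z [`|c0|]gtr0_norm// exprMn -/S1 in h1.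
rewrite (_ : _ - _ = (phi c' (x + c0 *: z) - phi c' x - S1) - (Fx - phi c' x) + S2); last by ring.
rewrite (le_trans (ler_normD _ _))// mulrDr lerD// (le_trans (ler_normB _ _))// mulrDr lerD//.
  by rewrite (le_trans h1)// mulrA [L * _]mulrC.
by rewrite (le_trans h3)// [L * _]mulrC.
Qed.

(* Likelihood ratio of the drifted Gaussian step minus that of the [f]-tilted step, for
   which [ufun] is exactly preserved in the mean. *)
Let rho (z : vec) := expR (\sum_i (c0 * b 0 i * z 0 i - (c0 * b 0 i) ^+ 2 / 2)) -
  phi c' (x + c0 *: z) / Fx.

(** Both ratios are 1 + s up to second order, with the same s = c0 <b, z>: [exp_drift_bound] treats
    the first with e = c0 B, [phi_expand] divided by [Fx] the second. *)
Let rho_bound z : `|rho z| <= c0 ^+ 2 * (B ^+ 2 + L / xi) * kappa d (n1 z).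
Proof.
have bB i : `|b 0 i| <= B by exact: bdrift_bound.
have t0 : 0 <= n1 z by exact: n1_ge0.
have cB0 : 0 <= c0 * B by rewrite mulr_ge0// ltW.
pose s := \sum_i c0 * b 0 i * z 0 i.
pose q := \sum_i (c0 * b 0 i) ^+ 2 / 2.
have h1 : `|expR (s - q) - 1 - s| <= (c0 * B) ^+ 2 * ((n1 z + d%:R) ^+ 2 * expR (n1 z + d%:R) + d%:R).
  apply: exp_drift_bound => //; first by rewrite cB0.
    rewrite (le_trans (ler_norm_sum _ _ _))// /n1 mulr_sumr; apply: ler_sum => i _.
    by rewrite !normrM gtr0_norm// ler_wpM2r// ler_wpM2l// ltW.
  rewrite sumr_ge0 => [/=|i _]; last by rewrite divr_ge0// sqr_ge0.
  rewrite (le_trans (y := \sum_(i < d) (c0 * B) ^+ 2 / 2))//; last first.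
    by rewrite sumr_const card_ord -[leLHS]mulr_natr mulrAC.
  apply: ler_sum => i _; rewrite ler_pM2r ?invr_gt0//.
  rewrite -real_normK ?num_real// lerXn2r ?nnegrE// normrM gtr0_norm//.
  by rewrite ler_wpM2l// ltW.
have Fx0 : 0 < Fx by exact: phi0.
have h2 := phi_expand z.
have h2' : `|phi c' (x + c0 *: z) / Fx - 1 - s| <=
   c0 ^+ 2 * (L / xi) * (n1 z ^+ 2 + m2d d + m1d d * n1 z).
  have -> : phi c' (x + c0 *: z) / Fx - 1 - s =
    (phi c' (x + c0 *: z) - Fx - c0 * Fx * \sum_i b 0 i * z 0 i) / Fx.
    rewrite (_ : s = c0 * \sum_i b 0 i * z 0 i); last first.
      by rewrite mulr_sumr; apply: eq_bigr => i _; rewrite mulrA.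
    by field; rewrite gt_eqF.
  rewrite normrM normfV [X in _ / X]gtr0_norm// ler_pdivrMr// (le_trans h2)//.
  have h : 1 <= Fx / xi by rewrite ler_pdivlMr// mul1r; case/andP: (phi_bounds c x).
  set k := n1 z ^+ 2 + _ + _.
  have k0 : 0 <= k by rewrite !addr_ge0 ?mulr_ge0 ?sqr_ge0 ?m1d_ge0 ?m2d_ge0.
  rewrite (_ : c0 ^+ 2 * (L / xi) * k * Fx = c0 ^+ 2 * L * k * (Fx / xi)); last first.
    by field; rewrite gt_eqF.
  rewrite ler_peMr//; apply: mulr_ge0 => //; apply: mulr_ge0 => //; exact: sqr_ge0.
rewrite /rho sumrB -/s -/q.
rewrite (_ : _ - _ / Fx = (expR (s - q) - 1 - s) - (phi c' (x + c0 *: z) / Fx - 1 - s)); last by ring.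
rewrite (le_trans (ler_normB _ _))// /kappa.
rewrite (le_trans (lerD h1 h2'))// exprMn.
set k1 := _ + d%:R; set k2 := n1 z ^+ 2 + _ + _.
have k10 : 0 <= k1 by rewrite addr_ge0// mulr_ge0 ?sqr_ge0 ?expR_ge0.
have k20 : 0 <= k2 by rewrite !addr_ge0 ?mulr_ge0 ?sqr_ge0 ?m1d_ge0 ?m2d_ge0.
have B2 : 0 <= B ^+ 2 by exact: sqr_ge0.
have Lx : 0 <= L / xi by rewrite divr_ge0// ltW.
rewrite -subr_ge0 (_ : _ - _ = c0 ^+ 2 * (B ^+ 2 * k2 + L / xi * k1)); last by ring.
apply: mulr_ge0; first exact: sqr_ge0.
by apply: addr_ge0; apply: mulr_ge0.
Qed.

Let drift_coord i : (c0 ^+ 2 *: b) 0 i / c0 = c0 * b 0 i.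
Proof. by rewrite [X in X / _]mxE; field; rewrite gt_eqF. Qed.

Let mfr_expo : mfr (fun z : vec => expR (\sum_i (c0 * b 0 i * z 0 i - (c0 * b 0 i) ^+ 2 / 2))).
Proof.
apply: (@mfr_comp _ _ expR) => //.
apply: mfr_sum => i; apply: mfrB; last exact: mfr_cst.
by apply: mfrM; [exact: mfr_cst|exact: mfr_coord].
Qed.

Let integ_expo : integ (fun w => expR (\sum_i (c0 * b 0 i * W w 0 i - (c0 * b 0 i) ^+ 2 / 2))).
Proof.
apply: (@integ_expdom _ _ _ _ _ _ hW _ 1 1 mfr_expo) => z.
rewrite mul1r mul1r ger0_norm ?expR_ge0// ler_expR /n1; apply: ler_sum => i _.
rewrite lerBlDr (le_trans (ler_norm _))//.
rewrite (@le_trans _ _ `|z 0 i|)//; last by rewrite lerDl divr_ge0// sqr_ge0.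
rewrite normrM ler_piMl// normrM gtr0_norm//.
by rewrite (le_trans _ c0B)// ler_wpM2l ?(ltW c00)//; exact: bdrift_bound.
Qed.

Let mfr_rho : mfr rho.
Proof.
apply: mfrB; first exact: mfr_expo.
apply: mfrM; last exact: mfr_cst.
exact: (mfr_affine c0 x (lip_mfr (phi_lip c'))).
Qed.

Let integ_rho : integ (fun w => rho (W w)).
Proof.
apply: integB; first exact: integ_expo.
apply: (eq_integrable measurableT (EFin \o (fun w => Fx^-1 * phi c' (x + c0 *: W w)))).
  by move=> w _ /=; rewrite mulrC.
by apply: integZ; exact: iphi.
Qed.

Let E_rho0 : E (fun w => rho (W w)) = 0.
Proof.
have Fx0 : 0 < Fx by exact: phi0.
rewrite /rho E_sub; last 2 first.
- exact: integ_expo.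
- apply: (eq_integrable measurableT (EFin \o (fun w => Fx^-1 * phi c' (x + c0 *: W w)))).
    by move=> w _ /=; rewrite mulrC.
  by apply: integZ; exact: iphi.
have -> : E (fun w => phi c' (x + c0 *: W w) / Fx) = 1.
  transitivity (E (fun w => Fx^-1 * phi c' (x + c0 *: W w))).
    by congr (Rintegral _ _ _); apply/funext => w; rewrite mulrC.
  by rewrite E_scale// -phi_conv mulVf// gt_eqF.
have -> : E (fun w => expR (\sum_i (c0 * b 0 i * W w 0 i - (c0 * b 0 i) ^+ 2 / 2))) = 1.
  have H := @E_shift _ _ _ _ _ _ hW c0 (c0 ^+ 2 *: b) 0 (fun=> 1) 1 c00 (mfr_cst _) _.
  rewrite -[RHS](E_cst P 1) H; last by move=> _; rewrite ler01 lexx.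
  congr (Rintegral _ _ _); apply/funext => w; rewrite mul1r; congr expR.
  by apply: eq_bigr => i _; rewrite drift_coord.
by rewrite subrr.
Qed.

Lemma one_step : `|E (fun w => ufun c' (x + c0 ^+ 2 *: b + c0 *: W w)) - ufun c x|
  <= Lu * c0 ^+ 3 * (B ^+ 2 + L / xi) * Kd d.
Proof.
have Fx0 : 0 < Fx by exact: phi0.
pose u z := ufun c' (x + c0 *: z).
have mu : mfr u by exact: (mfr_affine c0 x (lip_mfr (ufun_lip c'))).
have u01 z : `|u z| <= 1 by have /andP[? ?] := ufun_range c' (x + c0 *: z); rewrite ger0_norm.
pose M := c0 ^+ 2 * (B ^+ 2 + L / xi).
have M0 : 0 <= M by rewrite mulr_ge0 ?sqr_ge0// addr_ge0 ?sqr_ge0// divr_ge0// ltW.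
have iuexp : integ (fun w => u (W w) * expR (\sum_i (c0 * b 0 i * W w 0 i - (c0 * b 0 i) ^+ 2 / 2))).
  apply: (integ_le _ _ integ_expo) => [|w].
    exact: (measW hW (mfrM mu mfr_expo)).
  by rewrite normrM [X in _ * X <= _]ger0_norm ?expR_ge0// ler_piMl ?expR_ge0.
have E1 : E (fun w => ufun c' (x + c0 ^+ 2 *: b + c0 *: W w)) =
    E (fun w => u (W w) * expR (\sum_i (c0 * b 0 i * W w 0 i - (c0 * b 0 i) ^+ 2 / 2))).
  rewrite (E_shift hW (K := 1) _ _ c00 (lip_mfr (ufun_lip c')) (ufun_range c')).
  congr (Rintegral _ _ _); apply/funext => w; congr (_ * expR _).
  by apply: eq_bigr => i _; rewrite drift_coord.
have iu2 : integ (fun w => u (W w) * (phi c' (x + c0 *: W w) / Fx)).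
  apply: (@integ_bdd _ _ _ P _ (zeta / Fx)) => [|w].
    apply: (measW hW (f := fun z => u z * (phi c' (x + c0 *: z) / Fx))).
    apply: mfrM => //; apply: mfrM; last exact: mfr_cst.
    exact: (mfr_affine c0 x (lip_mfr (phi_lip c'))).
  rewrite normrM -[leRHS]mul1r ler_pM// normrM normfV [X in _ / X]gtr0_norm//.
  by rewrite ler_pM2r ?invr_gt0//; exact: phiz.
(* The tilting weight cancels the denominator of [ufun c'], leaving [hfun c'], whose Gaussian mean
   is [hfun c x]. *)
have E2 : ufun c x = E (fun w => u (W w) * (phi c' (x + c0 *: W w) / Fx)).
  rewrite /ufun hfun_conv -/Fx mulrC -E_scale; last first.
    exact: (integ_sm (E_sm_lip gflip gfz c') (E_sm_bound gflip gfz c')).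
  congr (Rintegral _ _ _); apply/funext => w; rewrite /u /ufun.
  have := phi0 c' (x + c0 *: W w); move: (phi c' _) (hfun c' _) => p h p0.
  by field; rewrite !gt_eqF.
rewrite E1 E2 -E_sub//.
(* Since [rho] has mean 0, the constant [u 0] can be subtracted, and the increment of [u] brings the
   third factor c0. *)
have -> : E (fun w => u (W w) * expR (\sum_i (c0 * b 0 i * W w 0 i - (c0 * b 0 i) ^+ 2 / 2)) -
     u (W w) * (phi c' (x + c0 *: W w) / Fx)) = E (fun w => (u (W w) - u 0) * rho (W w)).
  transitivity (E (fun w => u (W w) * rho (W w)) - u 0 * E (fun w => rho (W w))).
    rewrite E_rho0 mulr0 subr0; congr (Rintegral _ _ _); apply/funext => w.
    by rewrite /rho mulrBr.
  rewrite -E_scale// -E_sub.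
  - by congr (Rintegral _ _ _); apply/funext => w; rewrite mulrBl.
  - apply: (eq_integrable measurableT (EFin \o (fun w => u (W w) * expR (\sum_i (c0 * b 0 i * W w 0 i - (c0 * b 0 i) ^+ 2 / 2)) -
     u (W w) * (phi c' (x + c0 *: W w) / Fx)))).
      by move=> w _ /=; rewrite /rho mulrBr.
    exact: integB.
  - by apply: integZ; exact: integ_rho.
rewrite (_ : Lu * c0 ^+ 3 * _ * _ = Lu * c0 * M * Kd d); last by rewrite /M; ring.
rewrite -E_Kd -E_scale; last exact: integ_kappa.
apply: E_abs_le => [||w].
- apply: (measW hW (f := fun z => (u z - u 0) * rho z)).
  by apply: mfrM => //; apply: mfrB => //; exact: mfr_cst.
- by apply: integZ; exact: integ_kappa.
- have h1 : `|u (W w) - u 0| <= Lu * c0 * n1 (W w).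
    rewrite (le_trans (ufun_lip _ _ _))// scaler0 addr0 addrAC subrr add0r n1Z gtr0_norm//.
    by rewrite mulrA.
  rewrite normrM (_ : _ * (n1 _ * _) = (Lu * c0 * n1 (W w)) * (M * kappa d (n1 (W w)))); last by ring.
  by rewrite ler_pM//; exact: rho_bound.
Qed.

End step.

End onestep.

(** * Conditional steps and Monte Carlo error *)

Section quot.
Context {R : realType} {d : nat}.
Notation vec := 'rV[R]_d.

(** The second quotient enters only through its bound [q], so a single factor 1/xi is lost instead
    of 1/xi^2. *)
Lemma quot_diff (a1 b1 a2 b2 q xi : R) : 0 < xi -> xi <= b1 -> 0 < b2 -> `|a2 / b2| <= q ->
  `|a1 / b1 - a2 / b2| <= (`|a1 - a2| + q * `|b1 - b2|) / xi.
Proof.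
move=> xi0 b1xi b20 q2.
have b10 : 0 < b1 by exact: lt_le_trans b1xi.
have q0 : 0 <= q by rewrite (le_trans _ q2).
rewrite (_ : a1 / b1 - a2 / b2 = ((a1 - a2) + a2 / b2 * (b2 - b1)) / b1); last first.
  by field; rewrite !gt_eqF.
rewrite normrM normfV [X in _ / X]gtr0_norm//.
apply: ler_pM => //; first by rewrite invr_ge0 ltW.
- rewrite (le_trans (ler_normD _ _))// lerD2l normrM distrC.
  by rewrite ler_wpM2r.
- by rewrite lef_pV2.
Qed.

Lemma quot_lip (N Q : vec -> R) (Ln Lq q xi : R) : lip Ln N -> lip Lq Q -> 0 < xi ->
  (forall x, xi <= Q x) -> (forall x, `|N x / Q x| <= q) ->
  lip ((Ln + q * Lq) / xi) (fun x => N x / Q x).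
Proof.
move=> lN lQ xi0 Qx Nq x y.
have Q0 z : 0 < Q z by exact: lt_le_trans (Qx z).
rewrite (le_trans (quot_diff _ xi0 (Qx x) (Q0 y) (Nq y)))//.
rewrite mulrAC ler_pM2r ?invr_gt0// mulrDl; apply: lerD; first exact: lN.
by rewrite -mulrA ler_wpM2l// (le_trans _ (Nq 0)).
Qed.

End quot.

Section chain.
Context {R : realType} {d : nat} {dT : measure_display} {T : measurableType dT}.
Variables (P : probability T R) (W : T -> 'rV[R]_d).
Hypothesis hW : std_gauss_vec P W.
Notation vec := 'rV[R]_d.
Implicit Types (x y : vec) (c t : R).
Local Notation E F := (Rintegral P setT F%R).
Local Notation integ := (integ P).

Section noise.
Variables (I : eqType) (S : set I) (xs : I -> T -> R).
Hypothesis xs_law : forall a, S a -> has_normal_law P (xs a) 0 1.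
Hypothesis xs_indep : mutually_indep P S xs.
Local Notation pmeas := (pmeas xs).
Local Notation pvmeas := (pvmeas xs).
Local Notation noise := (noisevec xs).

Definition fresh (L : seq I) (A : 'I_d -> I) :=
  injective A /\ forall i, S (A i) /\ A i \notin L.

Definition okpast (L : seq I) := uniq L /\ forall a, a \in L -> S a.

Lemma pvmeas_vmeas L (Y : T -> vec) : okpast L -> pvmeas L Y -> vmeas Y.
Proof. by case=> _ LS mY i; exact: (pmeas_measurable xs_law LS (mY i)). Qed.

Lemma pmeas_meas L (al : T -> R) : okpast L -> pmeas L al -> measurable_fun setT al.
Proof. by case=> _ LS mal; exact: (pmeas_measurable xs_law LS mal). Qed.

Lemma pmeas_mfr L (F : vec -> R) (Y : T -> vec) : mfr F -> pvmeas L Y -> pmeas L (fun w => F (Y w)).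
Proof. by move=> mF mY; exact: (mF _ _ _ mY). Qed.

Lemma noise_pvmeas L (A : 'I_d -> I) : (forall i, A i \in L) -> pvmeas L (noise A).
Proof.
move=> AL i; rewrite (_ : (fun w => _) = xs (A i)); first exact: pmeas_xi.
by apply/funext => w; rewrite mxE.
Qed.

Lemma noise_vmeas (A : 'I_d -> I) : (forall i, S (A i)) -> vmeas (noise A).
Proof.
move=> AS i; rewrite (_ : (fun w => _) = xs (A i)); last by apply/funext => w; rewrite mxE.
by have [] := xs_law (AS i).
Qed.

(** The signed bounded form of [cond_vec]: [F + M] and [al + Al] are nonnegative, and the
    contributions of the added constants cancel. *)
Lemma cond_real L (al : T -> R) (Y : T -> vec) (A : 'I_d -> I) c (F : vec -> R) K M Al : okpast L -> fresh L A ->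
  pmeas L al -> (forall w, `|al w| <= Al) -> pvmeas L Y ->
  lip K F -> (forall x, `|F x| <= M) ->
  E (fun w => al w * F (Y w + c *: noise A w)) =
  E (fun w => al w * E (fun w' => F (Y w + c *: W w'))).
Proof.
move=> okL [Ainj AS] mal alA mY lF FM.
have mF := lip_mfr lF.
pose Fb y := E (fun w' => F (y + c *: W w')).
have mFb : mfr Fb by exact: (lip_mfr (E_sm_lip hW lF FM c)).
have FbM y : `|Fb y| <= M by exact: (E_sm_bound hW lF FM).
have mYT := pvmeas_vmeas okL mY.
have malT := pmeas_meas okL mal.
have mN : vmeas (fun w => Y w + c *: noise A w).
  apply: vmeasD => //; apply: vmeasZ => //; apply: noise_vmeas => i.
  by case: (AS i).
have mFN : measurable_fun setT (fun w => F (Y w + c *: noise A w)) by exact: (mF _ _ _ mN).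
have mFbY : measurable_fun setT (fun w => Fb (Y w)) by exact: (mFb _ _ _ mYT).
have M0 : 0 <= M by rewrite (le_trans _ (FM 0)).
have Al0 (w : T) : 0 <= Al by rewrite (le_trans _ (alA w)).
have pos (be : T -> R) Be : pmeas L be -> (forall w, 0 <= be w <= Be) ->
   E (fun w => be w * F (Y w + c *: noise A w)) = E (fun w => be w * Fb (Y w)).
  move=> mbe beB.
  have mbeT := pmeas_meas okL mbe.
  have be0 w : 0 <= be w by case/andP: (beB w).
  have beB' w : `|be w| <= Be by rewrite ger0_norm//; case/andP: (beB w).
  pose h y := F y + M.
  have h0 y : 0 <= h y by rewrite /h -lerBlDr sub0r; have := FM y; rewrite ler_norml => /andP[].
  have mh : mfr h by apply: mfrD => //; exact: mfr_cst.
  have ibe : integ be by exact: (integ_bdd P mbeT beB').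
  have i1 : integ (fun w => be w * F (Y w + c *: noise A w)).
    apply: (integ_bdd P (c := Be * M)) => [|w]; first exact: measurable_funM.
    by rewrite normrM ler_pM.
  have i2 : integ (fun w => be w * Fb (Y w)).
    apply: (integ_bdd P (c := Be * M)) => [|w]; first exact: measurable_funM.
    by rewrite normrM ler_pM.
  have hg y : gsm c (EFin \o h) y = (Fb y + M)%:E.
    rewrite -(integral_W hW)//; last exact: mfr_mfv.
    rewrite /Fb -[in RHS](E_cst P M) -E_add; last 2 first.
    - exact: (integ_sm hW lF FM).
    - exact: integ_cst.
    rewrite E_fin//; apply: integD; last exact: integ_cst.
    exact: (integ_sm hW lF FM).
  have H := @cond_vec R dT T P I S xs xs_law xs_indep d A Ainj L be Y c (EFin \o h)
    okL.1 okL.2 AS mbe be0 mY (mfr_mfv mh) (fun y => h0 y).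
  have {}H : E (fun w => be w * h (Y w + c *: noise A w)) = E (fun w => be w * (Fb (Y w) + M)).
    rewrite /Rintegral; congr fine.
    transitivity (\int[P]_w ((be w)%:E * (EFin \o h) (Y w + c *: noise A w)%R))%E.
      by apply: eq_integral => w _; rewrite EFinM.
    by rewrite H; apply: eq_integral => w _; rewrite hg EFinM.
  have e1 : E (fun w => be w * h (Y w + c *: noise A w)) =
      E (fun w => be w * F (Y w + c *: noise A w)) + M * E be.
    rewrite -E_scale// -E_add//; last exact: integZ.
    by congr (Rintegral _ _ _); apply/funext => w; rewrite /h mulrDr [M * _]mulrC.
  have e2 : E (fun w => be w * (Fb (Y w) + M)) = E (fun w => be w * Fb (Y w)) + M * E be.
    rewrite -E_scale// -E_add//; last exact: integZ.
    by congr (Rintegral _ _ _); apply/funext => w; rewrite mulrDr [M * _]mulrC.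
  by move: H; rewrite e1 e2 => /addIr.
have ial : integ al by exact: (integ_bdd P malT alA).
have iF : integ (fun w => F (Y w + c *: noise A w)) by exact: (integ_bdd P mFN (fun w => FM _)).
have iFb : integ (fun w => Fb (Y w)) by exact: (integ_bdd P mFbY (fun w => FbM _)).
have i1 : integ (fun w => al w * F (Y w + c *: noise A w)).
  apply: (integ_bdd P (c := Al * M)) => [|w]; first exact: measurable_funM.
  by rewrite normrM ler_pM.
have i2 : integ (fun w => al w * Fb (Y w)).
  apply: (integ_bdd P (c := Al * M)) => [|w]; first exact: measurable_funM.
  by rewrite normrM ler_pM.
have p1 := pos (fun w => al w + Al) (Al + Al).
have p2 := pos (fun=> Al) Al.
have {p1} : E (fun w => (al w + Al) * F (Y w + c *: noise A w)) = E (fun w => (al w + Al) * Fb (Y w)).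
  apply: p1 => [|w]; first by apply: measurable_funD.
  have := alA w; rewrite ler_norml => /andP[h1 h2].
  by rewrite -lerBlDr sub0r h1/= lerD2r.
have {p2} : E (fun w => Al * F (Y w + c *: noise A w)) = E (fun w => Al * Fb (Y w)).
  apply: p2 => [|w]; first exact: measurable_cst.
  by rewrite lexx andbT (Al0 w).
have -> : E (fun w => (al w + Al) * F (Y w + c *: noise A w)) =
    E (fun w => al w * F (Y w + c *: noise A w)) + E (fun w => Al * F (Y w + c *: noise A w)).
  rewrite -E_add//; last exact: integZ.
  by congr (Rintegral _ _ _); apply/funext => w; rewrite mulrDl.
have -> : E (fun w => (al w + Al) * Fb (Y w)) = E (fun w => al w * Fb (Y w)) + E (fun w => Al * Fb (Y w)).
  rewrite -E_add//; last exact: integZ.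
  by congr (Rintegral _ _ _); apply/funext => w; rewrite mulrDl.
by move=> -> /addIr.
Qed.

(** * Mean error of an average of independent samples *)

Section mc.
Variables (L : seq I) (Y : T -> vec) (A : nat -> 'I_d -> I) (m : nat).
Hypotheses (okL : okpast L) (mY : pvmeas L Y) (m0 : (0 < m)%N).
Hypothesis AS : forall j i, (j < m)%N -> S (A j i) /\ A j i \notin L.
Hypothesis Ainj : forall j j' i i', A j i = A j' i' -> j = j' /\ i = i'.
Variables (F : vec -> R) (K M c : R).
Hypotheses (lF : lip K F) (FM : forall x, `|F x| <= M) (M0 : 0 < M).
Let Fb y := E (fun w' => F (y + c *: W w')).
Let a j w := F (Y w + c *: noise (A j) w) - Fb (Y w).

Let mFb : mfr Fb. Proof. exact: (lip_mfr (E_sm_lip hW lF FM c)). Qed.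
Let FbM y : `|Fb y| <= M. Proof. exact: (E_sm_bound hW lF FM). Qed.

Let a_bound j w : `|a j w| <= 2 * M.
Proof. by rewrite (le_trans (ler_normB _ _))// (_ : 2 * M = M + M) ?lerD//; ring. Qed.

(** The past enlarged by the [l]-th sample: [a l] is known from it, while the other samples stay
    fresh. *)
Let ext l := L ++ [seq A l i | i <- enum 'I_d].

Let ok_ext l : (l < m)%N -> okpast (ext l).
Proof.
move=> lm; split.
  rewrite cat_uniq okL.1/= map_inj_uniq ?enum_uniq ?andbT; last first.
    by move=> i i' /Ainj[].
  apply/hasPn => _ /mapP[i _ ->]; by have [] := AS i lm.
move=> b; rewrite mem_cat => /orP[/okL.2//|/mapP[i _ ->]].
by have [] := AS i lm.
Qed.

Let a_pmeas l : pmeas (ext l) (a l).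
Proof.
have mY' : pvmeas (ext l) Y.
  by apply: pvmeas_mono mY => b bL; rewrite mem_cat bL.
apply: measurable_funB; last exact: (pmeas_mfr mFb mY').
apply: (pmeas_mfr (Y := fun w => Y w + c *: noise (A l) w) (lip_mfr lF)).
apply: (@vmeasD _ _ _ (g_sigma_algebraType (past xs (ext l)))) => //.
apply: (@vmeasZ _ _ _ (g_sigma_algebraType (past xs (ext l)))) => //.
apply: noise_pvmeas => i.
by rewrite mem_cat map_f ?orbT// mem_enum.
Qed.

Let a_meas l : (l < m)%N -> measurable_fun setT (a l).
Proof. by move=> lm; exact: (pmeas_meas (ok_ext lm) (@a_pmeas l)). Qed.

(** Given [ext l], the factor [a l] is a known weight and [a j] has conditional mean 0. *)
Let cross j l : (j < m)%N -> (l < m)%N -> j != l -> E (fun w => a l w * a j w) = 0.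
Proof.
move=> jm lm jl.
have fr : fresh (ext l) (A j).
  split; first by move=> i i' /Ainj[].
  move=> i; have [SA AL] := AS i jm; split => //.
  rewrite mem_cat negb_or AL/=; apply/negP => /mapP[i' _ /Ainj[jl' _]].
  by rewrite jl' eqxx in jl.
have mY' : pvmeas (ext l) Y.
  by apply: pvmeas_mono mY => b bL; rewrite mem_cat bL.
have H := cond_real c (ok_ext lm) fr (@a_pmeas l) (a_bound l) mY' lF FM.
have mal := a_meas lm.
have mYT := pvmeas_vmeas (ok_ext lm) mY'.
have mFj : measurable_fun setT (fun w => F (Y w + c *: noise (A j) w)).
  have -> : (fun w => F (Y w + c *: noise (A j) w)) = (fun w => a j w + Fb (Y w)).
    by apply/funext => w; rewrite subrK.
  by apply: measurable_funD; [exact: a_meas|exact: (mFb mYT)].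
have i1 : integ (fun w => a l w * F (Y w + c *: noise (A j) w)).
  apply: (integ_bdd P (c := 2 * M * M)) => [|w]; first exact: measurable_funM.
  by rewrite normrM ler_pM.
have i2 : integ (fun w => a l w * Fb (Y w)).
  apply: (integ_bdd P (c := 2 * M * M)) => [|w].
    by apply: measurable_funM => //; exact: (mFb mYT).
  by rewrite normrM ler_pM.
rewrite -[RHS](subrr (E (fun w => a l w * Fb (Y w)))) -[X in _ = X - _]H -E_sub//.
by congr (Rintegral _ _ _); apply/funext => w; rewrite mulrBr.
Qed.

(** The deviations are uncorrelated, so their sum has second moment at most m (2M)^2; a weighted
    square inequality turns this into an L^1 bound. *)
Lemma mc_bound :
  E (fun w => `|m%:R^-1 * \sum_(j < m) F (Y w + c *: noise (A j) w) - Fb (Y w)|) <=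
  2 * M / Num.sqrt m%:R.
Proof.
have mR : 0 < m%:R :> R by rewrite ltr0n.
have ia2 (j l : 'I_m) : integ (fun w => a l w * a j w).
  apply: (integ_bdd P (c := 2 * M * (2 * M))) => [|w].
    by apply: measurable_funM; exact: a_meas.
  by rewrite normrM ler_pM.
have msum : measurable_fun setT (fun w => \sum_(j < m) a j w).
  by apply: measurable_sum => j; exact: a_meas.
have avgE w : m%:R^-1 * \sum_(j < m) F (Y w + c *: noise (A j) w) - Fb (Y w) =
    m%:R^-1 * \sum_(j < m) a j w.
  rewrite sumrB mulrBr sumr_const card_ord -[Fb _ *+ _]mulr_natl mulrA mulVf ?mul1r//.
  by rewrite gt_eqF.
have sq_le : E (fun w => (\sum_(j < m) a j w) ^+ 2) <= m%:R * (2 * M) ^+ 2.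
  have -> : E (fun w => (\sum_(j < m) a j w) ^+ 2) = \sum_(l < m) \sum_(j < m) E (fun w => a l w * a j w).
    transitivity (E (fun w => \sum_(l < m) \sum_(j < m) a l w * a j w)).
      congr (Rintegral _ _ _); apply/funext => w; rewrite expr2 mulr_suml.
      by apply: eq_bigr => l _; rewrite mulr_sumr.
    rewrite E_sum; last by move=> l; apply: integ_sum => j; exact: ia2.
    by apply: eq_bigr => l _; rewrite E_sum// => j; exact: ia2.
  rewrite (@le_trans _ _ (\sum_(l < m) (2 * M) ^+ 2))//; last first.
    by rewrite sumr_const card_ord [leRHS]mulr_natl.
  apply: ler_sum => l _; rewrite (bigD1 l)//= big1 ?addr0; last first.
    by move=> j jl; exact: cross.
  rewrite (le_trans (ler_norm _))//; apply: E_abs_le_cst => [|w].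
    by apply: measurable_funM; exact: a_meas.
  by rewrite normrM expr2 ler_pM.
have s0 : 0 < Num.sqrt m%:R :> R by rewrite sqrtr_gt0.
have s2 : Num.sqrt m%:R ^+ 2 = m%:R :> R by rewrite sqr_sqrtr// ltW.
set s := Num.sqrt m%:R in s0 s2 *.
have isq : integ (fun w => (\sum_(j < m) a j w) ^+ 2).
  apply: (integ_bdd P (c := (m%:R * (2 * M)) ^+ 2)) => [|w]; first exact: measurable_funX.
  rewrite normrX; apply: lerXn2r; rewrite ?nnegrE ?mulr_ge0 ?(ltW M0)//.
  rewrite (le_trans (ler_norm_sum _ _ _))// (@le_trans _ _ (\sum_(l < m) (2 * M)))//.
    by apply: ler_sum => j _.
  by rewrite sumr_const card_ord [leRHS]mulr_natl.
(* With s = sqrt m this weight makes k t^2 + M/s - t/m equal to the square k (t - 2Ms)^2, and each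
   of the two remaining terms contributes M/s. *)
pose k := (2 * M * s ^+ 3)^-1 / 2.
have k0 : 0 < k by rewrite divr_gt0// invr_gt0 !mulr_gt0// exprn_gt0.
apply: (@le_trans _ _ (E (fun w => k * (\sum_(j < m) a j w) ^+ 2 + M / s))).
  apply: E_le.
  - apply: integ_abs; rewrite (_ : (fun w => _) = (fun w => m%:R^-1 * \sum_(j < m) a j w)).
      apply: integZ; apply: integ_sum => j.
      exact: (integ_bdd P (a_meas (ltn_ord j)) (a_bound j)).
    by apply/funext => w; rewrite avgE.
  - by apply: integD; [exact: integZ|exact: integ_cst].
  - move=> w; rewrite avgE normrM [`|m%:R^-1|]ger0_norm ?invr_ge0 ?(ltW mR)//.
    rewrite -[X in k * X]real_normK ?num_real//; move: (`|_|) => t.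
    rewrite -s2 -subr_ge0.
    rewrite (_ : _ - _ = k * (t - 2 * M * s) ^+ 2); last by rewrite /k; field; rewrite !gt_eqF.
    by rewrite mulr_ge0 ?sqr_ge0// ltW.
rewrite E_add; [|exact: integZ|exact: integ_cst].
rewrite (E_scale k isq) (E_cst P (M / s)) (le_trans (lerD (ler_wpM2l (ltW k0) sq_le) (lexx _)))//.
rewrite -s2 le_eqVlt; apply/orP; left; apply/eqP; rewrite /k.
by field; rewrite !gt_eqF.
Qed.

End mc.

Lemma mc_bound_ge0 L (Y : T -> vec) (A : nat -> 'I_d -> I) (m : nat)
    (F : vec -> R) (K M c : R) : okpast L -> pvmeas L Y -> (0 < m)%N ->
  (forall j i, (j < m)%N -> S (A j i) /\ A j i \notin L) ->
  (forall j j' i i', A j i = A j' i' -> j = j' /\ i = i') ->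
  lip K F -> (forall x, `|F x| <= M) ->
  E (fun w => `|m%:R^-1 * \sum_(j < m) F (Y w + c *: noise (A j) w) -
     E (fun w' => F (Y w + c *: W w'))|) <= 2 * M / Num.sqrt m%:R.
Proof.
move=> okL mY m0 AS Ainj lF FM.
have : 0 <= M by rewrite (le_trans _ (FM 0)).
rewrite le_eqVlt => /predU1P[M0|M0]; last first.
  exact: (@mc_bound L Y A m okL mY m0 AS Ainj F K M c lF FM M0).
have F0 x : F x = 0 by apply/eqP; rewrite -normr_le0 M0.
rewrite -M0 mulr0 mul0r le_eqVlt -{2}(E_cst P 0); apply/orP; left; apply/eqP.
congr (Rintegral _ _ _); apply/funext => w; rewrite big1 ?mulr0 => [|j _]; last exact: F0.
have -> : (fun w' => F (Y w + c *: W w')) = (fun=> 0) by apply/funext => w'; exact: F0.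
by rewrite E_cst subrr normr0.
Qed.

End noise.
End chain.

Section inverse.
Context {R : realType} {dT : measure_display} {T : measurableType dT}.

Lemma measurable_inv_pos (Q : T -> R) : measurable_fun setT Q -> (forall w, 0 < Q w) ->
  measurable_fun setT (fun w => (Q w)^-1).
Proof.
move=> mQ Q0; rewrite (_ : (fun w => _) = (fun w => expR (- ln (Q w)))).
  apply: (measurableT_comp (f := expR)) => //; apply: measurable_funN.
  exact: (measurableT_comp (@measurable_ln R) mQ).
by apply/funext => w; rewrite expRN lnK// posrE.
Qed.

End inverse.

Section data.
Context {R : realType} {d : nat} {dT : measure_display} {T : measurableType dT}.
Variables (P : probability T R) (W : T -> 'rV[R]_d).
Hypothesis hW : std_gauss_vec P W.
Notation vec := 'rV[R]_d.
Implicit Types (x y : vec) (c t : R).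
Local Notation E F := (Rintegral P setT F%R).
Local Notation integ := (integ P).
Variables (f g : vec -> R) (D : 'I_d -> vec -> R) (xi zeta B L Lf Lg : R).
Hypotheses (xi0 : 0 < xi) (fb : forall x, xi <= f x <= zeta) (flip : lip Lf f)
  (glip : lip Lg g) (g01 : forall x, 0 <= g x <= 1)
  (Dlip : forall i, lip L (D i)) (DB : forall i x, `|D i x| <= B * f x)
  (B0 : 0 <= B) (L0 : 0 <= L) (Lf0 : 0 <= Lf) (Lg0 : 0 <= Lg)
  (taylor : forall x y, `|f (x + y) - f x - \sum_i D i x * y 0 i| <= L * n1 y ^+ 2).
Local Notation phi := (phi P W f).
Local Notation Dm := (Dm P W D).
Local Notation bdrift := (bdrift P W f D).
Local Notation ufun := (ufun P W f g).
Local Notation Lu := (Lu xi zeta Lf Lg).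

Definition Lb := (L + B * Lf) / xi.

Let fz x : `|f x| <= zeta.
Proof.
have /andP[h1 h2] := fb x.
by rewrite ger0_norm// (le_trans (ltW xi0)).
Qed.

Let zeta0 : 0 <= zeta. Proof. by rewrite (le_trans _ (fz 0)). Qed.

Let Dz i x : `|D i x| <= B * zeta.
Proof. by rewrite (le_trans (DB i x))// ler_wpM2l//; case/andP: (fb x). Qed.

Let phixi c x : xi <= phi c x.
Proof. by case/andP: (phi_bounds hW xi0 fb flip c x). Qed.

Let phi0 c x : 0 < phi c x. Proof. exact: lt_le_trans xi0 (phixi c x). Qed.

Let bbB c x i : `|bdrift c x 0 i| <= B.
Proof. exact: (bdrift_bound hW xi0 fb flip Dlip DB). Qed.

Let bbE c x i : bdrift c x 0 i = Dm c i x / phi c x. Proof. by rewrite mxE. Qed.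

Let Dphi c x i : `|Dm c i x / phi c x| <= B. Proof. by rewrite -bbE. Qed.

Lemma Lb_ge0 : 0 <= Lb.
Proof. by apply: divr_ge0; [apply: addr_ge0 => //; exact: mulr_ge0|exact: ltW]. Qed.

Lemma bdrift_lip c i : lip Lb (fun x => bdrift c x 0 i).
Proof.
have -> : (fun x => bdrift c x 0 i) = (fun x => Dm c i x / phi c x).
  by apply/funext => x; rewrite mxE.
apply: quot_lip => //.
- exact: (E_sm_lip hW (@Dlip i) (Dz i)).
- exact: (E_sm_lip hW flip fz).
Qed.

Lemma bdrift_lipc c c' x i : `|bdrift c x 0 i - bdrift c' x 0 i| <= Lb * (`|c - c'| * m1d d).
Proof.
rewrite !bbE (le_trans (quot_diff _ xi0 (phixi _ _) (phi0 _ _) (Dphi _ _ _)))//.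
have h1 := E_sm_lipc hW (@Dlip i) (Dz i) c c' x L0.
have h2 := E_sm_lipc hW flip fz c c' x Lf0.
set t := _ * m1d d.
rewrite (_ : Lb * t = (L * t + B * (Lf * t)) / xi); last first.
  by rewrite /Lb; field; rewrite gt_eqF.
rewrite ler_pM2r ?invr_gt0//; apply: lerD; first by rewrite /t mulrA.
by rewrite ler_wpM2l// /t mulrA.
Qed.

Section noise.
Variables (I : eqType) (S : set I) (xs : I -> T -> R).
Hypothesis xs_law : forall a, S a -> has_normal_law P (xs a) 0 1.
Hypothesis xs_indep : mutually_indep P S xs.
Local Notation pmeas := (pmeas xs).
Local Notation pvmeas := (pvmeas xs).
Local Notation noise := (noisevec xs).
Local Notation fresh := (fresh S).
Local Notation okpast := (okpast S).

Lemma bdrift_pvmeas c La (Y : T -> vec) : pvmeas La Y -> pvmeas La (fun w => bdrift c (Y w)).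
Proof. by move=> mY i; exact: (lip_mfr (@bdrift_lip c i) mY). Qed.

Lemma n1_meas (Y : T -> vec) : vmeas Y -> measurable_fun setT (fun w => n1 (Y w)).
Proof. exact: mfr_n1. Qed.

(** The drift [be] is any bounded vector known from the past: the Monte Carlo drift for the
    algorithm, and the exact drift for the Brownian chain, where the middle term vanishes. Replacing
    [be] by the exact drift costs the Lipschitz constant of [ufun]; conditioning then brings in
    [one_step] at each value of [Y]. *)
Lemma step_bound La (Y be : T -> vec) (A : 'I_d -> I) c0 c' : okpast La -> fresh La A ->
  pvmeas La Y -> pvmeas La be -> (forall w i, `|be w 0 i| <= B) ->
  0 < c0 -> 0 <= c' -> c0 * B <= 1 ->
  E (fun w => ufun c' (Y w + c0 ^+ 2 *: be w + c0 *: noise A w)) <=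
  E (fun w => ufun (Num.sqrt (c0 ^+ 2 + c' ^+ 2)) (Y w)) +
   Lu * c0 ^+ 2 * E (fun w => n1 (be w - bdrift (Num.sqrt (c0 ^+ 2 + c' ^+ 2)) (Y w)))
   + Lu * c0 ^+ 3 * (B ^+ 2 + L / xi) * Kd d.
Proof.
move=> okL fr mY mbe beB c00 c'0 c0B; set c : R := Num.sqrt _.
have ulip c1 := ufun_lip hW xi0 fb flip glip g01 Lf0 Lg0 c1.
have urange c1 x : 0 <= ufun c1 x <= 1 := ufun_range hW xi0 fb flip glip g01 c1 x.
have u1 c1 x : `|ufun c1 x| <= 1 by have /andP[? ?] := urange c1 x; rewrite ger0_norm.
set b := fun w => bdrift c (Y w).
have mb : pvmeas La b by exact: bdrift_pvmeas.
have Lu0 : 0 <= Lu by rewrite divr_ge0 ?addr_ge0 ?mulr_ge0// ltW.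
pose err := Lu * c0 ^+ 3 * (B ^+ 2 + L / xi) * Kd d.
have mYT := pvmeas_vmeas xs_law okL mY.
have mbT := pvmeas_vmeas xs_law okL mb.
have mbeT := pvmeas_vmeas xs_law okL mbe.
have mN : vmeas (noise A) by apply: (noise_vmeas xs_law) => i; case: fr => _ /(_ i)[].
have mY1 (v : T -> vec) : vmeas v -> vmeas (fun w => Y w + c0 ^+ 2 *: v w).
  by move=> mv; apply: vmeasD => //; exact: vmeasZ.
have mY2 (v : T -> vec) : vmeas v -> vmeas (fun w => Y w + c0 ^+ 2 *: v w + c0 *: noise A w).
  by move=> mv; apply: vmeasD; [exact: mY1|exact: vmeasZ].
have iu (v : T -> vec) : vmeas v ->
    integ (fun w => ufun c' (Y w + c0 ^+ 2 *: v w + c0 *: noise A w)).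
  move=> mv; apply: (integ_bdd P (c := 1)) => [|w]; last exact: u1.
  exact: (lip_mfr (ulip c') (mY2 _ mv)).
have iuY : integ (fun w => ufun c (Y w)).
  by apply: (integ_bdd P (c := 1)) => [|w //]; exact: (lip_mfr (ulip c) mYT).
have inb : integ (fun w => n1 (be w - b w)).
  apply: (integ_bdd P (c := d%:R * (B + B))) => [|w].
    by apply: n1_meas; apply: vmeasD => //; exact: vmeasN.
  rewrite ger0_norm ?n1_ge0// /n1 (@le_trans _ _ (\sum_(i < d) (B + B)))//.
    apply: ler_sum => i _; rewrite [X in `|X|]mxE [X in _ + X]mxE.
    by rewrite (le_trans (ler_normB _ _))// lerD//; exact: bbB.
  by rewrite sumr_const card_ord -[leLHS]mulr_natl.
pose Gu y := E (fun w' => ufun c' (y + c0 *: W w')).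
have mGu : measurable_fun setT (fun w => Gu (Y w + c0 ^+ 2 *: b w)).
  exact: (lip_mfr (E_sm_lip hW (ulip c') (u1 c') c0) (mY1 _ mbT)).
have key : E (fun w => ufun c' (Y w + c0 ^+ 2 *: b w + c0 *: noise A w)) =
    E (fun w => Gu (Y w + c0 ^+ 2 *: b w)).
  have mY' : pvmeas La (fun w => Y w + c0 ^+ 2 *: b w).
    apply: (@vmeasD _ _ _ (g_sigma_algebraType (past xs La))) => //.
    by apply: (@vmeasZ _ _ _ (g_sigma_algebraType (past xs La))).
  have := cond_real hW xs_law xs_indep c0 okL fr (al := fun=> 1) (Al := 1) (measurable_cst _) _ mY' (ulip c') (u1 c').
  have -> : (fun w => 1 * ufun c' (Y w + c0 ^+ 2 *: b w + c0 *: noise A w)) =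
     (fun w => ufun c' (Y w + c0 ^+ 2 *: b w + c0 *: noise A w)).
    by apply/funext => w; rewrite mul1r.
  move=> ->; last by move=> w; rewrite normr1.
  by congr (Rintegral _ _ _); apply/funext => w; rewrite mul1r.
apply: (@le_trans _ _ (E (fun w => ufun c' (Y w + c0 ^+ 2 *: b w + c0 *: noise A w)
     + Lu * c0 ^+ 2 * n1 (be w - b w)))).
  apply: E_le => [||w].
  - exact: iu.
  - by apply: integD; [exact: iu|exact: integZ].
  - rewrite -lerBlDl (le_trans (ler_norm _))// (le_trans (ulip _ _ _))//.
    rewrite opprD addrACA subrr addr0 opprD addrACA subrr add0r -scalerBr n1Z.
    by rewrite ger0_norm ?sqr_ge0// mulrA.
rewrite E_add; [|exact: iu|exact: integZ].
rewrite E_scale// key [leRHS]addrAC lerD2r -/err.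
rewrite -[X in _ <= _ + X](E_cst P err) -E_add//; last exact: integ_cst.
apply: E_le => [||w].
- apply: (integ_bdd P (c := 1)) => // w.
  exact: (E_sm_bound hW (ulip c') (u1 c')).
- by apply: integD => //; exact: integ_cst.
- rewrite -lerBlDl (le_trans (ler_norm _))//.
  exact: (one_step hW xi0 fb flip glip g01 Dlip DB B0 L0 Lf0 Lg0 taylor).
Qed.

Section mcdrift.
Variables (La : seq I) (Y : T -> vec) (A : nat -> 'I_d -> I) (m : nat) (c : R).
Hypotheses (okL : okpast La) (mY : pvmeas La Y) (m0 : (0 < m)%N).
Hypothesis AS : forall j i, (j < m)%N -> S (A j i) /\ A j i \notin La.
Hypothesis Ainj : forall j j' i i', A j i = A j' i' -> j = j' /\ i = i'.

Definition mcb (w : T) : vec :=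
  (m%:R^-1 * \sum_(j < m) f (Y w + c *: noise (A j) w))^-1 *:
  (\row_i (m%:R^-1 * \sum_(j < m) D i (Y w + c *: noise (A j) w))).

Let mR : 0 < m%:R :> R. Proof. by rewrite ltr0n. Qed.

Let Qm w := m%:R^-1 * \sum_(j < m) f (Y w + c *: noise (A j) w).
Let Nm i w := m%:R^-1 * \sum_(j < m) D i (Y w + c *: noise (A j) w).

Let Qxi w : xi <= Qm w.
Proof.
rewrite /Qm ler_pdivlMl// (@le_trans _ _ (\sum_(j < m) xi))//.
  by rewrite sumr_const card_ord [leLHS]mulr_natl.
by apply: ler_sum => j _; case/andP: (fb (Y w + c *: noise (A j) w)).
Qed.

Let Q0 w : 0 < Qm w. Proof. exact: lt_le_trans (Qxi w). Qed.

Let mcbE w i : mcb w 0 i = Nm i w / Qm w.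
Proof. by rewrite !mxE mulrC. Qed.

Lemma mcb_bound w i : `|mcb w 0 i| <= B.
Proof.
rewrite mcbE normrM normfV [X in _ / X]gtr0_norm// ler_pdivrMr//.
rewrite /Nm normrM gtr0_norm ?invr_gt0// /Qm mulrCA ler_pM2l ?invr_gt0//.
rewrite mulr_sumr (le_trans (ler_norm_sum _ _ _))//; apply: ler_sum => j _; exact: DB.
Qed.

Let mN j : (j < m)%N -> vmeas (fun w => Y w + c *: noise (A j) w).
Proof.
move=> jm; apply: vmeasD; first exact: (pvmeas_vmeas xs_law okL mY).
by apply: vmeasZ => //; apply: (noise_vmeas xs_law) => i; have [] := AS i jm.
Qed.

Let mQ : measurable_fun setT Qm.
Proof.
by apply: measurable_funM => //; apply: measurable_sum => j; exact: (lip_mfr flip (mN (ltn_ord j))).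
Qed.

Let mNm i : measurable_fun setT (Nm i).
Proof.
by apply: measurable_funM => //; apply: measurable_sum => j; exact: (lip_mfr (@Dlip i) (mN (ltn_ord j))).
Qed.

(** In [quot_diff] the empirical denominator is at least xi and the exact quotient at most B. The
    averages of [D i] and of [f] then contribute 2 B zeta / xi each, whence the factor 4. *)
Lemma mcb_err : E (fun w => n1 (mcb w - bdrift c (Y w))) <=
  d%:R * (4 * B * zeta / xi) / Num.sqrt m%:R.
Proof.
have mYT := pvmeas_vmeas xs_law okL mY.
have s0 : 0 < Num.sqrt m%:R :> R by rewrite sqrtr_gt0.
have mDmY i : measurable_fun setT (fun w => Dm c i (Y w)).
  exact: (lip_mfr (E_sm_lip hW (@Dlip i) (Dz i) c) mYT).
have mphiY : measurable_fun setT (fun w => phi c (Y w)).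
  exact: (lip_mfr (E_sm_lip hW flip fz c) mYT).
have Qz w : `|Qm w| <= zeta.
  rewrite gtr0_norm// /Qm ler_pdivrMl// (@le_trans _ _ (\sum_(j < m) zeta))//.
    by apply: ler_sum => j _; case/andP: (fb (Y w + c *: noise (A j) w)).
  by rewrite sumr_const card_ord [leRHS]mulr_natl.
have Nz i w : `|Nm i w| <= B * zeta.
  rewrite normrM gtr0_norm ?invr_gt0// ler_pdivrMl//.
  rewrite (le_trans (ler_norm_sum _ _ _))// (@le_trans _ _ (\sum_(j < m) B * zeta))//.
    by apply: ler_sum => j _; exact: Dz.
  by rewrite sumr_const card_ord [leRHS]mulr_natl.
have iN i : integ (fun w => `|Nm i w - Dm c i (Y w)|).
  apply: integ_abs; apply: (integ_bdd P (c := B * zeta + B * zeta)) => [|w].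
    exact: measurable_funB.
  rewrite (le_trans (ler_normB _ _))// lerD//; exact: (E_sm_bound hW (@Dlip i) (Dz i)).
have iQ : integ (fun w => `|Qm w - phi c (Y w)|).
  apply: integ_abs; apply: (integ_bdd P (c := zeta + zeta)) => [|w].
    exact: measurable_funB.
  rewrite (le_trans (ler_normB _ _))// lerD//; exact: (E_sm_bound hW flip fz).
have ib i : integ (fun w => `|mcb w 0 i - bdrift c (Y w) 0 i|).
  apply: integ_abs; apply: (integ_bdd P (c := B + B)) => [|w].
    apply: measurable_funB; last exact: (lip_mfr (@bdrift_lip c i) mYT).
    rewrite (_ : (fun w => _) = (fun w => Nm i w * (Qm w)^-1)).
      apply: measurable_funM => //.
      exact: measurable_inv_pos.
    by apply/funext => w; rewrite mcbE.
  by rewrite (le_trans (ler_normB _ _))// lerD//; exact: mcb_bound.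
have -> : E (fun w => n1 (mcb w - bdrift c (Y w))) = \sum_i E (fun w => `|mcb w 0 i - bdrift c (Y w) 0 i|).
  rewrite -E_sum//; congr (Rintegral _ _ _); apply/funext => w.
  by rewrite /n1; apply: eq_bigr => i _; rewrite [X in `|X|]mxE [X in _ + X]mxE.
rewrite (@le_trans _ _ (\sum_(i < d) (4 * B * zeta / xi) / Num.sqrt m%:R))//; last first.
  by rewrite sumr_const card_ord -[leLHS]mulr_natl mulrA.
apply: ler_sum => i _.
have h1 := mc_bound_ge0 hW xs_law xs_indep c okL mY m0 AS Ainj (@Dlip i) (Dz i).
have h2 := mc_bound_ge0 hW xs_law xs_indep c okL mY m0 AS Ainj flip fz.
apply: (@le_trans _ _ (E (fun w => xi^-1 * `|Nm i w - Dm c i (Y w)| + (xi^-1 * B) * `|Qm w - phi c (Y w)|))).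
  apply: E_le => // [|w]; first by apply: integD; exact: integZ.
  rewrite mcbE bbE (le_trans (quot_diff _ xi0 (Qxi _) (phi0 _ _) (Dphi _ _ _)))//.
  by rewrite mulrDl [X in X + _]mulrC mulrAC [X in _ + X * _]mulrC.
rewrite E_add; [|exact: integZ|exact: integZ].
rewrite !E_scale//.
apply: (@le_trans _ _ (xi^-1 * (2 * (B * zeta) / Num.sqrt m%:R) + xi^-1 * B * (2 * zeta / Num.sqrt m%:R))).
  apply: lerD; apply: ler_wpM2l; [|exact: h1| |exact: h2].
  - by rewrite invr_ge0 ltW.
  - by rewrite mulr_ge0// invr_ge0 ltW.
rewrite le_eqVlt; apply/orP; left; apply/eqP.
by field; rewrite !gt_eqF.
Qed.

End mcdrift.
End noise.
End data.

(** * The sampling algorithm *)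

Section times.
Context {R : realType}.
Variables (s : R) (K : nat).
Hypotheses (s0 : 0 < s) (K0 : (0 < K)%N).

(** The standard deviation of one step at temperature [s]; its square is also the coefficient of the
    drift, so an Euler step has the form treated in [one_step]. *)
Definition cstep : R := Num.sqrt (s / K%:R).
(* Standard deviation of the noise remaining at time k/K. *)
Definition ctime (k : nat) : R := Num.sqrt ((1 - k%:R / K%:R) * s).

Let KR : 0 < K%:R :> R. Proof. by rewrite ltr0n. Qed.

Lemma cstep_gt0 : 0 < cstep. Proof. by rewrite sqrtr_gt0 divr_gt0. Qed.

Lemma cstep_sq : cstep ^+ 2 = s / K%:R.
Proof. by rewrite sqr_sqrtr// divr_ge0// ltW. Qed.

Lemma ctime_ge0 k : 0 <= ctime k. Proof. exact: sqrtr_ge0. Qed.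

Lemma ctime_step k : (k < K)%N -> Num.sqrt (cstep ^+ 2 + ctime k.+1 ^+ 2) = ctime k.
Proof.
move=> kK; rewrite cstep_sq sqr_sqrtr; last first.
  rewrite mulr_ge0 ?(ltW s0)// subr_ge0 ler_pdivrMr// mul1r ler_nat//.
congr Num.sqrt; rewrite -natr1; field.
by rewrite gt_eqF.
Qed.

Lemma ctime0 : ctime 0 = Num.sqrt s.
Proof. by rewrite /ctime mul0r subr0 mul1r. Qed.

Lemma ctimeK : ctime K = 0.
Proof. by rewrite /ctime divff ?gt_eqF// subrr mul0r sqrtr0. Qed.

End times.

Section data.
Context {R : realType} {d : nat} {dT : measure_display} {T : measurableType dT}.
Variables (P : probability T R) (W : T -> 'rV[R]_d).
Hypothesis hW : std_gauss_vec P W.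
Notation vec := 'rV[R]_d.
Implicit Types (x y : vec).
Local Notation E F := (Rintegral P setT F%R).
Local Notation integ := (integ P).
Variables (V g : vec -> R) (s xi zeta B L Lf Lg : R) (K : nat).
Local Notation f := (fhat V s).
Local Notation D := (fun (i : 'I_d) (x : vec) => grad f x 0 i).
Hypotheses (s0 : 0 < s) (K0 : (0 < K)%N).
Hypotheses (xi0 : 0 < xi) (fb : forall x, xi <= f x <= zeta) (flip : lip Lf f)
  (glip : lip Lg g) (g01 : forall x, 0 <= g x <= 1)
  (Dlip : forall i, lip L (D i)) (DB : forall i x, `|D i x| <= B * f x)
  (B0 : 0 <= B) (L0 : 0 <= L) (Lf0 : 0 <= Lf) (Lg0 : 0 <= Lg)
  (taylor : forall x y, `|f (x + y) - f x - \sum_i D i x * y 0 i| <= L * n1 y ^+ 2).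
Hypothesis cB : cstep s K * B <= 1.
Local Notation bdrift := (bdrift P W f D).
Local Notation ufun := (ufun P W f g).
Local Notation Lu := (Lu xi zeta Lf Lg).

Lemma ufun0 x : ufun 0 x = g x.
Proof.
rewrite /ufun /hfun /phi.
have f0 : f x != 0 by rewrite gt_eqF// (lt_le_trans xi0)//; case/andP: (fb x).
have -> : (fun w => g (x + 0 *: W w) * f (x + 0 *: W w)) = (fun=> g x * f x).
  by apply/funext => w; rewrite scale0r addr0.
have -> : (fun w => f (x + 0 *: W w)) = (fun=> f x).
  by apply/funext => w; rewrite scale0r addr0.
by rewrite !E_cst mulfK.
Qed.

Lemma driftE x (t : R) : drift P W V s x t = bdrift (Num.sqrt ((1 - t) * s)) x.
Proof.
apply/rowP => i; rewrite /drift !mxE !gaussEE mulrC; congr (_ / _).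
Qed.

Section algo.
Variables (m : nat) (epsn : nat -> T -> vec) (Z : nat -> nat -> T -> vec).
Hypothesis m0 : (0 < m)%N.
Local Notation noise := (fun (a : noise_idx * 'I_d) (w : T) =>
    match a.1 with Eps k => epsn k w 0 a.2 | Zn k j => Z k j w 0 a.2 end).
Local Notation used := [set a : noise_idx * 'I_d |
    match a.1 with Eps k => (1 <= k <= K)%N | Zn k j => (k < K)%N && (j < m)%N end].
Hypothesis noise_law : forall a, used a -> has_normal_law P (noise a) 0 1.
Hypothesis noise_indep : mutually_indep P used noise.

Definition znoise k : seq (noise_idx * 'I_d) := [seq (Zn k j, i) | j <- iota 0 m, i <- enum 'I_d].
Definition enoise k : seq (noise_idx * 'I_d) := [seq (Eps k, i) | i <- enum 'I_d].
(** Within a step the Monte Carlo samples are revealed before the Gaussian increment. The indices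
    differ by one because samples are numbered from 0 and increments from 1. *)
Fixpoint alg_past k := match k with 0 => [::] | k'.+1 => (alg_past k' ++ znoise k') ++ enoise k'.+1 end.

Lemma mem_znoise k a : a \in znoise k -> exists j i, (j < m)%N /\ a = (Zn k j, i).
Proof.
by move=> /allpairsP[[j i]] [/=]; rewrite mem_iota => jm _ ->; exists j, i; split.
Qed.

Lemma mem_alg_past k a : a \in alg_past k ->
  match a.1 with Eps j => (1 <= j <= k)%N | Zn j l => (j < k)%N && (l < m)%N end.
Proof.
elim: k => [//|k IH] /=; rewrite !mem_cat => /orP[/orP[/IH|/mem_znoise[j [i [jm ->]]]]|/mapP[i _ ->]] /=.
- case: a.1 => [j /andP[-> jk]|j l /andP[jk ->]] /=; first exact: leqW.
  by rewrite andbT ltnW.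
- by rewrite ltnSn.
- by rewrite leqnn.
Qed.

Lemma okpast_alg_past k : (k <= K)%N -> okpast used (alg_past k).
Proof.
move=> kK; split; last first.
  move=> a /mem_alg_past; rewrite /=; case: a.1 => [j /andP[-> jk]|j l /andP[jk ->]] /=.
    exact: leq_trans kK.
  by rewrite andbT (leq_trans jk).
elim: k {kK} => [//|k IH] /=; rewrite !cat_uniq IH /=.
have uz : uniq (znoise k).
  rewrite allpairs_uniq ?iota_uniq ?enum_uniq//.
  by move=> [j i] [j' i'] _ _ /= [-> ->].
have ue : uniq (enoise k.+1) by rewrite map_inj_uniq ?enum_uniq// => i i' [].
rewrite uz ue andbT andbT/=; apply/andP; split.
  by apply/hasPn => a /mem_znoise[j [i [jm ->]]]; apply/negP => /mem_alg_past/=; rewrite ltnn.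
apply/hasPn => _ /mapP[i _ ->]; rewrite mem_cat negb_or; apply/andP; split.
  by apply/negP => /mem_alg_past /=; rewrite ltnn.
by apply/negP => /mem_znoise[j [i' [_ ]]].
Qed.

Lemma okpast_alg_past_z k : (k < K)%N -> okpast used (alg_past k ++ znoise k).
Proof.
move=> kK; have [u us] := okpast_alg_past kK; split.
  by move: u; rewrite /= cat_uniq => /andP[].
by move=> a ak; apply: us; rewrite /= mem_cat ak.
Qed.

Definition Yalg k w := Ytilde V s K m (fun k => epsn k w) (fun k j => Z k j w) k.

Definition balg k w := btilde V s K m (fun j => Z k j w) (Yalg k w) k.

Lemma noise_eps k w : noisevec noise (fun i => (Eps k, i)) w = epsn k w.
Proof. by apply/rowP => i; rewrite mxE. Qed.

Lemma noise_Z k j w : noisevec noise (fun i => (Zn k j, i)) w = Z k j w.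
Proof. by apply/rowP => i; rewrite mxE. Qed.

Lemma balg_mcb k w : balg k w =
  mcb f D noise (Yalg k) (fun j i => (Zn k j, i)) m (ctime s K k) w.
Proof.
rewrite /balg /btilde /mcb.
apply: (f_equal2 (fun (a : R) (v : vec) => a^-1 *: v)).
  by apply: congr1; apply: eq_bigr => j _; rewrite noise_Z.
apply/rowP => i; rewrite !mxE summxE; apply: congr1.
by apply: eq_bigr => j _; rewrite noise_Z.
Qed.

Lemma Yalg_step k w : Yalg k.+1 w =
  Yalg k w + cstep s K ^+ 2 *: balg k w + cstep s K *: noisevec noise (fun i => (Eps k.+1, i)) w.
Proof. by rewrite noise_eps cstep_sq. Qed.

(** The loss of one step: the Monte Carlo error of the drift, then the discretisation error. *)
Definition alg_err := Lu * cstep s K ^+ 2 * (d%:R * (4 * B * zeta / xi) / Num.sqrt m%:R)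
   + Lu * cstep s K ^+ 3 * (B ^+ 2 + L / xi) * Kd d.

Lemma balg_pvmeas k : (k < K)%N -> pvmeas noise (alg_past k) (Yalg k) -> pvmeas noise (alg_past k ++ znoise k) (balg k).
Proof.
move=> kK mY.
have mY' : pvmeas noise (alg_past k ++ znoise k) (Yalg k).
  by apply: pvmeas_mono mY => a ak; rewrite mem_cat ak.
have mf := lip_mfr flip.
have mZ j (i : 'I_d) : (j < m)%N -> (Zn k j, i) \in alg_past k ++ znoise k.
  move=> jm; rewrite mem_cat; apply/orP; right.
  by apply: (allpairs_f (fun j i => (Zn k j, i))); rewrite ?mem_iota ?mem_enum.
have mYZ j : (j < m)%N -> pvmeas noise (alg_past k ++ znoise k)
    (fun w => Yalg k w + ctime s K k *: noisevec noise (fun i => (Zn k j, i)) w).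
  move=> jm; apply: (@vmeasD _ _ _ (g_sigma_algebraType (past noise (alg_past k ++ znoise k)))) => //.
  apply: (@vmeasZ _ _ _ (g_sigma_algebraType (past noise (alg_past k ++ znoise k)))) => //.
  by apply: noise_pvmeas => i; exact: mZ.
have -> : balg k = mcb f D noise (Yalg k) (fun j i => (Zn k j, i)) m (ctime s K k).
  by apply/funext => w; exact: balg_mcb.
apply: (@vmeasZ _ _ _ (g_sigma_algebraType (past noise (alg_past k ++ znoise k)))).
  apply: measurable_inv_pos => [|w].
    apply: measurable_funM => //; apply: measurable_sum => j.
    exact: (pmeas_mfr mf (mYZ j (ltn_ord j))).
  have mR : 0 < m%:R :> R by rewrite ltr0n.
  rewrite mulr_gt0 ?invr_gt0// (@lt_le_trans _ _ (\sum_(j < m) xi))//.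
    by rewrite sumr_const card_ord pmulrn_lgt0.
  by apply: ler_sum => j _; case/andP: (fb (Yalg k w + ctime s K k *: noisevec noise (fun i => (Zn k j, i)) w)).
move=> i; rewrite (_ : (fun w => _) = (fun w => m%:R^-1 * \sum_(j < m) D i
   (Yalg k w + ctime s K k *: noisevec noise (fun i => (Zn k j, i)) w))).
  apply: measurable_funM => //; apply: measurable_sum => j.
  exact: (pmeas_mfr (lip_mfr (@Dlip i)) (mYZ j (ltn_ord j))).
by apply/funext => w; rewrite mxE.
Qed.

Lemma alg_pvmeas k : (k <= K)%N -> pvmeas noise (alg_past k) (Yalg k).
Proof.
elim: k => [_|k IH kK]; first by move=> i; exact: measurable_cst.
have mY := IH (ltnW kK).
have mY' : pvmeas noise (alg_past k ++ znoise k) (Yalg k).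
  by apply: pvmeas_mono mY => a ak; rewrite mem_cat ak.
have sub : {subset alg_past k ++ znoise k <= alg_past k.+1} by move=> a ak; rewrite /= mem_cat ak.
have mb := balg_pvmeas kK mY.
have mE (i : 'I_d) : (Eps k.+1, i) \in alg_past k.+1.
  by rewrite /= mem_cat map_f ?orbT// mem_enum.
rewrite (_ : Yalg k.+1 = fun w => Yalg k w + cstep s K ^+ 2 *: balg k w +
     cstep s K *: noisevec noise (fun i => (Eps k.+1, i)) w); last first.
    by apply/funext => w; exact: Yalg_step.
  apply: (@vmeasD _ _ _ (g_sigma_algebraType (past noise (alg_past k.+1)))).
    apply: (@vmeasD _ _ _ (g_sigma_algebraType (past noise (alg_past k.+1)))).
      exact: pvmeas_mono mY'.
    apply: (@vmeasZ _ _ _ (g_sigma_algebraType (past noise (alg_past k.+1)))) => //.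
    exact: pvmeas_mono mb.
  apply: (@vmeasZ _ _ _ (g_sigma_algebraType (past noise (alg_past k.+1)))) => //.
  exact: noise_pvmeas.
Qed.

Lemma alg_chain k : (k <= K)%N ->
  E (fun w => ufun (ctime s K k) (Yalg k w)) <= ufun (ctime s K 0) 0 + k%:R * alg_err.
Proof.
elim: k => [_|k IH kK].
  have -> : (fun w => ufun (ctime s K 0) (Yalg 0 w)) = (fun=> ufun (ctime s K 0) 0) by [].
  by rewrite mul0r addr0 E_cst.
have {}IH := IH (ltnW kK).
have mY := alg_pvmeas (ltnW kK).
have ok1 := okpast_alg_past (ltnW kK); have ok2 := okpast_alg_past_z kK.
have mY' : pvmeas noise (alg_past k ++ znoise k) (Yalg k).
  by apply: pvmeas_mono mY => a ak; rewrite mem_cat ak.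
have AS j i : (j < m)%N -> used (Zn k j, i) /\ (Zn k j, i) \notin alg_past k.
  move=> jm; split; first by rewrite /= kK jm.
  by apply/negP => /mem_alg_past/=; rewrite ltnn.
have Ainj j j' (i i' : 'I_d) : (Zn k j, i) = (Zn k j', i') -> j = j' /\ i = i' by case=> -> ->.
have mb := balg_pvmeas kK mY.
have bB w i : `|balg k w 0 i| <= B.
  by rewrite balg_mcb; exact: (@mcb_bound _ _ _ _ f D xi zeta B xi0 fb DB _ _ _ _ _ _ m0).
have fr : fresh used (alg_past k ++ znoise k) (fun i => (Eps k.+1, i)).
  split; first by move=> i i' [].
  move=> i; split; first by rewrite /= kK.
  rewrite mem_cat negb_or; apply/andP; split.
    by apply/negP => /mem_alg_past /=; rewrite ltnn.
  by apply/negP => /mem_znoise[j [i' [_ ]]].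
(* The increment is integrated with the samples of the step in the past, so that the drift is known;
   the drift error is afterwards averaged with [alg_past k] alone as past. *)
have := step_bound hW xi0 fb flip glip g01 Dlip DB B0 L0 Lf0 Lg0 taylor noise_law noise_indep
  ok2 fr mY' mb bB (cstep_gt0 s0 K0) (ctime_ge0 s K k.+1) cB.
rewrite (ctime_step s0 K0 kK) => h.
have <- : (fun w => ufun (ctime s K k.+1) (Yalg k w + cstep s K ^+ 2 *: balg k w +
    cstep s K *: noisevec noise (fun i => (Eps k.+1, i)) w)) =
    (fun w => ufun (ctime s K k.+1) (Yalg k.+1 w)).
  by apply/funext => w; rewrite Yalg_step.
apply: (le_trans h).
rewrite -natr1 mulrDl mul1r -addrA [leRHS]addrA.
apply: lerD => //; rewrite /alg_err lerD2r.
have zeta0 : 0 <= zeta by have /andP[h1 h2] := fb 0; rewrite (le_trans (ltW xi0))// (le_trans h1).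
apply: ler_wpM2l.
  by rewrite mulr_ge0 ?sqr_ge0// divr_ge0 ?(ltW xi0)// addr_ge0// mulr_ge0.
have -> : (fun w => n1 (balg k w - bdrift (ctime s K k) (Yalg k w))) =
   (fun w => n1 (mcb f D noise (Yalg k) (fun j i => (Zn k j, i)) m (ctime s K k) w
     - bdrift (ctime s K k) (Yalg k w))).
  by apply/funext => w; rewrite balg_mcb.
exact: (mcb_err hW xi0 fb flip Dlip DB B0 noise_law noise_indep _ ok1 mY m0 AS Ainj).
Qed.

Lemma alg_vmeas : vmeas (Yalg K).
Proof. exact: (pvmeas_vmeas noise_law (okpast_alg_past (leqnn K)) (alg_pvmeas (leqnn K))). Qed.

Lemma alg_final : E (fun w => g (Yalg K w)) <= ufun (Num.sqrt s) 0 + K%:R * alg_err.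
Proof.
have := alg_chain (leqnn K); rewrite (ctimeK s K0) ctime0.
by have -> : (fun w => ufun 0 (Yalg K w)) = (fun w => g (Yalg K w)) by apply/funext => w; rewrite ufun0.
Qed.

End algo.
End data.

(** * The diffusion *)

Section realpath.
Context {R : realType}.

(** Heine's theorem on a segment, with [u] allowed to leave it. *)
Lemma segment_unif_continuous (b : R -> R) (a c eps : R) : continuous b -> 0 < eps ->
  \forall n \near \oo, forall t u, a <= t <= c -> `|u - t| <= n%:R^-1 -> `|b u - b t| <= eps.
Proof.
move=> cb e0.
have /compact_near_coveringP/(_ nat \oo
  (fun n t => forall u, `|u - t| <= n%:R^-1 -> `|b u - b t| <= eps)) h := @segment_compact _ a c.
have : \forall n \near \oo, `[a, c]%classic `<=`
    (fun t => forall u, `|u - t| <= n%:R^-1 -> `|b u - b t| <= eps).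
  apply: h => t _.
  have e20 : 0 < eps / 2 by rewrite divr_gt0.
  have /nbhs_ballP[del /= del0 bd] : \forall u \near t, `|b t - b u| < eps / 2.
    by move: (cb t) => /cvgrPdist_lt; apply.
  have hd : 0 < del / 2 by rewrite divr_gt0.
  have hs u : `|u - t| < del -> `|b t - b u| < eps / 2.
    by move=> ut; apply: bd => /=; rewrite /ball/= distrC.
  exists (ball t (del / 2), [set n | n%:R^-1 < del / 2 :> R]); first split => /=.
  - exact: nbhsx_ballx.
  - exists (Num.truncn (del / 2)^-1).+1 => // n /= hn.
    have hn' : (del / 2)^-1 < n%:R by rewrite (lt_le_trans (truncnS_gt _))// ler_nat.
    by rewrite invf_plt ?posrE// (lt_trans _ hn')// invr_gt0.
  move=> [t' n] [/=]; rewrite /ball/= => tt' nd u ut'.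
  rewrite -(subrKA (b t)) (le_trans (ler_normD _ _))// [leRHS]splitr lerD//.
    rewrite distrC ltW// hs// -(subrKA t') (le_lt_trans (ler_normD _ _))//.
    by rewrite [ltRHS]splitr ltrD//; [exact: le_lt_trans ut' nd|rewrite distrC].
  by rewrite ltW// hs// distrC (lt_trans tt')// ltr_pdivrMr// ltr_pMr// ltr1n.
apply: filterS => n hn t u tac; apply: hn; by rewrite /= in_itv/=.
Qed.

Lemma discrete_gronwall (e : nat -> R) (r q : R) (K : nat) : 0 <= r -> 0 <= q -> e 0%N <= 0 ->
  (forall k, (k < K)%N -> e k.+1 <= e k + r * (e k + q)) ->
  e K <= q * expR (r * K%:R).
Proof.
move=> r0 q0 e0 h.
have H k : (k <= K)%N -> e k + q <= q * (1 + r) ^+ k.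
  elim: k => [_|k IH kK]; first by rewrite expr0 mulr1 -[leRHS]add0r lerD2r.
  rewrite (@le_trans _ _ ((e k + q) * (1 + r)))//; first by have := h k kK; lra.
  by rewrite exprSr mulrA ler_wpM2r ?addr_ge0// IH// ltnW.
rewrite (@le_trans _ _ (e K + q)) ?lerDl// (le_trans (H K (leqnn K)))//.
rewrite ler_wpM2l// mulrC expRM_natl lerXn2r ?nnegrE ?addr_ge0 ?expR_ge0//.
exact: expR_ge1Dx.
Qed.

End realpath.

Section clip.
Context {R : realType}.
Local Notation mu := (@lebesgue_measure R).

(** Composition with this projection extends functions of time from [0, 1] to the whole line. *)
Definition clip01 (t : R) : R := Num.max 0 (Num.min t 1).

Lemma clip01_range t : 0 <= clip01 t <= 1.
Proof. by rewrite /clip01 le_max lexx/= ge_max ler01 ge_min lexx orbT. Qed.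

Lemma clip01_id t : 0 <= t <= 1 -> clip01 t = t.
Proof. by case/andP=> t0 t1; rewrite /clip01 (min_idPl t1) (max_idPr t0). Qed.

Lemma clip01_mono t u : t <= u -> clip01 t <= clip01 u.
Proof.
move=> tu; rewrite /clip01 ge_max !le_max lexx/=; apply/orP.
have [|h] := leP u 1.
  by move=> u1; right; rewrite ge_min tu.
by right; rewrite ge_min lexx orbT.
Qed.

Lemma measurable_clip01 : measurable_fun setT clip01.
Proof. by apply: nondecreasing_measurable => // t u; exact: clip01_mono. Qed.

Local Open Scope ereal_scope.

(** The integral is a supremum over simple functions below the integrand, a family that grows with
    the integrand whether or not it is measurable. *)
Lemma ge0_le_integral_nonmeas (f g : R -> \bar R) : (forall x, 0 <= f x) -> (forall x, f x <= g x) ->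
  \int[mu]_x f x <= \int[mu]_x g x.
Proof.
move=> f0 fg.
have g0 x : 0 <= g x by exact: le_trans (fg x).
rewrite !ge0_integralTE//; apply: ub_ereal_sup => _ [h hf <-].
by apply: ereal_sup_ubound; exists h => // x; exact: le_trans (fg x).
Qed.

(* No measurability of [beta] is available yet: it is only obtained from that of the solution. *)
Lemma primitive_fin_num (beta : R -> R) (M v : R) : (forall u, 0 <= beta u <= M)%R ->
  \int[mu]_(u in `[0%R, v]) (beta u)%:E \is a fin_num.
Proof.
move=> bM; have b0 x : (0 <= (beta x)%:E) by rewrite lee_fin; case/andP: (bM x).
rewrite ge0_fin_numE; last exact: integral_ge0.
rewrite integral_mkcond.
apply: (@le_lt_trans _ _ (\int[mu]_x ((cst M%:E) \_ (`[0%R, v]%classic)) x)).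
  apply: ge0_le_integral_nonmeas => x; rewrite /patch; case: ifP => //= _.
  by rewrite lee_fin; case/andP: (bM x).
rewrite -integral_mkcond integral_cst//= lebesgue_measure_itv/=.
by case: ifP => _; rewrite ?mule0 ?ltry// -EFinD -EFinM ltry.
Qed.

(** A primitive of a nonnegative function is nondecreasing, and monotone functions are
    measurable. *)
Lemma measurable_ge0_primitive (beta : R -> R) (M : R) : (forall u, 0 <= beta u <= M)%R ->
  measurable_fun setT (fun t => fine (\int[mu]_(u in `[0%R, clip01 t]) (beta u)%:E)).
Proof.
move=> bM; apply: nondecreasing_measurable => // t u tu.
have b0 x : (0 <= (beta x)%:E) by rewrite lee_fin; case/andP: (bM x).
apply: fine_le; [exact: (primitive_fin_num _ bM)|exact: (primitive_fin_num _ bM)|].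
rewrite [leLHS]integral_mkcond [leRHS]integral_mkcond.
apply: ge0_le_integral_nonmeas => x; rewrite /patch; first by case: ifP.
have h := clip01_mono tu.
case: ifPn => [|_]; last by case: ifP.
rewrite inE/= in_itv/= => /andP[x0 xt].
by rewrite mem_set//= in_itv/= x0 (le_trans xt).
Qed.

Lemma measurable_primitive (beta : R -> R) (M : R) : (forall u, `|beta u| <= M)%R ->
  measurable_fun setT (fun t => Rintegral mu `[0%R, clip01 t] beta).
Proof.
move=> bM.
have hp u : (0 <= Num.max (beta u) 0 <= M)%R.
  by rewrite le_max lexx orbT/= ge_max (le_trans (ler_norm _) (bM u)) (le_trans _ (bM u)).
have hn u : (0 <= Num.max (- beta u) 0 <= M)%R.
  by rewrite le_max lexx orbT/= ge_max (le_trans _ (bM u)) ?(le_trans _ (bM u))// -normrN ler_norm.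
rewrite (_ : (fun t => _) = fun t => (fine (\int[mu]_(u in `[0%R, clip01 t]) (Num.max (beta u) 0)%:E) -
   fine (\int[mu]_(u in `[0%R, clip01 t]) (Num.max (- beta u) 0)%:E))%R).
  apply: measurable_funB; exact: measurable_ge0_primitive.
apply/funext => t; rewrite /Rintegral -fineB; [|exact: (primitive_fin_num _ hp)|exact: (primitive_fin_num _ hn)].
congr fine; rewrite integralE; congr (_ - _); apply: eq_integral => u _.
  by rewrite unlock/= EFin_max.
by rewrite unlock/= EFin_max.
Qed.

End clip.

Lemma le_sqrt_dist (R : realType) (a b : R) : 0 <= b -> b <= a ->
  `|Num.sqrt b - Num.sqrt a| <= Num.sqrt (a - b).
Proof.
move=> b0 ba; have a0 : 0 <= a by exact: le_trans ba.
have h : Num.sqrt b <= Num.sqrt a by rewrite ler_sqrt.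
rewrite distrC ger0_norm ?subr_ge0// -[leLHS]ger0_norm ?subr_ge0// -sqrtr_sqr ler_sqrt ?subr_ge0//.
rewrite sqrrB !sqr_sqrtr//.
have : Num.sqrt b * Num.sqrt b <= Num.sqrt a * Num.sqrt b by rewrite ler_wpM2r.
rewrite -expr2 sqr_sqrtr//; lra.
Qed.

Section path.
Context {R : realType} {d : nat} {dT : measure_display} {T : measurableType dT}.
Variables (P : probability T R) (W : T -> 'rV[R]_d).
Hypothesis hW : std_gauss_vec P W.
Notation vec := 'rV[R]_d.
Local Notation mu := (@lebesgue_measure R).
Variables (f : vec -> R) (D : 'I_d -> vec -> R) (xi zeta B L Lf s : R).
Hypotheses (xi0 : 0 < xi) (fb : forall x, xi <= f x <= zeta) (flip : lip Lf f)
  (Dlip : forall i, lip L (D i)) (DB : forall i x, `|D i x| <= B * f x)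
  (B0 : 0 <= B) (L0 : 0 <= L) (Lf0 : 0 <= Lf) (s0 : 0 < s).
Local Notation bdrift := (bdrift P W f D).
Local Notation Lb := (Lb xi B L Lf).

Let bbB c x i : `|bdrift c x 0 i| <= B.
Proof. exact: (bdrift_bound hW xi0 fb flip Dlip DB). Qed.

Let Lb0 : 0 <= Lb. Proof. exact: Lb_ge0. Qed.

(* Joint measurability is obtained by seeing (c, x) as a vector of dimension d + 1. *)
Lemma bdrift_joint_meas dT' (T' : measurableType dT') (c : T' -> R) (Y : T' -> vec) i :
  measurable_fun setT c -> vmeas Y -> measurable_fun setT (fun w => bdrift (c w) (Y w) 0 i).
Proof.
move=> mc mY.
pose F (y : 'rV[R]_d.+1) := bdrift (y 0 0) (\row_j y 0 (lift ord0 j)) 0 i.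
have hF : lip (Lb * (m1d d + 1)) F.
  move=> y z; rewrite /F.
  set xy : vec := \row_j y 0 (lift ord0 j); set xz : vec := \row_j z 0 (lift ord0 j).
  have hn : n1 (y - z) = `|y 0 0 - z 0 0| + n1 (xy - xz).
    rewrite /n1 big_ord_recl !mxE; congr (_ + _).
    by apply: eq_bigr => j _; rewrite !mxE.
  have m0 := @m1d_ge0 R d.
  rewrite -(subrKA (bdrift (y 0 0) xz 0 i)) (le_trans (ler_normD _ _))//.
  have h1 := bdrift_lip hW xi0 fb flip Dlip DB B0 (y 0 0) i xy xz.
  have h2 := bdrift_lipc hW xi0 fb flip Dlip DB B0 L0 Lf0 (y 0 0) (z 0 0) xz i.
  rewrite (le_trans (lerD h1 h2))// hn -mulrDr -mulrA ler_wpM2l//.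
  rewrite mulrDl mul1r mulrDr [X in X + _ + _]mulrC.
  have := @n1_ge0 R d (xy - xz).
  have := normr_ge0 (y 0 0 - z 0 0); set p := `|_|; set q := n1 _ => hp hq.
  have : 0 <= m1d d * q by rewrite mulr_ge0.
  lra.
pose Z w : 'rV[R]_d.+1 := \row_j (if unlift ord0 j is Some k then Y w 0 k else c w).
have mZ : vmeas Z.
  move=> j; rewrite (_ : (fun w => _) = fun w => if unlift ord0 j is Some k then Y w 0 k else c w).
    by case: (unlift ord0 j) => [k|]; [exact: mY|exact: mc].
  by apply/funext => w; rewrite mxE.
rewrite (_ : (fun w => _) = fun w => F (Z w)); first exact: (lip_mfr hF mZ).
apply/funext => w; rewrite /F /Z mxE unlift_none; congr (bdrift _ _ 0 i).
by apply/rowP => j; rewrite !mxE liftK.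
Qed.

Variables (x b : R -> vec).
Hypothesis cb : forall i, continuous (fun t => b t 0 i).
Hypothesis b0 : b 0 = 0.
Local Notation be i := (fun u : R => bdrift (Num.sqrt ((1 - u) * s)) (x u) 0 i).
Hypothesis xE : forall t, 0 <= t <= 1 ->
  x t = s *: (\row_i Rintegral mu `[0, t] (be i)) + Num.sqrt s *: b t.

Let bt i (u : R) := be i (clip01 u).

(** A bootstrap: the integral in the equation is measurable in time merely because its integrand is
    bounded, hence so is the path [x], hence so is the drift along it. *)
Lemma measurable_path_drift i : measurable_fun setT (bt i).
Proof.
apply: bdrift_joint_meas.
  have h : measurable_fun setT (fun u : R => (1 - clip01 u) * s).
    apply: measurable_funM => //; apply: measurable_funB => //; exact: measurable_clip01.
  have hs : measurable_fun setT (@Num.sqrt R).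
    by apply: nondecreasing_measurable => // p q; exact: ler_wsqrtr.
  exact (measurableT_comp hs h).
move=> j; rewrite (_ : (fun w => _) = fun u => s * Rintegral mu `[0, clip01 u] (be j) +
   Num.sqrt s * b (clip01 u) 0 j); last first.
  by apply/funext => u; rewrite xE ?clip01_range// !mxE.
apply: measurable_funD; apply: measurable_funM => //.
  by apply: (@measurable_primitive _ _ B) => u; exact: bbB.
exact: (measurableT_comp (continuous_measurable_fun (@cb j)) (@measurable_clip01 R)).
Qed.

Let itv_int (I : interval R) (h : R -> R) M : (mu [set` I] < +oo)%E -> measurable_fun setT h ->
  (forall v, `|h v| <= M) -> mu.-integrable [set` I] (EFin \o h).
Proof.
move=> muI mh hM; apply: measurable_bounded_integrable => //; first exact: measurable_funTS mh.
by exists M; split; rewrite ?num_real// => M' MM' v _ /=; rewrite (le_trans (hM v))// ltW.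
Qed.

Let mu_itv_fin (a c : R) (p q : bool) : (mu [set` Interval (BSide p a) (BSide q c)] < +oo)%E.
Proof. by rewrite /= lebesgue_measure_itv/=; case: ifP => _; rewrite ?ltry// -EFinD ltry. Qed.

Lemma path_increment t u i : 0 <= t -> t <= u -> u <= 1 ->
  x u 0 i - x t 0 i = s * Rintegral mu `]t, u] (bt i) + Num.sqrt s * (b u 0 i - b t 0 i).
Proof.
move=> t0 tu u1.
have hE v : 0 <= v -> v <= 1 -> Rintegral mu `[0, v] (be i) = Rintegral mu `[0, v] (bt i).
  move=> v0 v1; apply: eq_Rintegral => w; rewrite inE/= in_itv/= => /andP[w0 wv].
  by rewrite /bt clip01_id// w0 (le_trans wv).
rewrite !xE ?t0 ?u1 ?(le_trans tu) ?(le_trans t0)// !mxE !hE ?(le_trans tu) ?(le_trans t0)//.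
have <- : Rintegral mu `[0, u] (bt i) - Rintegral mu `[0, t] (bt i) = Rintegral mu `]t, u] (bt i).
  apply: Rintegral_itvB; rewrite ?bnd_simp//.
  by apply: (itv_int (M := B)) => //; exact: measurable_path_drift.
ring.
Qed.

Lemma path_drift_dev t u i (c M : R) : 0 <= t -> t <= u -> u <= 1 ->
  (forall v, t <= v <= u -> `|be i v - c| <= M) ->
  `|Rintegral mu `]t, u] (bt i) - (u - t) * c| <= M * (u - t).
Proof.
move=> t0 tu u1 h.
have mui : mu `]t, u]%classic = (u - t)%:E.
  rewrite /= lebesgue_measure_itv/= lte_fin; case: ltP => [_|ut]; first by rewrite EFinB.
  by have -> : u = t; [apply/eqP; rewrite eq_le ut|rewrite subrr].
have mb := measurable_path_drift i.
have bi : mu.-integrable `]t, u] (EFin \o bt i) by apply: (itv_int (M := B)) => // v; exact: bbB.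
have ci r : mu.-integrable `]t, u] (EFin \o cst r) by apply: (itv_int (M := `|r|)) => // v; rewrite lexx.
have cE r : Rintegral mu `]t, u] (fun=> r) = r * (u - t).
  rewrite Rintegral_cst//; congr (_ * _).
  by have := congr1 fine mui; rewrite /=.
have -> : Rintegral mu `]t, u] (bt i) - (u - t) * c = Rintegral mu `]t, u] (fun v => bt i v - c).
  have := @RintegralB _ _ _ mu `]t, u]%classic (bt i) (fun=> c) _ bi (ci c).
  by rewrite cE [(u - t) * c]mulrC => ->.
have mbc : measurable_fun setT (fun v => bt i v - c) by exact: measurable_funB.
have bbc v : `|bt i v - c| <= B + `|c|.
  by rewrite (le_trans (ler_normB _ _))// lerD//; exact: bbB.
apply: le_trans (le_normr_Rintegral _ _) _ => //; first exact: (itv_int _ mbc bbc).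
rewrite -cE; apply: le_Rintegral => //.
  apply: (itv_int (M := B + `|c|)) => // [|v]; last by rewrite normr_id.
  exact: measurableT_comp mbc.
  exact: (ci M).
move=> v /=; rewrite in_itv/= => /andP[tv vu]; rewrite /bt clip01_id; last first.
  by rewrite (le_trans t0 (ltW tv)) (le_trans vu).
by apply: h; rewrite (ltW tv).
Qed.

Section euler.
Variable (K : nat).
Hypothesis K0 : (0 < K)%N.

Definition grid (k : nat) : R := k%:R / K%:R.

Let KR : 0 < K%:R :> R. Proof. by rewrite ltr0n. Qed.

Lemma grid_ge0 k : 0 <= grid k. Proof. by rewrite divr_ge0. Qed.

Lemma grid_le1 k : (k <= K)%N -> grid k <= 1.
Proof. by move=> kK; rewrite ler_pdivrMr// mul1r ler_nat. Qed.

Lemma grid_step k : grid k.+1 - grid k = K%:R^-1.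
Proof. by rewrite /grid -mulrBl -natr1 addrAC subrr add0r mul1r. Qed.

Lemma grid_lt k : grid k < grid k.+1.
Proof. by rewrite -subr_gt0 grid_step invr_gt0. Qed.

Fixpoint euler (k : nat) : vec := match k with 0 => 0 | k'.+1 =>
  euler k' + cstep s K ^+ 2 *: bdrift (ctime s K k') (euler k') +
  Num.sqrt s *: (b (grid k'.+1) - b (grid k')) end.

(** The driving path cancels in the difference of the solution and the chain, which leaves drift
    errors that the discrete Gronwall inequality sums. *)
Lemma euler_path eps : (forall t u, 0 <= t <= 1 -> `|u - t| <= K%:R^-1 -> n1 (b u - b t) <= eps) ->
  n1 (x 1 - euler K) <=
  (s * d%:R * B / K%:R + Num.sqrt s * eps + m1d d * cstep s K) * expR (s * d%:R * Lb).
Proof.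
move=> beps.
have eps0 : 0 <= eps.
  by rewrite (le_trans _ (beps 0 0 _ _)) ?n1_ge0 ?lexx ?ler01// subrr normr0 invr_ge0.
(* The local error has three sources: the displacement by the drift within a mesh interval, the
   oscillation of [b], and the change of the smoothing level, which is at most [cstep]. *)
set q := _ + _ + _.
have m0 := @m1d_ge0 R d.
have q0 : 0 <= q.
  rewrite !addr_ge0// ?mulr_ge0 ?sqrtr_ge0 ?invr_ge0//; exact: ltW.
pose r := s * d%:R * Lb / K%:R.
have r0 : 0 <= r by rewrite /r; apply: divr_ge0 => //; apply: mulr_ge0 => //; apply: mulr_ge0 => //; exact: ltW.
have gK : grid K = 1 by rewrite /grid divff// gt_eqF.
have -> : s * d%:R * Lb = r * K%:R by rewrite /r divfK// gt_eqF.
have -> : x 1 = x (grid K) by rewrite gK.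
apply: (@discrete_gronwall _ (fun k => n1 (x (grid k) - euler k)) r q K r0 q0).
  have x0 : x 0 = 0.
    rewrite xE ?lexx ?ler01// b0 scaler0 addr0; apply/rowP => i; rewrite !mxE.
    by rewrite set_itv1 Rintegral_set1 mulr0.
  by rewrite /grid mul0r x0 subr0 n10.
move=> k kK; set e := n1 (x (grid k) - euler k).
have t0 := grid_ge0 k; have tu := ltW (grid_lt k); have u1 := grid_le1 kK.
have near v : grid k <= v <= grid k.+1 -> n1 (x v - x (grid k)) <= s * d%:R * B / K%:R + Num.sqrt s * eps.
  move=> /andP[tv vu].
  have vK : v - grid k <= K%:R^-1 by rewrite -(grid_step k) lerD2r.
  have hc i : `|x v 0 i - x (grid k) 0 i| <= s * (B / K%:R) + Num.sqrt s * `|b v 0 i - b (grid k) 0 i|.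
    rewrite (path_increment _ t0 tv (le_trans vu u1)) (le_trans (ler_normD _ _))//.
    rewrite normrM (gtr0_norm s0) [X in _ + X]normrM [X in _ + X * _]ger0_norm ?sqrtr_ge0// lerD2r ler_pM2l//.
    have := @path_drift_dev (grid k) v i 0 B t0 tv (le_trans vu u1).
    rewrite mulr0 subr0 => h; rewrite (le_trans (h _))//; first by move=> ? _; rewrite subr0; exact: bbB.
    by rewrite ler_wpM2l.
  rewrite /n1 (@le_trans _ _ (\sum_i (s * (B / K%:R) + Num.sqrt s * `|b v 0 i - b (grid k) 0 i|)))//.
    by apply: ler_sum => i _; rewrite [X in `|X|]mxE [X in _ + X]mxE.
  rewrite big_split/= sumr_const card_ord -[X in X + _]mulr_natl -mulr_sumr.
  rewrite (_ : d%:R * (s * (B / K%:R)) = s * d%:R * B / K%:R); last by ring.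
  rewrite lerD2l ler_wpM2l ?sqrtr_ge0//.
  have := beps (grid k) v; rewrite t0 (le_trans tu u1) ger0_norm ?subr_ge0// => /(_ isT vK).
  by rewrite /n1; under eq_bigr do rewrite mxE [X in _ + X]mxE.
have dev v i : grid k <= v <= grid k.+1 -> `|be i v - bdrift (ctime s K k) (euler k) 0 i| <= Lb * (e + q).
  move=> tv; have /andP[tv1 tv2] := tv.
  rewrite -(subrKA (bdrift (Num.sqrt ((1 - v) * s)) (euler k) 0 i)) (le_trans (ler_normD _ _))//.
  have h1 := bdrift_lip hW xi0 fb flip Dlip DB B0 (Num.sqrt ((1 - v) * s)) i (x v) (euler k).
  have h2 := bdrift_lipc hW xi0 fb flip Dlip DB B0 L0 Lf0 (Num.sqrt ((1 - v) * s)) (ctime s K k) (euler k) i.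
  rewrite (le_trans (lerD h1 h2))// -mulrDr ler_wpM2l//.
  have h3 := n1_dist_add (x v) (x (grid k)) (euler k).
  have h4 := near v tv.
  have h5 : `|Num.sqrt ((1 - v) * s) - ctime s K k| <= cstep s K.
    have v1 : v <= 1 by exact: le_trans u1.
    rewrite /ctime -/(grid k) (le_trans (le_sqrt_dist _ _))//.
    - by rewrite mulr_ge0 ?subr_ge0// ltW.
    - by rewrite ler_wpM2r ?(ltW s0)// lerD2l lerN2.
    - rewrite -mulrBl opprB addrC addrA subrK ler_sqrt ?divr_ge0// ?(ltW s0)//.
      by rewrite mulrC ler_pM2l// -(grid_step k) lerD2r.
  have h6 : `|Num.sqrt ((1 - v) * s) - ctime s K k| * m1d d <= m1d d * cstep s K.
    by rewrite mulrC ler_wpM2l.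
  rewrite /e /q; lra.
have hc i : `|x (grid k.+1) 0 i - euler k.+1 0 i| <= `|x (grid k) 0 i - euler k 0 i| + s * (Lb * (e + q) / K%:R).
  have -> : x (grid k.+1) 0 i - euler k.+1 0 i = (x (grid k) 0 i - euler k 0 i) +
     s * (Rintegral mu `]grid k, grid k.+1] (bt i) - (grid k.+1 - grid k) * bdrift (ctime s K k) (euler k) 0 i).
    have := path_increment i t0 tu u1.
    move/eqP; rewrite subr_eq => /eqP ->.
    rewrite grid_step [euler k.+1]/= [X in _ - X]mxE [X in _ - (X + _)]mxE.
    rewrite [X in _ - (_ + X + _)]mxE [X in _ - (_ + X)]mxE [X in _ - (_ + _ * X)]mxE.
    rewrite [X in _ - (_ + _ * (_ + X))]mxE (cstep_sq K s0).
    by set p := Rintegral _ _ _; set p' := bdrift _ _; ring.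
  rewrite (le_trans (ler_normD _ _))// lerD2l normrM (gtr0_norm s0) ler_pM2l//.
  have := path_drift_dev t0 tu u1 (dev ^~ i); rewrite grid_step; exact.
rewrite [leLHS]/n1 (@le_trans _ _ (\sum_i (`|x (grid k) 0 i - euler k 0 i| + s * (Lb * (e + q) / K%:R))))//.
  by apply: ler_sum => i _; rewrite [X in `|X|]mxE [X in _ + X]mxE.
rewrite big_split/= sumr_const card_ord -[X in _ + X]mulr_natl.
rewrite (_ : d%:R * (s * (Lb * (e + q) / K%:R)) = r * (e + q)); last by rewrite /r; ring.
rewrite lerD2r /e /n1 le_eqVlt; apply/orP; left; apply/eqP.
by apply: eq_bigr => i _; rewrite [in RHS]mxE [X in _ = `|_ + X|]mxE.
Qed.

End euler.
End path.

(** * The Euler chain driven by Brownian increments, and its limit *)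

Section scaling.
Context {R : realType} {dT : measure_display} {T : measurableType dT}.
Variable P : probability T R.

Lemma has_normal_law_scale (X : T -> R) (r : R) : 0 < r -> has_normal_law P X 0 r ->
  has_normal_law P (fun w => X w / r) 0 1.
Proof.
move=> r0 [mX XE]; split; first exact: measurable_funM.
move=> A mA; pose A' := (fun z => z / r) @^-1` A.
have mA' : measurable A'.
  rewrite -[A']setTI; apply: measurable_funM => //.
rewrite [LHS](XE A' mA') -[LHS]mul1e -[RHS]mul1e.
rewrite -(setIT A') -(setIT A).
rewrite mul1e mul1e -(integral_indic (normal_prob 0 r) measurableT mA') -(integral_indic (normal_prob 0 1) measurableT mA).
rewrite ge0_integral_normal_affine//.
  apply: eq_integral => z _; rewrite !indicE; congr (_%:R%:E).
  have e : A' (0 + r * z) = A z by rewrite add0r /A'/= mulrAC divff ?mul1r ?gt_eqF.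
  case: (pselect (A z)) => Az; [rewrite (mem_set Az) mem_set//|rewrite (memNset Az) memNset//].
    by rewrite e.
  by rewrite e.
exact/measurable_EFinP.
Qed.

Lemma mutually_indep_scale (I : eqType) (S : set I) (X : I -> T -> R) (r : R) :
  mutually_indep P S X -> mutually_indep P S (fun i w => X i w / r).
Proof.
move=> h J uJ JS A mA.
have mA' i : measurable ((fun z => z / r) @^-1` A i).
  by rewrite -[X in measurable X]setTI; apply: measurable_funM.
exact: (h J uJ JS (fun i => (fun z => z / r) @^-1` A i) mA').
Qed.

End scaling.

Section data.
Context {R : realType} {d : nat} {dT : measure_display} {T : measurableType dT}.
Variables (P : probability T R) (W : T -> 'rV[R]_d).
Hypothesis hW : std_gauss_vec P W.
Notation vec := 'rV[R]_d.
Implicit Types (x y : vec).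
Local Notation E F := (Rintegral P setT F%R).
Local Notation integ := (integ P).
Variables (V g : vec -> R) (s xi zeta B L Lf Lg : R).
Local Notation f := (fhat V s).
Local Notation D := (fun (i : 'I_d) (x : vec) => grad f x 0 i).
Hypotheses (s0 : 0 < s).
Hypotheses (xi0 : 0 < xi) (fb : forall x, xi <= f x <= zeta) (flip : lip Lf f)
  (glip : lip Lg g) (g01 : forall x, 0 <= g x <= 1)
  (Dlip : forall i, lip L (D i)) (DB : forall i x, `|D i x| <= B * f x)
  (B0 : 0 <= B) (L0 : 0 <= L) (Lf0 : 0 <= Lf) (Lg0 : 0 <= Lg)
  (taylor : forall x y, `|f (x + y) - f x - \sum_i D i x * y 0 i| <= L * n1 y ^+ 2).
Local Notation bdrift := (bdrift P W f D).
Local Notation ufun := (ufun P W f g).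
Local Notation Lu := (Lu xi zeta Lf Lg).
Variable Bm : T -> R -> vec.
Hypothesis hB : brownian P Bm.

Section fixedK.
Variable K : nat.
Hypotheses (K0 : (0 < K)%N) (cB : cstep s K * B <= 1).

Let KR : 0 < K%:R :> R. Proof. by rewrite ltr0n. Qed.
Local Notation grid := (grid K).
Let sq : R := Num.sqrt K%:R^-1.

Let sq0 : 0 < sq. Proof. by rewrite sqrtr_gt0 invr_gt0. Qed.

Definition bm_incr (a : nat * 'I_d) (w : T) : R :=
  (Bm w (grid a.1.+1) 0 a.2 - Bm w (grid a.1) 0 a.2) / sq.
Local Notation xs := bm_incr.
Local Notation S := [set ki : nat * 'I_d | (ki.1 < K)%N].

Let hB2 := hB.2 K grid (grid_ge0 K 0) (fun k _ => grid_lt K0 k).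

Lemma bm_incr_law a : S a -> has_normal_law P (xs a) 0 1.
Proof.
case: a => k i /= kK; have := hB2.1 k i kK; rewrite grid_step//.
exact: has_normal_law_scale.
Qed.

Lemma bm_incr_indep : mutually_indep P S xs.
Proof. exact: mutually_indep_scale hB2.2. Qed.

Definition bm_past k : seq (nat * 'I_d) := [seq (j, i) | j <- iota 0 k, i <- enum 'I_d].

Lemma mem_bm_past k a : (a \in bm_past k) = (a.1 < k)%N.
Proof.
apply/allpairsP/idP => [[[j i] [/=]]|ak].
  by rewrite mem_iota => jk _ ->.
by exists a; rewrite mem_iota mem_enum; split => //; case: a ak.
Qed.

Lemma okpast_bm k : (k <= K)%N -> okpast S (bm_past k).
Proof.
move=> kK; split; last by move=> a; rewrite mem_bm_past => /leq_trans; apply.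
by rewrite allpairs_uniq ?iota_uniq ?enum_uniq// => -[j i] [j' i'] _ _ /= [-> ->].
Qed.

Local Notation Yb k := (fun w => euler P W f D s (Bm w) K k).

Lemma bm_step k w : euler P W f D s (Bm w) K k.+1 =
  Yb k w + cstep s K ^+ 2 *: bdrift (ctime s K k) (Yb k w) + cstep s K *: noisevec xs (fun i => (k, i)) w.
Proof.
rewrite /=; congr (_ + _); apply/rowP => i; rewrite !mxE /bm_incr/=.
have -> : cstep s K = Num.sqrt s * sq by rewrite /cstep sqrtrM ?(ltW s0).
by rewrite mulrACA divff ?gt_eqF// mulr1.
Qed.

Lemma euler_pvmeas k : (k <= K)%N -> pvmeas xs (bm_past k) (Yb k).
Proof.
elim: k => [_|k IH kK]; first by move=> i; exact: measurable_cst.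
have mY := IH (ltnW kK).
have mb : pvmeas xs (bm_past k) (fun w => bdrift (ctime s K k) (Yb k w)).
  exact: (bdrift_pvmeas hW xi0 fb flip Dlip DB B0).
have sub : {subset bm_past k <= bm_past k.+1}.
  by move=> a; rewrite !mem_bm_past => /ltnW.
rewrite (_ : Yb k.+1 = fun w => Yb k w + cstep s K ^+ 2 *: bdrift (ctime s K k) (Yb k w) +
   cstep s K *: noisevec xs (fun i => (k, i)) w); last first.
  by apply/funext => w; exact: bm_step.
apply: (@vmeasD _ _ _ (g_sigma_algebraType (past xs (bm_past k.+1)))).
  apply: (@vmeasD _ _ _ (g_sigma_algebraType (past xs (bm_past k.+1)))).
    exact: pvmeas_mono mY.
  apply: (@vmeasZ _ _ _ (g_sigma_algebraType (past xs (bm_past k.+1)))) => //.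
  exact: pvmeas_mono mb.
apply: (@vmeasZ _ _ _ (g_sigma_algebraType (past xs (bm_past k.+1)))) => //.
by apply: noise_pvmeas => i; rewrite mem_bm_past.
Qed.

Lemma bm_chain k : (k <= K)%N ->
  E (fun w => ufun (ctime s K k) (Yb k w)) <= ufun (ctime s K 0) 0
    + k%:R * (Lu * cstep s K ^+ 3 * (B ^+ 2 + L / xi) * Kd d).
Proof.
elim: k => [_|k IH kK].
  have -> : (fun w => ufun (ctime s K 0) (Yb 0 w)) = (fun=> ufun (ctime s K 0) 0) by [].
  by rewrite mul0r addr0 E_cst.
have {}IH := IH (ltnW kK).
have mY := euler_pvmeas (ltnW kK).
have ok1 := okpast_bm (ltnW kK).
have mb : pvmeas xs (bm_past k) (fun w => bdrift (ctime s K k) (Yb k w)).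
  exact: (bdrift_pvmeas hW xi0 fb flip Dlip DB B0).
have fr : fresh S (bm_past k) (fun i => (k, i)).
  split; first by move=> i i' [].
  by move=> i; split => //=; rewrite mem_bm_past ltnn.
have := step_bound hW xi0 fb flip glip g01 Dlip DB B0 L0 Lf0 Lg0 taylor bm_incr_law bm_incr_indep
  ok1 fr mY mb (fun w i => bdrift_bound hW xi0 fb flip Dlip DB _ _ i) (cstep_gt0 s0 K0) (ctime_ge0 s K k.+1) cB.
rewrite (ctime_step s0 K0 kK) => h.
have <- : (fun w => ufun (ctime s K k.+1) (Yb k w + cstep s K ^+ 2 *: bdrift (ctime s K k) (Yb k w) +
    cstep s K *: noisevec xs (fun i => (k, i)) w)) =
    (fun w => ufun (ctime s K k.+1) (Yb k.+1 w)).
  by apply/funext => w; rewrite -bm_step.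
apply: (le_trans h).
have -> : (fun w => n1 (bdrift (ctime s K k) (Yb k w) - bdrift (ctime s K k) (Yb k w))) = (fun=> 0).
  by apply/funext => w; rewrite subrr n10.
rewrite E_cst mulr0 addr0 -natr1 mulrDl mul1r addrA lerD2r.
exact: IH.
Qed.

Lemma bm_final : E (fun w => g (Yb K w)) <= ufun (Num.sqrt s) 0
    + K%:R * (Lu * cstep s K ^+ 3 * (B ^+ 2 + L / xi) * Kd d).
Proof.
have := bm_chain (leqnn K); rewrite (ctimeK s K0) ctime0.
have -> : (fun w => ufun 0 (Yb K w)) = (fun w => g (Yb K w)) by apply/funext => w; rewrite (ufun0 _ _ _ xi0 fb).
exact.
Qed.

End fixedK.

Lemma cvg_cstep : (cstep s n.+1 @[n --> \oo] --> (0 : R)).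
Proof.
rewrite -(@sqrtr0 R); apply: (@cvg_comp _ _ _ (fun n => s / n.+1%:R) Num.sqrt); last exact: sqrt_continuous.
rewrite -(mulr0 s); apply: cvgMr; exact: cvg_harmonic.
Qed.

Variable X : T -> R -> vec.
Hypotheses (hX : solves_sde P W V s Bm X) (mX : vmeas (fun w => X w 1)).
Local Notation Yn n := (fun w => euler P W f D s (Bm w) n.+1 n.+1).

Lemma euler_cvg : {ae P, forall w, n1 (X w 1 - Yn n w) @[n --> \oo] --> (0 : R)}.
Proof.
apply: filterS2 hB.1 hX => w [Bw0 Bwc] Xw.
have Xe (t : R) : 0 <= t <= 1 -> X w t = s *: (\row_i Rintegral (@lebesgue_measure R) `[0, t]
    (fun u => bdrift (Num.sqrt ((1 - u) * s)) (X w u) 0 i)) + Num.sqrt s *: Bm w t.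
  move=> ht; rewrite {1}(Xw t ht); congr (s *: _ + _); apply/rowP => i; rewrite !mxE.
  by apply: eq_Rintegral => u _; rewrite driftE.
have cB i : continuous (fun t => Bm w t 0 i).
  move=> t; apply: (@cvg_comp _ _ _ (Bm w) (fun M : vec => M 0 i)); first exact: Bwc.
  exact: coord_continuous.
have hp := euler_path hW xi0 fb flip Dlip DB B0 L0 Lf0 s0 cB Bw0 Xe.
set ex := expR (s * d%:R * Lb xi B L Lf) in hp.
have ex0 : 0 < ex := expR_gt0 _.
apply/cvgrPdist_le => e e0.
(* Chosen so that the oscillation of the Brownian path contributes at most e/2 after the Gronwall
   factor; the 1 keeps the denominator positive. *)
pose e1 := e / 2 / (ex * (Num.sqrt s * d%:R + 1)).
have den0 : 0 < ex * (Num.sqrt s * d%:R + 1).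
  by rewrite mulr_gt0// ltr_wpDl// mulr_ge0// sqrtr_ge0.
have e10 : 0 < e1 by rewrite !divr_gt0.
have h1 : \forall n \near \oo, forall i t u, 0 <= t <= 1 -> `|u - t| <= n%:R^-1 -> `|Bm w u 0 i - Bm w t 0 i| <= e1.
  apply: filter_forall => i; exact: segment_unif_continuous.
have h1' : \forall n \near \oo, forall i t u, 0 <= t <= 1 -> `|u - t| <= n.+1%:R^-1 -> `|Bm w u 0 i - Bm w t 0 i| <= e1.
  by case: h1 => N _ hN; exists N => // n Nn; apply: hN => /=; rewrite (leq_trans Nn).
have h2 : (s * d%:R * B * n.+1%:R^-1 + m1d d * cstep s n.+1) * ex @[n --> \oo] --> (0 : R).
  rewrite [X in _ --> X](_ : 0 = (s * d%:R * B * 0 + m1d d * 0) * ex); last by rewrite !mulr0 addr0 mul0r.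
  apply: cvgMl; apply: cvgD; apply: cvgMr; [exact: cvg_harmonic|exact: cvg_cstep].
have e20 : 0 < e / 2 by rewrite divr_gt0.
move/cvgrPdist_le : h2 => /(_ _ e20) h2.
apply: filterS2 h1' h2 => n hn1; rewrite !sub0r !normrN => hn2.
rewrite ger0_norm ?n1_ge0// (le_trans (hp n.+1 _ (d%:R * e1) _))//.
  move=> t u t01 ut; rewrite /n1 (@le_trans _ _ (\sum_(i < d) e1))//.
    by apply: ler_sum => i _; rewrite [X in `|X|]mxE [X in _ + X]mxE; exact: hn1.
  by rewrite sumr_const card_ord -[leLHS]mulr_natl.
rewrite addrAC mulrDl [leRHS]splitr lerD//; first exact: le_trans (ler_norm _) hn2.
have hsd : 0 <= Num.sqrt s * d%:R by rewrite mulr_ge0 ?sqrtr_ge0.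
rewrite (_ : Num.sqrt s * (d%:R * e1) * ex = e / 2 * (Num.sqrt s * d%:R / (Num.sqrt s * d%:R + 1))); last first.
  by rewrite /e1; field; rewrite !gt_eqF// ltr_wpDl.
by rewrite ger_pMr// ler_pdivrMr ?ltr_wpDl// mul1r lerDl.
Qed.

(** For n.+1 steps the discretisation error is a constant times s [cstep], which tends to 0, and
    dominated convergence replaces the chain by [X] at time 1. *)
Lemma sde_final : E (fun w => g (X w 1)) <= ufun (Num.sqrt s) 0.
Proof.
have mg := lip_mfr glip.
have mgX : measurable_fun setT (fun w => g (X w 1)) := mg _ _ _ mX.
have gb x : `|g x| <= 1 by have /andP[? ?] := g01 x; rewrite ger0_norm.
have igX : integ (fun w => g (X w 1)) by apply: (integ_bdd P (c := 1)) => // w; exact: gb.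
have mY n : vmeas (Yn n).
  exact: (pvmeas_vmeas (bm_incr_law (ltn0Sn n)) (okpast_bm (leqnn n.+1)) (euler_pvmeas (ltn0Sn n) (leqnn n.+1))).
have igY n : integ (fun w => g (Yn n w)).
  by apply: (integ_bdd P (c := 1)) => [|w]; [exact: (mg _ _ _ (mY n))|exact: gb].
pose h n w := `|g (X w 1) - g (Yn n w)|.
have mh n : measurable_fun setT (h n).
  by apply: measurableT_comp => //; apply: measurable_funB => //; exact: (mg _ _ _ (mY n)).
have hb n w : `|h n w| <= 2.
  rewrite normr_id (le_trans (ler_normB _ _))// (_ : 2 = 1 + 1 :> R) ?lerD//.
have ih n : integ (h n) by apply: (integ_bdd P (c := 2)).
have h0 : E (h n) @[n --> \oo] --> (0 : R).
  have [] := @dominated_convergence _ _ _ P setT measurableT (fun n => EFin \o h n) (cst 0%E) (cst 2%:E).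
  - by move=> n; exact/measurable_EFinP.
  - exact: measurable_cst.
  - apply: filterS euler_cvg => w hw _.
    apply/fine_cvgP; split; first by exists 0%N.
    have hq : Lg * n1 (X w 1 - Yn n w) @[n --> \oo] --> (0 : R).
      by rewrite -(mulr0 Lg); apply: cvgMr.
    have hs : h n w @[n --> \oo] --> (0 : R).
      apply: (squeeze_cvgr _ (@cvg_cst _ (0 : R) _ \oo _) hq).
      by exists 0%N => // n _ /=; rewrite /h normr_ge0; exact: glip.
    exact: hs.
  - exact: (integ_cst P 2).
  - by apply: aeW => w n _ /=; rewrite lee_fin.
  move=> _ _; rewrite integral_cst// mul0e => hc.
  exact: fine_cvg hc.
have key n : cstep s n.+1 * B <= 1 -> E (fun w => g (X w 1)) <= ufun (Num.sqrt s) 0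
   + s * (Lu * (B ^+ 2 + L / xi) * Kd d) * cstep s n.+1 + E (h n).
  move=> cB; have hY := bm_final (ltn0Sn n) cB.
  have : E (fun w => g (X w 1)) <= E (fun w => g (Yn n w) + h n w).
    apply: E_le => // [|w]; first exact: integD.
    by rewrite -lerBlDl ler_norm.
  rewrite E_add// => h1; rewrite (le_trans h1)// lerD2r (le_trans hY)// lerD2l le_eqVlt.
  apply/orP; left; apply/eqP; rewrite exprS (cstep_sq _ s0).
  have n0 : n.+1%:R != 0 :> R by rewrite pnatr_eq0.
  move: (n.+1%:R) n0 (cstep s n.+1) Lu (L / xi) (Kd d) => a a0 b c e k.
  by field.
(* The step condition [cB] holds for all large n, because [cstep] tends to 0. *)
have hk : \forall n \near \oo, E (fun w => g (X w 1)) <= ufun (Num.sqrt s) 0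
   + s * (Lu * (B ^+ 2 + L / xi) * Kd d) * cstep s n.+1 + E (h n).
  have h1 : cstep s n.+1 * B @[n --> \oo] --> (0 : R).
    by rewrite -(mul0r B); apply: cvgMl; exact: cvg_cstep.
  move/cvgrPdist_le : h1 => /(_ 1 ltr01); apply: filterS => n.
  rewrite sub0r normrN => hn; apply: key; exact: le_trans (ler_norm _) hn.
have hl : ufun (Num.sqrt s) 0 + s * (Lu * (B ^+ 2 + L / xi) * Kd d) * cstep s n.+1 + E (h n) @[n --> \oo]
    --> ufun (Num.sqrt s) 0.
  rewrite -[X in _ --> X]addr0 -[X in _ --> X + 0]addr0; apply: cvgD => //; apply: cvgD; first exact: cvg_cst.
  rewrite -[X in _ --> X](mulr0 (s * (Lu * (B ^+ 2 + L / xi) * Kd d))); apply: cvgMr; exact: cvg_cstep.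
rewrite -(cvg_lim _ hl)//; apply: limr_ge => //.
by apply/cvg_ex; eexists; exact: hl.
Qed.

End data.

(** * The potential *)

Section calculus.
Context {R : realType} {d : nat}.
Notation vec := 'rV[R]_d.
Implicit Types (x y z a : vec).
Local Notation e_ i := (@ebase R d i).

(** [C2] is phrased through partial derivatives, so the calculus proceeds along coordinate axes. *)
Definition pder (h : vec -> R) (Dh : 'I_d -> vec -> R) :=
  forall i z, is_derive z (e_ i) h (Dh i z).

Lemma line_is_derive (h : vec -> R) z v (t l : R) :
  is_derive (z + t *: v) v h l <-> is_derive t (1 : R) (fun u => h (z + u *: v)) l.
Proof.
have E : (fun k : R => k^-1 *: ((h \o shift (z + t *: v)) (k *: v) - h (z + t *: v))) =
    (fun k : R => k^-1 *: (((fun u => h (z + u *: v)) \o shift t) (k *: (1 : R)) - (fun u => h (z + u *: v)) t)).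
  apply/funext => k /=; congr (_ *: (h _ - _)).
  by rewrite addrCA -scalerDl [k *: 1]mulr1.
by split=> -[h1 h2]; split; move: h1 h2; rewrite /derivable /derive E.
Qed.

Lemma pder_line h Dh i z t : pder h Dh -> is_derive t (1 : R) (fun u => h (z + u *: e_ i)) (Dh i (z + t *: e_ i)).
Proof. by move=> hD; apply/line_is_derive; exact: hD. Qed.

Lemma pder_intro h Dh : (forall i z, is_derive (0 : R) (1 : R) (fun u => h (z + u *: e_ i)) (Dh i z)) ->
  pder h Dh.
Proof.
move=> hD i z; have := hD i z; rewrite -(line_is_derive h z (e_ i) 0 (Dh i z)).
by rewrite scale0r addr0.
Qed.

Lemma ebaseE i j : e_ i 0 j = (j == i)%:R.
Proof. by rewrite /ebase mxE eqxx. Qed.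

Lemma pder_coord_mvt h Dh i z (t C r : R) : pder h Dh -> `|t| <= r ->
  (forall u, `|u| <= r -> `|Dh i (z + u *: e_ i)| <= C) ->
  `|h (z + t *: e_ i) - h z| <= C * `|t|.
Proof.
move=> hD tr hC; pose F u := h (z + u *: e_ i).
have dF u : is_derive u (1 : R) F (Dh i (z + u *: e_ i)) by exact: pder_line.
have cF p q : {within `[p, q], continuous F}.
  by apply: derivable_within_continuous => u _; exact: ex_derive.
have F0 : F 0 = h z by rewrite /F scale0r addr0.
rewrite -F0; have [t0|t0] := leP 0 t.
  have [c] := MVT_segment t0 (fun u _ => dF u) (cF 0 t).
  rewrite in_itv/= => /andP[c0 ct] ->; rewrite subr0 normrM ler_wpM2r//.
  by apply: hC; rewrite ger0_norm// (le_trans ct)// (le_trans (ler_norm _) tr).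
have [c] := MVT_segment (ltW t0) (fun u _ => dF u) (cF t 0).
rewrite in_itv/= => /andP[c0 ct]; rewrite distrC => ->; rewrite sub0r normrM normrN ler_wpM2r//.
apply: hC; rewrite ler0_norm// (le_trans _ tr)// ltr0_norm// lerN2//.
Qed.

(** The mean value theorem on each edge of an axis-parallel path from y to y + a. The path stays
    within l1 distance |a|_1 of y, and the edge lengths add up to this norm. *)
Lemma coord_mvt h Dh y a (C : R) : pder h Dh ->
  (forall i z, n1 (z - y) <= n1 a -> `|Dh i z| <= C) -> `|h (y + a) - h y| <= C * n1 a.
Proof.
move=> hD hC.
pose w (l : seq 'I_d) : vec := \sum_(i <- l) a 0 i *: e_ i.
have wn l : uniq l -> n1 (w l) = \sum_(i <- l) `|a 0 i|.
  move=> ul; rewrite /n1 [RHS]big_uniq//= [RHS]big_mkcond/=; apply: eq_bigr => j _.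
  by rewrite /w coord_sum_delta//; case: ifP => // _; rewrite normr0.
have le_a l : uniq l -> \sum_(i <- l) `|a 0 i| <= n1 a.
  move=> ul; rewrite big_uniq//= /n1 [leRHS](bigID (mem l))/= lerDl.
  exact: sumr_ge0.
have H l : uniq l -> `|h (y + w l) - h y| <= C * \sum_(i <- l) `|a 0 i|.
  elim: l => [_|i l IH /= /andP[il ul]].
    by rewrite /w !big_nil addr0 subrr normr0 mulr0.
  have -> : y + w (i :: l) = (y + w l) + a 0 i *: e_ i by rewrite /w big_cons addrCA addrC.
  rewrite -(subrKA (h (y + w l))) (le_trans (ler_normD _ _))// big_cons mulrDr lerD//; last exact: IH.
  apply: (pder_coord_mvt (Dh := Dh) (r := `|a 0 i|)) => // u ua.
  apply: hC; have -> : y + w l + u *: e_ i - y = w l + u *: e_ i by rewrite -(addrA y) [y + _]addrC addrK.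
  rewrite (le_trans (n1D _ _))// n1Z wn//.
  have -> : n1 (e_ i) = 1.
    rewrite /n1 (bigD1 i)//= ebaseE eqxx normr1 big1 ?addr0// => j ji.
    by rewrite ebaseE (negbTE ji) normr0.
  rewrite mulr1 (le_trans _ (le_a (i :: l) _))//=; last by rewrite il.
  by rewrite big_cons addrC lerD2r.
have := H (enum 'I_d) (enum_uniq _).
have -> : w (enum 'I_d) = a by exact: sum_delta_enum.
by rewrite /n1 -big_enum.
Qed.

Lemma pder_lip h Dh (C : R) : pder h Dh -> (forall i z, `|Dh i z| <= C) -> lip C h.
Proof.
move=> hD hC x y; have := @coord_mvt h Dh y (x - y) C hD (fun i z _ => hC i z).
by rewrite [y + _]addrC subrK.
Qed.

(** After subtraction of the linear part at x, the partial derivatives are at most C |y|_1 along the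
    path of [coord_mvt]. *)
Lemma pder_taylor h Dh (C : R) x y : 0 <= C -> pder h Dh -> (forall i, lip C (Dh i)) ->
  `|h (x + y) - h x - \sum_i Dh i x * y 0 i| <= C * n1 y ^+ 2.
Proof.
move=> C0 hD hC.
pose k z := h z - \sum_i Dh i x * (z 0 i - x 0 i).
have kD : pder k (fun i z => Dh i z - Dh i x).
  apply: pder_intro => i z.
  have -> : (fun u => k (z + u *: e_ i)) =
      (fun u => h (z + u *: e_ i) - ((\sum_j Dh j x * (z 0 j - x 0 j)) + Dh i x * u)).
    apply/funext => u; congr (_ - _).
    have hc j : (z + u *: e_ i) 0 j = z 0 j + u * (j == i)%:R by rewrite mxE [X in _ + X]mxE ebaseE.
    rewrite (bigD1 i)//= [in RHS](bigD1 i)//= hc eqxx mulr1.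
    rewrite [RHS]addrAC -mulrDr [z 0 i - _ + _]addrAC; congr (_ + _).
    by apply: eq_bigr => j ji; rewrite hc (negbTE ji) mulr0 addr0.
  have h1 := pder_line i z 0 hD; rewrite scale0r addr0 in h1.
  apply: is_deriveB.
  apply: is_derive_eq.
  by rewrite /= add0r mul1r [_ *: 1]mulr1.
have := @coord_mvt k _ x y (C * n1 y) kD.
rewrite /k => h1; rewrite expr2 mulrA; apply: le_trans (h1 _).
  rewrite le_eqVlt; apply/orP; left; apply/eqP; congr `|_|.
  have -> : \sum_i Dh i x * (x 0 i - x 0 i) = 0 by rewrite big1// => i _; rewrite subrr mulr0.
  rewrite subr0 addrAC; congr (_ - _ - _).
  by apply: eq_bigr => i _; rewrite [(x + y) 0 i]mxE addrAC subrr add0r.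
by move=> i z zy; rewrite (le_trans (hC i z x))// ler_wpM2l.
Qed.

End calculus.

Section continuity.
Context {R : realType} {U : topologicalType}.

Lemma continuous_addr (f g : U -> R) : continuous f -> continuous g -> continuous (fun x => f x + g x).
Proof. by move=> cf cg x; apply: cvgD; [exact: cf|exact: cg]. Qed.

Lemma continuous_sqr (f : U -> R) : continuous f -> continuous (fun x => f x ^+ 2).
Proof.
move=> cf; have -> : (fun x => f x ^+ 2) = (fun x => f x * f x) by apply/funext => x; rewrite expr2.
by move=> x; apply: cvgM; exact: cf.
Qed.

Lemma continuous_cstB (f : U -> R) (c : R) : continuous f -> continuous (fun x => c - f x).
Proof. by move=> cf x; apply: cvgB; [exact: cvg_cst|exact: cf]. Qed.

End continuity.

Section potential.
Context {R : realType} {d : nat}.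
Notation vec := 'rV[R]_d.
Implicit Types (x y z a : vec).
Local Notation e_ i := (@ebase R d i).

Lemma enorm_sq x : enorm x ^+ 2 = \sum_i x 0 i ^+ 2.
Proof. by rewrite sqr_sqrtr// sumr_ge0// => i _; rewrite sqr_ge0. Qed.

Lemma enorm_ge0 x : 0 <= enorm x. Proof. exact: sqrtr_ge0. Qed.

Lemma coord_le_enorm x i : `|x 0 i| <= enorm x.
Proof.
rewrite -sqrtr_sqr ler_sqrt; last by rewrite sumr_ge0// => j _; rewrite sqr_ge0.
by rewrite (bigD1 i)//= lerDl sumr_ge0// => j _; rewrite sqr_ge0.
Qed.

Lemma continuous_enorm_sq : continuous (fun x => enorm x ^+ 2).
Proof.
have -> : (fun x => enorm x ^+ 2) = (fun x => \sum_(i <- index_enum 'I_d) x 0 i ^+ 2).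
  by apply/funext => x; rewrite enorm_sq.
elim: (index_enum _) => [|i l IH].
  have -> : (fun x0 : vec => \sum_(i <- [::]) x0 0 i ^+ 2) = fun=> 0 by apply/funext => y; rewrite big_nil.
  exact: cst_continuous.
have -> : (fun y : vec => \sum_(j <- i :: l) y 0 j ^+ 2) = fun y : vec => y 0 i ^+ 2 + \sum_(j <- l) y 0 j ^+ 2.
  by apply/funext => y; rewrite big_cons.
by apply: continuous_addr => //; apply: continuous_sqr; exact: coord_continuous.
Qed.

Lemma open_enorm_gt (r : R) : 0 <= r -> open [set x : vec | r < enorm x].
Proof.
move=> r0; have -> : [set x : vec | r < enorm x] = (fun x => enorm x ^+ 2) @^-1` [set u | r ^+ 2 < u].
  by apply/seteqP; split => x /=; rewrite ltr_pXn2r// nnegrE// enorm_ge0.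
by apply: open_comp; [move=> x _; exact: continuous_enorm_sq|exact: open_gt].
Qed.

Lemma pder_coord i : pder (fun x => x 0 i) (fun j _ => (i == j)%:R).
Proof.
apply: pder_intro => j z.
have -> : (fun u : R => (z + u *: e_ j) 0 i) = (fun u => z 0 i + u * (i == j)%:R).
  by apply/funext => u; rewrite mxE [X in _ + X]mxE ebaseE.
by apply: is_derive_eq; rewrite /GRing.scale/=; ring.
Qed.

Lemma pder_half_sq : pder (fun x => enorm x ^+ 2 / 2) (fun i x => x 0 i).
Proof.
apply: pder_intro => i z.
have -> : (fun u : R => enorm (z + u *: e_ i) ^+ 2 / 2) =
    (fun u => enorm z ^+ 2 / 2 + (z 0 i * u + u * u / 2)).
  apply/funext => u; rewrite !enorm_sq (bigD1 i)//= [in RHS](bigD1 i)//=.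
  have hc j : (z + u *: e_ i) 0 j = z 0 j + u * (j == i)%:R by rewrite mxE [X in _ + X]mxE ebaseE.
  under eq_bigr => j ji do rewrite hc (negbTE ji) mulr0 addr0.
  by rewrite hc eqxx mulr1; move: (\sum_(j < d | _) _) (z 0 i) => S q; field.
by apply: is_derive_eq; rewrite /GRing.scale/=; ring.
Qed.

Lemma pderB h k Dh Dk : pder h Dh -> pder k Dk -> pder (fun x => h x - k x) (fun i x => Dh i x - Dk i x).
Proof. by move=> hfun hk i z; apply: is_deriveB. Qed.

Variables (V : vec -> R) (Rad : R).
Hypothesis hA : assumptionA V Rad.

Let Rad0 : 0 < Rad. Proof. by case: hA => _ []. Qed.
Let VE x : Rad < enorm x -> V x = enorm x ^+ 2 / 2. Proof. by case: hA => _ [_]; exact. Qed.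

Definition pert x : R := enorm x ^+ 2 / 2 - V x.
Definition dpert i x : R := x 0 i - partial i V x.
Let ddpert i j x : R := (i == j)%:R - partial j (partial i V) x.

Lemma pertE x : - V x + enorm x ^+ 2 / 2 = pert x. Proof. by rewrite addrC. Qed.

Lemma pert_out x : Rad < enorm x -> pert x = 0.
Proof. by move=> h; rewrite /pert VE// subrr. Qed.

Lemma pder_pert : pder pert dpert.
Proof.
apply: pderB; first exact: pder_half_sq.
by move=> i z; apply: DeriveDef => //; case: hA => -[].
Qed.

Let pder_dpert i : pder (dpert i) (ddpert i).
Proof.
apply: pderB; first exact: pder_coord.
by move=> j z; apply: DeriveDef => //; case: hA => -[_ []].
Qed.

Let near_out (h : vec -> R) x : (forall y, Rad < enorm y -> h y = 0) -> Rad < enorm x ->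
  \near x, h x = (fun=> 0 : R) x.
Proof.
move=> h0 hx; have := open_nbhs_nbhs (conj (open_enorm_gt (ltW Rad0)) hx).
exact: filterS.
Qed.

Let pder_out h Dh i x : pder h Dh -> (forall y, Rad < enorm y -> h y = 0) -> Rad < enorm x -> Dh i x = 0.
Proof.
move=> hD h0 hx; rewrite -(@derive_val _ _ _ _ _ _ _ (hD i x)).
by rewrite (near_eq_derive (e_ i) (near_out h0 hx)) derive_cst.
Qed.

Lemma dpert_out i x : Rad < enorm x -> dpert i x = 0.
Proof. exact: pder_out pder_pert pert_out. Qed.

Let ddpert_out i j x : Rad < enorm x -> ddpert i j x = 0.
Proof. exact: pder_out (@pder_dpert i) (@dpert_out i). Qed.

(** The second derivatives are continuous on a compact box that contains the ball, and vanish
    outside the ball. *)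
Lemma ddpert_bounded : exists2 C : R, 0 <= C & forall i j x, `|ddpert i j x| <= C.
Proof.
have h1 i j : exists M : R, 0 <= M /\ forall x, `|ddpert i j x| <= M.
  pose A := [set x : vec | forall k, `[- Rad, Rad]%classic (x ord0 k)].
  have cA : compact A by apply: (@rV_compact _ _ (fun=> `[- Rad, Rad]%classic)) => k; exact: segment_compact.
  have cw : continuous (ddpert i j).
    by apply: continuous_cstB; case: hA => -[_ [_ h]] _; exact: h.
  have : compact (ddpert i j @` A).
    by apply: continuous_compact => //; exact: continuous_subspaceT.
  move/compact_bounded => -[M [_ hM]].
  exists (`|M| + 1); split; first by rewrite addr_ge0.
  move=> x; have [Ax|nA] := pselect (A x).
    by apply: (hM (`|M| + 1)); [rewrite (le_lt_trans (ler_norm _))// ltrDl|exists x].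
  rewrite ddpert_out ?normr0 ?addr_ge0// ltNge; apply/negP => xR; apply: nA => k.
  by rewrite /= in_itv/= -ler_norml (le_trans _ xR)// coord_le_enorm.
have /(_ _ _)/cid h2 := h1.
pose M i j := projT1 (h2 i j).
exists (\sum_i \sum_j M i j).
  by apply: sumr_ge0 => i _; apply: sumr_ge0 => j _; have [] := projT2 (h2 i j).
move=> i j x; have [_ h] := projT2 (h2 i j); rewrite (le_trans (h x))//.
have M0 k l : 0 <= M k l by have [] := projT2 (h2 k l).
rewrite -/(M i j); clearbody M.
apply: (@le_trans _ _ (\sum_l M i l)).
  by rewrite (bigD1 j)//= lerDl; apply: sumr_ge0.
rewrite [leRHS](bigD1 i)//= lerDl; apply: sumr_ge0 => k _; exact: sumr_ge0.
Qed.

Lemma dpert_lip : exists2 C : R, 0 <= C & forall i, lip C (dpert i).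
Proof.
have [C C0 hC] := ddpert_bounded; exists C => // i.
exact: (pder_lip (@pder_dpert i)).
Qed.

Let out_near x (i : 'I_d) : enorm x <= Rad -> Rad < enorm (x + (2 * Rad + 1) *: e_ i).
Proof.
move=> xR; apply: lt_le_trans (coord_le_enorm _ i).
rewrite mxE [X in _ + X]mxE ebaseE eqxx mulr1.
have /andP[h1 h2] : - Rad <= x 0 i <= Rad by rewrite -ler_norml (le_trans (coord_le_enorm _ _)).
by rewrite ger0_norm; lra.
Qed.

(** A displacement of length 2 Rad + 1 along an axis leads from any point of the ball to the
    outside, where [h] is 0. *)
Lemma lip_out_bounded h (C : R) (i : 'I_d) x : 0 <= C -> lip C h -> (forall y, Rad < enorm y -> h y = 0) ->
  `|h x| <= C * (2 * Rad + 1).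
Proof.
move=> C0 hC h0; have hR : 0 <= 2 * Rad + 1 by have := ltW Rad0; lra.
have [xR|xR] := ltP Rad (enorm x); first by rewrite h0// normr0 mulr_ge0.
have := hC x (x + (2 * Rad + 1) *: e_ i).
rewrite [X in `|_ - X|]h0 ?out_near// subr0 opprD addrA subrr add0r n1N n1Z.
have -> : n1 (e_ i) = 1.
  rewrite /n1 (bigD1 i)//= ebaseE eqxx normr1 big1 ?addr0// => j ji.
  by rewrite ebaseE (negbTE ji) normr0.
by rewrite mulr1 [`|2 * _ + _|]ger0_norm.
Qed.

Let dpert_bounded0 : exists C : R, forall i x, `|dpert i x| <= C.
Proof.
have [C C0 hC] := dpert_lip; exists (C * (2 * Rad + 1)) => i x.
exact: (lip_out_bounded i _ C0 (hC i) (@dpert_out i)).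
Qed.

Let cball0 : cball Rad (0 : vec).
Proof.
rewrite /cball/= /enorm big1 ?sqrtr0 ?(ltW Rad0)// => i _.
by rewrite mxE expr0n.
Qed.

(** On an unbounded set [sup] takes a default value, so boundedness must come before [M2] can serve
    as a bound. *)
Let M2_has_ub : has_ubound [set enorm (x - grad V x) | x in cball Rad].
Proof.
have [C hC] := dpert_bounded0.
exists (Num.sqrt (\sum_(i < d) C ^+ 2)) => _ [x _ <-].
rewrite ler_sqrt; last by rewrite sumr_ge0// => i _; rewrite sqr_ge0.
apply: ler_sum => i _; rewrite !mxE -/(dpert i x) -real_normK ?num_real// lerXn2r ?nnegrE//.
exact: le_trans (hC i x).
Qed.

Lemma M2_ge0 : 0 <= M2 V Rad.
Proof.
apply: le_trans (enorm_ge0 (0 - grad V 0)) _.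
by apply: ub_le_sup; [exact: M2_has_ub|exists 0].
Qed.

Lemma dpert_bound i x : `|dpert i x| <= M2 V Rad.
Proof.
have [xR|xR] := ltP Rad (enorm x); first by rewrite dpert_out// normr0 M2_ge0.
apply: (@le_trans _ _ (enorm (x - grad V x))).
  by apply: le_trans (coord_le_enorm _ i); rewrite !mxE.
by apply: ub_le_sup; [exact: M2_has_ub|exists x].
Qed.

Lemma pert_lip : lip (M2 V Rad) pert.
Proof. exact: pder_lip pder_pert dpert_bound. Qed.

(** Sets that have no supremum are covered by the default value 0. *)
Lemma sup_ge0 (S : set R) : (forall u : R, S u -> 0 <= u) -> 0 <= sup S.
Proof.
move=> S0; have [[[x Sx] ubS]|nS] := pselect (has_sup S); last by rewrite sup_out.
by rewrite (le_trans (S0 x Sx))// ub_le_sup.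
Qed.

Lemma M3_ge0 : 0 <= M3 V Rad.
Proof.
rewrite /M3; apply: sup_ge0 => _ [x _ <-].
by apply: sup_ge0 => _ [y _ <-]; exact: enorm_ge0.
Qed.

Hypothesis d0 : (0 < d)%N.
Let i0 := Ordinal d0.

Lemma pert_bound x : `|pert x| <= M2 V Rad * (2 * Rad + 1).
Proof. exact: (lip_out_bounded i0 _ M2_ge0 pert_lip pert_out). Qed.

Let pert_img : [set - V x + enorm x ^+ 2 / 2 | x in cball Rad] = [set pert x | x in cball Rad].
Proof. by apply: eq_imagel => x _; rewrite pertE. Qed.

Let enorm_axis (t : R) : 0 <= t -> enorm (t *: e_ i0) = t.
Proof.
move=> t0; rewrite /enorm (bigD1 i0)//= big1 => [|j ji].
  by rewrite mxE ebaseE eqxx mulr1 addr0 sqrtr_sqr ger0_norm.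
by rewrite mxE ebaseE (negbTE ji) mulr0 expr0n.
Qed.

Let bd : cball Rad (Rad *: e_ i0).
Proof. by rewrite /cball/= enorm_axis// ltW. Qed.

(** By continuity the value 0 taken outside the ball is attained on its sphere. Hence
    [m1 <= 0 <= M1], and the bounds on the ball hold in the whole space. *)
Let pert_bd : pert (Rad *: e_ i0) = 0.
Proof.
apply/eqP; rewrite -normr_le0; apply/ler_addgt0Pr => e e0; rewrite add0r.
have M0 := M2_ge0.
pose t := e / (M2 V Rad + 1).
have t0 : 0 < t by rewrite divr_gt0// ltr_wpDl.
have := pert_lip (Rad *: e_ i0) ((Rad + t) *: e_ i0).
rewrite [X in `|_ - X|]pert_out; last by rewrite enorm_axis ?ltrDl// addr_ge0// ltW.
rewrite subr0 -scalerBl opprD addrA subrr add0r n1Z => h; rewrite (le_trans h)//.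
have -> : n1 (e_ i0) = 1.
  rewrite /n1 (bigD1 i0)//= ebaseE eqxx normr1 big1 ?addr0// => j ji.
  by rewrite ebaseE (negbTE ji) normr0.
rewrite mulr1 normrN gtr0_norm// /t mulrCA ger_pMr// ler_pdivrMr ?ltr_wpDl// mul1r lerDl//.
Qed.

Lemma M1_m1_bounds x : m1 V Rad <= pert x <= M1 V Rad.
Proof.
have hub : has_ubound [set pert x | x in cball Rad].
  by exists (M2 V Rad * (2 * Rad + 1)) => _ [y _ <-]; rewrite (le_trans (ler_norm _))// pert_bound.
have hlb : has_lbound [set pert x | x in cball Rad].
  exists (- (M2 V Rad * (2 * Rad + 1))) => _ [y _ <-].
  by have := pert_bound y; rewrite ler_norml => /andP[].
have in_ball y : cball Rad y -> m1 V Rad <= pert y <= M1 V Rad.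
  move=> By; rewrite /m1 /M1 pert_img; apply/andP; split.
    by apply: ge_inf => //; exists y.
  by apply: ub_le_sup => //; exists y.
have [xR|xR] := ltP Rad (enorm x); last exact: in_ball.
by rewrite pert_out// -pert_bd; apply: in_ball.
Qed.

End potential.

Lemma weighted_diff_le (R : realType) (p q u v z c b s n : R) : 0 < s -> 0 < p -> p <= z ->
  `|p - q| <= b / s * z * n -> `|u - v| <= c * n -> `|v| <= b ->
  `|p * (u / s) - q * (v / s)| <= z * (c / s + (b / s) ^+ 2) * n.
Proof.
move=> s0 p0 pz pq uv vb.
have -> : p * (u / s) - q * (v / s) = p * ((u - v) / s) + (p - q) * (v / s) by ring.
have si : 0 < s^-1 by rewrite invr_gt0.
rewrite (le_trans (ler_normD _ _))// !normrM [`|s^-1|]gtr0_norm// [`|p|]gtr0_norm//.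
have h1 : p * (`|u - v| / s) <= z * (c * n / s).
  by apply: ler_pM => //; [exact: ltW|rewrite divr_ge0// ltW|rewrite ler_pM2r].
have h2 : `|p - q| * (`|v| / s) <= b / s * z * n * (b / s).
  by apply: ler_pM => //; [rewrite divr_ge0// ltW|rewrite ler_pM2r].
rewrite (le_trans (lerD h1 h2))// le_eqVlt; apply/orP; left; apply/eqP.
by field; rewrite gt_eqF.
Qed.

Section weight.
Context {R : realType} {d : nat}.
Notation vec := 'rV[R]_d.
Implicit Types (x y z a : vec).
Variables (V : vec -> R) (Rad : R).
Hypotheses (hA : assumptionA V Rad) (d0 : (0 < d)%N).
Variables (s C2 : R).
Hypotheses (s0 : 0 < s) (C20 : 0 <= C2) (hC2 : forall i, lip C2 (dpert V i)).
Local Notation f := (fhat V s).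
Local Notation D := (fun (i : 'I_d) (x : vec) => grad f x 0 i).
Local Notation b := (M2 V Rad).
Local Notation zeta := (zeta_s V Rad s).
Local Notation L := (zeta * (C2 / s + (b / s) ^+ 2)).

Let s_n0 : s != 0. Proof. by rewrite gt_eqF. Qed.
Let b0 : 0 <= b := M2_ge0 hA.

Lemma fhatE x : f x = expR (pert V x / s).
Proof. by rewrite /fhat /pert; congr expR; field. Qed.

Lemma fhat_gt0 x : 0 < f x. Proof. exact: expR_gt0. Qed.

Lemma fhat_bounds x : xi_s V Rad s <= f x <= zeta.
Proof.
have /andP[h1 h2] := M1_m1_bounds hA d0 x.
by rewrite fhatE /xi_s /zeta_s !ler_expR !ler_pM2r ?invr_gt0// h1.
Qed.

Lemma pder_fhat : pder f (fun i x => f x * (dpert V i x / s)).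
Proof.
apply: pder_intro => i z.
have -> : (fun u : R => f (z + u *: ebase R i)) = (fun u : R => expR (pert V (z + u *: ebase R i) / s)).
  by apply/funext => u; rewrite fhatE.
have h := pder_line i z 0 (pder_pert hA); rewrite scale0r addr0 in h.
apply: is_derive_eq.
by rewrite scale0r addr0 fhatE /GRing.scale/=; ring.
Qed.

Lemma grad_fhat i x : grad f x 0 i = f x * (dpert V i x / s).
Proof. by rewrite mxE; exact: (derive_val (is_derive := pder_fhat i x)). Qed.

Lemma grad_fhat_bound i x : `|grad f x 0 i| <= b / s * f x.
Proof.
rewrite grad_fhat mulrC normrM (gtr0_norm (fhat_gt0 x)) ler_pM2r ?fhat_gt0//.
by rewrite normrM [`|s^-1|]gtr0_norm ?invr_gt0// ler_pM2r ?invr_gt0// (dpert_bound hA).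
Qed.

Lemma zeta_gt0 : 0 < zeta. Proof. exact: expR_gt0. Qed.

Lemma fhat_lip : lip (b / s * zeta) f.
Proof.
apply: (pder_lip pder_fhat) => i x; rewrite -grad_fhat (le_trans (grad_fhat_bound _ _))//.
by rewrite ler_wpM2l ?divr_ge0// ?(ltW s0)//; case/andP: (fhat_bounds x).
Qed.

(** The constant follows the product rule: [C2 / s] comes from the derivative of [dpert],
    [(b / s) ^+ 2] from differentiating the exponential. *)
Lemma grad_fhat_lip i : lip L (fun x => grad f x 0 i).
Proof.
move=> x y; have /andP[_ fz] := fhat_bounds x.
have h := weighted_diff_le s0 (fhat_gt0 x) fz (fhat_lip x y) (hC2 i x y) (dpert_bound hA i y).
by rewrite -(grad_fhat i x) -(grad_fhat i y) in h.
Qed.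

Lemma L_fhat_ge0 : 0 <= L.
Proof.
apply: mulr_ge0; first exact: ltW zeta_gt0.
by apply: addr_ge0; [rewrite divr_ge0// ltW|exact: sqr_ge0].
Qed.

Lemma fhat_taylor x y : `|f (x + y) - f x - \sum_i grad f x 0 i * y 0 i| <= L * n1 y ^+ 2.
Proof.
apply: (@pder_taylor _ _ f D) => //; first exact: L_fhat_ge0.
  by move=> i z; rewrite grad_fhat; exact: pder_fhat.
exact: grad_fhat_lip.
Qed.

End weight.

Section clip.
Context {R : realType}.
Implicit Types t u r : R.

Lemma clip01_dist t u : `|clip01 t - clip01 u| <= `|t - u|.
Proof.
wlog tu : t u / t <= u.
  move=> h; have [|/ltW ut] := leP t u; first exact: h.
  by rewrite distrC [leRHS]distrC; exact: h.
rewrite distrC [leRHS]distrC ger0_norm ?subr_ge0 ?clip01_mono// ger0_norm ?subr_ge0//.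
rewrite /clip01 /Num.max /Num.min; do ?case: ifPn; rewrite -?leNgt; lra.
Qed.

Definition clipr r t : R := Num.max (- r) (Num.min t r).

Lemma clipr_dist r t u : `|clipr r t - clipr r u| <= `|t - u|.
Proof.
wlog tu : t u / t <= u.
  move=> h; have [|/ltW ut] := leP t u; first exact: h.
  by rewrite distrC [leRHS]distrC; exact: h.
rewrite [leRHS]distrC [leRHS]ger0_norm ?subr_ge0// ler_norml.
rewrite /clipr /Num.max /Num.min; do ?case: ifPn; rewrite -?leNgt; lra.
Qed.

Lemma clipr_bound r t : 0 <= r -> `|clipr r t| <= r.
Proof.
move=> r0; rewrite ler_norml /clipr /Num.max /Num.min; do ?case: ifPn; rewrite -?leNgt; lra.
Qed.

Lemma clipr_id r t : `|t| <= r -> clipr r t = t.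
Proof.
rewrite ler_norml => /andP[h1 h2]; rewrite /clipr (min_idPl h2) (max_idPr h1)//.
Qed.

Lemma clipr_out r t : 0 <= r -> r < `|t| -> `|clipr r t| = r.
Proof.
move=> r0; rewrite lter_normr => /orP[h|h].
  by rewrite /clipr (min_idPr (ltW h)) max_r ?ger0_norm//; lra.
by rewrite /clipr min_l ?max_l ?normrN ?ger0_norm//; lra.
Qed.

End clip.

(** * A Lipschitz cutoff *)

Section cutoff.
Context {R : realType} {d : nat}.
Notation vec := 'rV[R]_d.
Implicit Types (x y z a : vec).
Variables (V : vec -> R) (Rad r : R).
Hypotheses (hA : assumptionA V Rad) (Radr : Rad <= r).
Local Notation b := (M2 V Rad).

Let Rad0 : 0 < Rad. Proof. by case: hA => _ []. Qed.
Let VE x : Rad < enorm x -> V x = enorm x ^+ 2 / 2. Proof. by case: hA => _ [_]; exact. Qed.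
Let r0 : 0 <= r. Proof. by rewrite (le_trans (ltW Rad0)). Qed.

Definition boxproj x : vec := \row_i clipr r (x 0 i).

Lemma boxproj_id x : (forall i, `|x 0 i| <= r) -> boxproj x = x.
Proof. by move=> h; apply/rowP => i; rewrite mxE clipr_id. Qed.

Lemma VboxE x : V (boxproj x) = \sum_i clipr r (x 0 i) ^+ 2 / 2 - pert V (boxproj x).
Proof.
rewrite /pert opprB addrCA -mulr_suml enorm_sq.
under [in X in _ - X]eq_bigr do rewrite mxE.
by rewrite subrr addr0.
Qed.

Lemma boxproj_n1 x y : n1 (boxproj x - boxproj y) <= n1 (x - y).
Proof.
apply: ler_sum => i _; rewrite [X in `|X|]mxE [X in _ + X]mxE [X in X - _]mxE [X in _ - X]mxE.
by rewrite [X in _ <= `|X|]mxE [X in _ <= `|_ + X|]mxE; exact: clipr_dist.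
Qed.

Lemma Vbox_lip : lip (r + b) (fun x => V (boxproj x)).
Proof.
move=> x y; rewrite !VboxE.
set px := pert V _; set py := pert V _; set sx := \sum_i _; set sy := \sum_i _.
have -> : sx - px - (sy - py) = (sx - sy) + (py - px) by ring.
rewrite (le_trans (ler_normD _ _))// mulrDl; apply: lerD; last first.
  rewrite distrC (le_trans (pert_lip hA _ _))// ler_wpM2l ?(M2_ge0 hA)//.
  exact: boxproj_n1.
rewrite /sx /sy -sumrB (le_trans (ler_norm_sum _ _ _))// /n1 mulr_sumr.
apply: ler_sum => i _; rewrite [X in _ <= _ * `|X|]mxE [X in _ <= _ * `|_ + X|]mxE.
set p := clipr r _; set q := clipr r _.
have -> : p ^+ 2 / 2 - q ^+ 2 / 2 = (p + q) / 2 * (p - q) by field.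
rewrite normrM; apply: ler_pM => //; last exact: clipr_dist.
have := clipr_bound (x 0 i) r0; have := clipr_bound (y 0 i) r0; rewrite -/p -/q !ler_norml.
move=> /andP[? ?] /andP[? ?]; lra.
Qed.

Let out x : ~ (forall i, `|x 0 i| <= r) -> exists i, r < `|x 0 i|.
Proof. by move=> /existsNP[i /negP]; rewrite -ltNge => h; exists i. Qed.

Let norm_out x : (exists i, r < `|x 0 i|) -> r ^+ 2 / 2 < V x.
Proof.
move=> [i hi]; have h : r < enorm x := lt_le_trans hi (coord_le_enorm x i).
rewrite VE ?(le_lt_trans Radr)// ltr_pM2r ?invr_gt0// ltrXn2r// ?nnegrE ?enorm_ge0//.
Qed.

Let box_out x : Rad < r -> (exists i, r < `|x 0 i|) -> r ^+ 2 / 2 <= V (boxproj x).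
Proof.
move=> Rr [i hi]; have h : r <= enorm (boxproj x).
  by apply: le_trans (coord_le_enorm _ i); rewrite mxE clipr_out.
rewrite VE ?(lt_le_trans Rr)// ler_pM2r ?invr_gt0// lerXn2r ?nnegrE ?enorm_ge0//.
Qed.

Variables (t1 t : R).
Hypotheses (t1t : t1 < t) (tr : t <= r ^+ 2 / 2) (Rr : Rad < r).

(* [V] is Lipschitz on boxes only, hence the projection; outside the box [V] exceeds [t]. *)
Definition cutoff x : R := clip01 ((V (boxproj x) - t1) / (t - t1)).

Lemma cutoff_range x : 0 <= cutoff x <= 1. Proof. exact: clip01_range. Qed.

Lemma cutoff_lip : lip ((r + b) / (t - t1)) cutoff.
Proof.
move=> x y; rewrite (le_trans (clip01_dist _ _))// -mulrBl normrM [`|_^-1|]gtr0_norm ?invr_gt0 ?subr_gt0//.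
rewrite [leRHS]mulrAC ler_pM2r ?invr_gt0 ?subr_gt0//.
have -> : V (boxproj x) - t1 - (V (boxproj y) - t1) = V (boxproj x) - V (boxproj y) by ring.
exact: Vbox_lip.
Qed.

Lemma cutoff1 x : t < V x -> cutoff x = 1.
Proof.
move=> tV; have h : t <= V (boxproj x).
  have [hx|/out hx] := pselect (forall i, `|x 0 i| <= r); first by rewrite boxproj_id// ltW.
  by rewrite (le_trans tr)// box_out.
by rewrite /cutoff /clip01 min_r ?max_r// ler_pdivlMr ?subr_gt0// mul1r lerD2r.
Qed.

Lemma cutoff_pos x : 0 < cutoff x -> t1 < V x.
Proof.
move=> h; have hV : t1 < V (boxproj x).
  rewrite ltNge; apply/negP => h'; move: h; rewrite /cutoff /clip01.
  have h2 : (V (boxproj x) - t1) / (t - t1) <= 0.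
    by rewrite pmulr_lle0 ?invr_gt0 ?subr_gt0// subr_le0.
  by rewrite min_l ?(le_trans h2)// max_l// ltxx.
have [hx|/out hx] := pselect (forall i, `|x 0 i| <= r); first by move: hV; rewrite boxproj_id.
exact: lt_trans t1t (le_lt_trans tr (norm_out hx)).
Qed.

(** [V] is a quadratic form minus the Lipschitz function [pert]. *)
Lemma mfr_potential : mfr V.
Proof.
have -> : V = (fun x => \sum_i x 0 i ^+ 2 / 2 - pert V x).
  by apply/funext => x; rewrite /pert enorm_sq mulr_suml; ring.
apply: mfrB; last exact: (lip_mfr (pert_lip hA)).
apply: mfr_sum => i; apply: (mfr_comp (g := fun u : R => u ^+ 2 / 2)); last exact: mfr_coord.
exact: measurable_funM.
Qed.

End cutoff.

(** * Laplace bound *)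

Section gaussian_1d.
Context {R : realType}.

Let pdf0E (c t : R) : c != 0 -> normal_pdf 0 c t = normal_peak c * expR (- t ^+ 2 / (c ^+ 2 *+ 2)).
Proof. by move=> c0; rewrite normal_pdfE// /normal_fun subr0. Qed.

(** The weight turns the density of N(0, 1) into a multiple of that of N(0, 1/lam). *)
Lemma gau_exp_sq (lam : R) : 0 < lam ->
  exists2 a : R, 0 <= a & (\int[gau]_z (expR ((1 - lam) / 2 * z ^+ 2))%:E = a%:E)%E.
Proof.
move=> l0; pose sl : R := (Num.sqrt lam)^-1.
have sq0 : 0 < Num.sqrt lam by rewrite sqrtr_gt0.
have sl0 : sl != 0 by rewrite gt_eqF// invr_gt0.
have sl2 : sl ^+ 2 = lam^-1 by rewrite exprVn sqr_sqrtr// ltW.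
have p1 := normal_peak_gt0 (@oner_neq0 R); have p2 := normal_peak_gt0 sl0.
exists (normal_peak 1 / normal_peak sl); first by rewrite divr_ge0 ?ltW.
have mf : measurable_fun setT (fun z : R => (expR ((1 - lam) / 2 * z ^+ 2))%:E).
  apply/measurable_EFinP; apply: measurableT_comp => //; exact: measurable_funM.
rewrite gau_pdf//.
transitivity (\int[lebesgue_measure]_t ((normal_peak 1 / normal_peak sl)%:E * (normal_pdf 0 sl t)%:E))%E.
  apply: eq_integral => t _; rewrite -!EFinM; congr _%:E.
  rewrite !pdf0E ?oner_neq0// [RHS]mulrA divfK ?gt_eqF// mulrCA; congr (_ * _).
  rewrite -expRD; congr expR; rewrite sl2 expr1n.
  by field; rewrite gt_eqF.
rewrite ge0_integralZl//.
- by rewrite integral_normal_pdf mule1.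
- by apply/measurable_EFinP; exact: measurable_normal_pdf.
- by move=> t _; rewrite lee_fin normal_pdf_ge0.
- by rewrite lee_fin divr_ge0 ?ltW.
Qed.

(** The weight cancels the Gaussian exponential, so only the length of the interval and the peak of
    the density remain. *)
Lemma gau_exp_itv (p q : R) : p <= q ->
  (\int[gau]_z (\1_(`[p, q]%classic) z * expR (z ^+ 2 / 2))%:E = (normal_peak 1 * (q - p))%:E)%E.
Proof.
move=> pq.
have mf : measurable_fun setT (fun z : R => (\1_(`[p, q]%classic) z * expR (z ^+ 2 / 2))%:E).
  apply/measurable_EFinP; apply: measurable_funM; first exact: measurable_indic.
  by apply: measurableT_comp => //; exact: measurable_funM.
have f0 (z : R) : (0 <= (\1_(`[p, q]%classic) z * expR (z ^+ 2 / 2))%:E)%E.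
  by rewrite lee_fin mulr_ge0// expR_ge0.
rewrite gau_pdf//.
transitivity (\int[lebesgue_measure]_t ((normal_peak 1)%:E * (\1_(`[p, q]%classic) t)%:E))%E.
  apply: eq_integral => t _; rewrite -!EFinM; congr _%:E.
  rewrite pdf0E ?oner_neq0// mulrCA -mulrA -expRD; congr (_ * _).
  rewrite expr1n (_ : _ + _ = 0) ?expR0 ?mulr1//.
  by field.
rewrite ge0_integralZl//.
- have -> : (\int[lebesgue_measure]_x (\1_`[p, q] x)%:E = (q - p)%:E)%E; last by rewrite -EFinM.
  rewrite integral_indic// setIT.
  rewrite /= lebesgue_measure_itv/= lte_fin; case: ltP => [_|qp]; first by rewrite EFinB.
  by have -> : q = p; [apply/eqP; rewrite eq_le qp|rewrite subrr].
- by apply/measurable_EFinP; exact: measurable_indic.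
- by rewrite lee_fin normal_peak_ge0.
Qed.

End gaussian_1d.

Section laplace.
Context {R : realType} {d : nat}.
Notation vec := 'rV[R]_d.

Section prod.
Context {dT : measure_display} {T : measurableType dT}.
Variables (P : probability T R) (W : T -> vec).
Hypothesis hW : std_gauss_vec P W.
Local Notation E F := (Rintegral P setT F%R).
Variables (k : 'I_d -> R -> R) (a : 'I_d -> R) (A : R).
Hypotheses (mk : forall i, measurable_fun setT (k i)) (k0 : forall i t, 0 <= k i t) (A0 : 0 <= A)
  (ka : forall i, (\int[gau]_z (k i z)%:E = (a i)%:E)%E).

Let mprod : mfr (fun x : vec => \prod_(i < d) k i (x 0 i)).
Proof.
move=> dT' T' Y mY; elim: (index_enum 'I_d) => [|j s IHs].
  by under eq_fun do rewrite big_nil; exact: measurable_cst.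
under eq_fun do rewrite big_cons.
by apply: measurable_funM => //; exact: (measurableT_comp (mk j) (mY j)).
Qed.

Let p0 (x : vec) : 0 <= \prod_(i < d) k i (x 0 i). Proof. exact: prodr_ge0. Qed.

Lemma integral_prod : (\int[P]_w (A * \prod_i k i (W w 0%R i))%:E = (A * \prod_i a i)%:E)%E.
Proof.
under eq_integral do rewrite EFinM.
rewrite ge0_integralZl//; last 2 first.
- by apply/measurable_EFinP; exact: (measW hW mprod).
- by move=> w _; rewrite lee_fin p0.
rewrite EFinM; congr (_ * _)%E.
pose K i t : \bar R := (k i t)%:E.
pose F (y : vec) : \bar R := (\prod_i K i (y 0%R i))%E.
have FE y : F y = (\prod_i k i (y 0%R i))%:E by rewrite /F prodEFin.
have mF : mfv F.
  move=> dT' T' Y mY; rewrite (_ : (fun _ => _) = fun w => (\prod_i k i (Y w 0%R i))%:E).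
    by apply/measurable_EFinP; exact: (mprod mY).
  by apply/funext => w; rewrite FE.
have F0 y : (0 <= F y)%E by rewrite FE lee_fin.
transitivity (gsm 1 F 0).
  rewrite -(integral_W hW 1 0 mF F0).
  by apply: eq_integral => w _; rewrite add0r scale1r FE.
rewrite (@gsm_prod R d 1 K) => [|i|i t].
- rewrite -prodEFin; apply: eq_bigr => i _; rewrite -ka; apply: eq_integral => z _.
  by rewrite mxE add0r mul1r.
- exact/measurable_EFinP.
- by rewrite lee_fin.
Qed.

Let mAp : measurable_fun setT (fun w => (A * \prod_i k i (W w 0 i))%:E).
Proof. by apply/measurable_EFinP; apply: measurable_funM => //; exact: (measW hW mprod). Qed.

Lemma E_prod_le (F : vec -> R) : integ P (fun w => F (W w)) -> (forall x, 0 <= F x) ->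
  (forall x : vec, F x <= A * \prod_(i < d) k i (x 0 i)) -> E (fun w => F (W w)) <= A * \prod_i a i.
Proof.
move=> iF F0 Fk; rewrite -lee_fin E_fin// -integral_prod.
apply: ge0_le_integral => //.
- by move=> w _; rewrite lee_fin.
- exact/measurable_EFinP/(integ_meas iF).
- by move=> w _; rewrite lee_fin.
Qed.

Lemma E_prod_ge (F : vec -> R) : integ P (fun w => F (W w)) ->
  (forall x : vec, A * \prod_(i < d) k i (x 0 i) <= F x) -> A * \prod_i a i <= E (fun w => F (W w)).
Proof.
move=> iF Fk; rewrite -lee_fin E_fin// -integral_prod.
apply: ge0_le_integral => //.
- by move=> w _; rewrite lee_fin mulr_ge0.
- exact/measurable_EFinP/(integ_meas iF).
- by move=> w _; rewrite lee_fin.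
Qed.

End prod.
End laplace.

Section laplace.
Context {R : realType} {d : nat}.
Notation vec := 'rV[R]_d.
Implicit Types (x y z : vec).
Variables (V : vec -> R) (Rad tau eps : R) (x0 : vec).
Hypotheses (hA : assumptionA V Rad) (Vx0 : V x0 = 0) (d0 : (0 < d)%N)
  (e0 : 0 < eps) (et : eps < tau).

Let Rad0 : 0 < Rad. Proof. by case: hA => _ []. Qed.
Let VE x : Rad < enorm x -> V x = enorm x ^+ 2 / 2. Proof. by case: hA => _ [_]; exact. Qed.
Local Notation b := (M2 V Rad).
Let b0 : 0 <= b := M2_ge0 hA.

(** One third of [eps] is spent here, one on integrability of the numerator ([lam]), and one on a
    neighbourhood of the minimiser ([V_near]). *)
Definition cut_level : R := tau - eps / 3.
(** Large enough for r^2 / 2 to exceed tau, and for the box to contain all points whose coordinates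
    are within 1 of those of [x0]. *)
Definition cut_radius : R := Rad + 2 * tau + 2.
Local Notation t1 := cut_level.
Local Notation r := cut_radius.
Local Notation g := (cutoff V r t1 tau).

Lemma cut_level_lt : t1 < tau. Proof. by move: e0; rewrite /cut_level; lra. Qed.

Lemma cut_radius_gt : Rad < r. Proof. by move: e0 et; rewrite /cut_radius; lra. Qed.

Lemma cut_radius_sq : tau <= r ^+ 2 / 2.
Proof.
rewrite ler_pdivlMr// (@le_trans _ _ ((2 * tau + 2) ^+ 2))//; first by have := sqr_ge0 tau; have := lt_trans e0 et; rewrite expr2; nra.
by rewrite lerXn2r ?nnegrE /cut_radius; move: Rad0 e0 et; lra.
Qed.

(** [V] vanishes at [x0] and has Lipschitz constant r + b on the box. The point [x0] lies in the
    ball because [V] is positive outside it. *)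
Let V_near : exists2 rho : R, 0 < rho & forall y, (forall i, `|y 0 i - x0 0 i| <= rho) -> V y <= eps / 3.
Proof.
have rb0 : 0 <= r + b by move: cut_radius_gt Rad0 b0; lra.
pose q : R := (r + b) * d%:R + 1.
have q0 : 0 < q by rewrite ltr_wpDl// mulr_ge0.
exists (Num.min 1 (eps / 3 / q)); first by rewrite lt_min ltr01 !divr_gt0.
move=> y; set rho := Num.min _ _ => hy.
have rho1 : rho <= 1 by rewrite ge_min lexx.
have rhoq : rho <= eps / 3 / q by rewrite ge_min lexx orbT.
have rho0 : 0 < rho by rewrite lt_min ltr01 !divr_gt0.
have x0R : enorm x0 <= Rad.
  rewrite leNgt; apply/negP => h; have := VE h; rewrite Vx0 => /esym/eqP.
  by rewrite mulf_eq0 invr_eq0 pnatr_eq0 orbF sqrf_eq0 gt_eqF// (lt_trans Rad0).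
have x0i i : `|x0 0 i| <= Rad by exact: le_trans (coord_le_enorm _ _) x0R.
have Rr := cut_radius_gt.
have hx0 : boxproj r x0 = x0 by apply: boxproj_id => i; exact: le_trans (x0i i) (ltW Rr).
have hyr : boxproj r y = y.
  apply: boxproj_id => i; rewrite -(subrK (x0 0 i) (y 0 i)) (le_trans (ler_normD _ _))//.
  by have := hy i; have := x0i i; move: e0 et; rewrite /cut_radius; lra.
have := Vbox_lip hA (ltW Rr) y x0; rewrite hx0 hyr Vx0 subr0 => h.
rewrite (le_trans (ler_norm _))// (le_trans h)//.
apply: (@le_trans _ _ ((r + b) * (d%:R * rho))).
  rewrite ler_wpM2l// /n1 (@le_trans _ _ (\sum_(i < d) rho))//.
    by apply: ler_sum => i _; rewrite [X in `|X|]mxE [X in _ + X]mxE.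
  by rewrite sumr_const card_ord -[leLHS]mulr_natl.
rewrite mulrA (@le_trans _ _ (q * rho))//; first by rewrite ler_pM2r// lerDl.
by rewrite mulrC -ler_pdivlMr.
Qed.

Let fhat_scale s z : 0 < s -> fhat V s (0 + Num.sqrt s *: z) =
  expR (- V (Num.sqrt s *: z) / s + (\sum_i z 0 i ^+ 2) / 2).
Proof.
move=> s0; rewrite add0r /fhat enorm_sq; congr (expR (_ + _)).
have -> : \sum_i (Num.sqrt s *: z) 0 i ^+ 2 = s * \sum_i z 0 i ^+ 2.
  by rewrite mulr_sumr; apply: eq_bigr => i _; rewrite mxE exprMn sqr_sqrtr// ltW.
by field; rewrite gt_eqF.
Qed.

Let prod_exp (c : R) z : \prod_i expR (c * z 0 i ^+ 2) = expR (c * \sum_i z 0 i ^+ 2).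
Proof. by rewrite mulr_sumr (big_morph _ (@expRD R) (expR0 R)). Qed.

Let c0 : R := b * (2 * Rad + 1).
Let c00 : 0 <= c0. Proof. by rewrite mulr_ge0// addr_ge0// mulr_ge0// ltW. Qed.
(** The share of the quadratic growth kept for integrability. Where V > t1, the bound |x|^2 / 2 <= V
    + c0 gives V - lam |x|^2 / 2 >= t1 - lam (t1 + c0) = tau - 2 eps / 3. *)
Let lam : R := eps / 3 / (t1 + c0).
Let t10 : 0 < t1. Proof. by move: e0 et; rewrite /cut_level; lra. Qed.
Let lam0 : 0 < lam. Proof. by apply: divr_gt0; [rewrite divr_gt0|exact: ltr_wpDr]. Qed.
Let lam1 : lam <= 1.
Proof.
rewrite /lam ler_pdivrMr ?(ltr_wpDr c00 t10)// mul1r /cut_level; move: c00 e0 et; lra.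
Qed.

Let numer s z : 0 < s -> g (0 + Num.sqrt s *: z) * fhat V s (0 + Num.sqrt s *: z) <=
  expR (- (tau - 2 * (eps / 3)) / s) * \prod_i expR ((1 - lam) / 2 * z 0 i ^+ 2).
Proof.
move=> s0; rewrite prod_exp -expRD.
have /andP[g0 g1] := @cutoff_range R d V r t1 tau (0 + Num.sqrt s *: z).
have [gp|gn] := ltP 0 (g (0 + Num.sqrt s *: z)); last first.
  have -> : g (0 + Num.sqrt s *: z) = 0 by apply/eqP; rewrite eq_le gn.
  by rewrite mul0r expR_ge0.
have hV := cutoff_pos hA (ltW cut_radius_gt) cut_level_lt cut_radius_sq gp.
rewrite (@le_trans _ _ (1 * fhat V s (0 + Num.sqrt s *: z)))//.
  by rewrite ler_wpM2r// expR_ge0.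
rewrite mul1r fhat_scale// ler_expR.
have hp := pert_bound hA d0 (Num.sqrt s *: z).
have hs : enorm (Num.sqrt s *: z) ^+ 2 = s * \sum_i z 0 i ^+ 2.
  by rewrite enorm_sq mulr_sumr; apply: eq_bigr => i _; rewrite mxE exprMn sqr_sqrtr// ltW.
move: hV hp; rewrite add0r -/c0 /pert hs.
move: (V _) (\sum_i _) => v S hV hp.
have h1 : s * S / 2 <= v + c0 by have := le_trans (ler_norm _) hp; lra.
have h2 : lam * (t1 + c0) = eps / 3 by rewrite /lam divfK// gt_eqF//; exact: ltr_wpDr.
have h3 : lam * (s * S / 2) <= lam * (v + c0) by rewrite ler_pM2l.
have h4 : (1 - lam) * t1 <= (1 - lam) * v by rewrite ler_wpM2l ?subr_ge0// ltW.
have h5 : lam * (s * S / 2) <= v - (tau - 2 * (eps / 3)).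
  by move: h2 h3 h4; rewrite /cut_level; lra.
rewrite -subr_ge0.
rewrite (_ : _ - _ = (v - (tau - 2 * (eps / 3)) - lam * (s * S / 2)) / s); last first.
  by field; rewrite gt_eqF.
by rewrite divr_ge0 ?subr_ge0// ltW.
Qed.

Lemma laplace_bound : exists2 C : R, 0 < C & forall (s : R) dT (T : measurableType dT)
  (P : probability T R) (W : T -> vec), 0 < s -> s < 1 -> std_gauss_vec P W ->
  ufun P W (fhat V s) g (Num.sqrt s) 0 <= C * expR (- (tau - eps) / s).
Proof.
have [a a0 ha] := gau_exp_sq lam0.
have [rho rho0 hrho] := V_near.
pose pk : R := normal_peak 1.
have pk0 : 0 < pk := normal_peak_gt0 (@oner_neq0 R).
(* A lower bound for the weight of a box around the minimiser, uniform in s: after rescaling its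
   sides are 2 rho / sqrt s, at least 2 rho since s < 1. *)
pose be : R := (pk * (2 * rho)) ^+ d.
have be0 : 0 < be by rewrite exprn_gt0// !mulr_gt0.
exists (a ^+ d / be + 1); first by rewrite ltr_wpDl//; apply: divr_ge0; [exact: exprn_ge0|exact: ltW].
move=> s dT T P W s0 s1 hW.
have q0 : 0 < Num.sqrt s by rewrite sqrtr_gt0.
have q1 : Num.sqrt s <= 1 by rewrite -(@sqrtr1 R) ler_sqrt// ltW.
have flip := fhat_lip hA d0 s0.
have fb := fhat_bounds hA d0 s0.
have glip := cutoff_lip hA (ltW cut_radius_gt) cut_level_lt.
have mf : mfr (fhat V s) := lip_mfr flip.
have mg : mfr g := lip_mfr glip.
have fz x : `|fhat V s x| <= zeta_s V Rad s.
  by rewrite gtr0_norm ?expR_gt0//; case/andP: (fb x).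
have hnum : hfun P W (fhat V s) g (Num.sqrt s) 0 <= expR (- (tau - 2 * (eps / 3)) / s) * a ^+ d.
  have := @E_prod_le R d _ _ P W hW (fun _ t => expR ((1 - lam) / 2 * t ^+ 2)) (fun=> a)
    (expR (- (tau - 2 * (eps / 3)) / s)) _ _ _ _ (fun z => g (0 + Num.sqrt s *: z) * fhat V s (0 + Num.sqrt s *: z)).
  rewrite prodr_const card_ord; apply.
  - by move=> i; apply: measurableT_comp => //; exact: measurable_funM.
  - by move=> i t; exact: expR_ge0.
  - exact: expR_ge0.
  - by move=> i; exact: ha.
  - apply: (integ_bdd P (c := zeta_s V Rad s)) => [|w].
      apply: (measW hW (f := fun z => g (0 + Num.sqrt s *: z) * fhat V s (0 + Num.sqrt s *: z))).
      by apply: mfrM; exact: mfr_affine.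
    have /andP[g0 g1] := @cutoff_range R d V r t1 tau (0 + Num.sqrt s *: W w).
    rewrite normrM (ger0_norm g0) -[leRHS]mul1r; apply: ler_pM => //; exact: fz.
  - move=> z; have /andP[g0 g1] := @cutoff_range R d V r t1 tau (0 + Num.sqrt s *: z).
    by rewrite mulr_ge0// expR_ge0.
  - by move=> z; exact: numer.
have hden : expR (- (eps / 3) / s) * be <= phi P W (fhat V s) (Num.sqrt s) 0.
  pose I i := `[(x0 0 i - rho) / Num.sqrt s, (x0 0 i + rho) / Num.sqrt s]%classic.
  have := @E_prod_ge R d _ _ P W hW (fun i t => \1_(I i) t * expR (t ^+ 2 / 2))
    (fun i => pk * ((x0 0 i + rho) / Num.sqrt s - (x0 0 i - rho) / Num.sqrt s))
    (expR (- (eps / 3) / s)) _ _ _ _ (fun z => fhat V s (0 + Num.sqrt s *: z)).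
  move=> h; apply: le_trans (h _ _ _ _ _ _) => {h}.
  - rewrite ler_wpM2l ?expR_ge0// /be -[d in _ ^+ d]card_ord -prodr_const.
    apply: ler_prod => i _; rewrite !mulr_ge0 ?(ltW pk0) ?(ltW rho0)//=.
    rewrite ler_pM2l// -mulrBl (_ : _ - _ = 2 * rho); last by ring.
    by rewrite ler_pdivlMr// ger_pMr// mulr_gt0.
  - move=> i; apply: measurable_funM; first by apply: measurable_indic; exact: measurable_itv.
    by apply: measurableT_comp => //; exact: measurable_funM.
  - by move=> i t; rewrite mulr_ge0// expR_ge0.
  - exact: expR_ge0.
  - by move=> i; apply: gau_exp_itv; rewrite ler_pM2r ?invr_gt0//; lra.
  - apply: (integ_bdd P (c := zeta_s V Rad s)) => [|w]; last exact: fz.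
    by apply: (measW hW (f := fun z => fhat V s (0 + Num.sqrt s *: z))); exact: mfr_affine.
  - move=> z; have [hz|/existsNP[i hi]] := pselect (forall i, I i (z 0 i)); last first.
      rewrite (bigD1 i)//= indicE memNset// !mul0r mulr0; exact: expR_ge0.
    have -> : \prod_i (\1_(I i) (z 0 i) * expR (z 0 i ^+ 2 / 2)) = \prod_i expR (2^-1 * z 0 i ^+ 2).
      by apply: eq_bigr => i _; rewrite indicE mem_set//= mul1r mulrC.
    rewrite prod_exp -expRD fhat_scale// ler_expR [_^-1 * _]mulrC lerD2r !mulNr lerN2 ler_pM2r ?invr_gt0//.
    apply: hrho => i; have := hz i; rewrite /I/= in_itv/= mxE ler_pdivrMr// ler_pdivlMr// => /andP[h1 h2].
    by rewrite ler_norml; apply/andP; split; lra.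
have phi0 : 0 < phi P W (fhat V s) (Num.sqrt s) 0.
  by apply: lt_le_trans hden; rewrite mulr_gt0// expR_gt0.
rewrite /ufun ler_pdivrMr// (le_trans hnum)//.
apply: (@le_trans _ _ ((a ^+ d / be + 1) * expR (- (tau - eps) / s) * (expR (- (eps / 3) / s) * be))); last first.
  by rewrite ler_wpM2l// mulr_ge0 ?expR_ge0// addr_ge0//; apply: divr_ge0; [exact: exprn_ge0|exact: ltW].
have -> : expR (- (tau - 2 * (eps / 3)) / s) = expR (- (tau - eps) / s) * expR (- (eps / 3) / s).
  by rewrite -expRD; congr expR; field; rewrite gt_eqF.
have hab : a ^+ d <= (a ^+ d / be + 1) * be.
  by rewrite mulrDl divfK ?gt_eqF// lerDl mul1r ltW.
rewrite [leRHS](_ : _ = expR (- (tau - eps) / s) * expR (- (eps / 3) / s) * ((a ^+ d / be + 1) * be)); last by ring.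
by rewrite ler_wpM2l// mulr_ge0// expR_ge0.
Qed.

End laplace.

(** * Constants *)

Section constants.
Context {R : realType}.

(** The K step variances add up to s, and this factor s cancels the 1/s in the Lipschitz constant of
    [fhat]: hence [Lg * s + 2 * b]. *)
Lemma alg_errE (d : nat) (s xi zeta b C2 Lg : R) (K m : nat) : 0 < s -> (0 < K)%N -> 0 < xi ->
  K%:R * @alg_err R d s xi zeta (b / s) (zeta * (C2 / s + (b / s) ^+ 2)) (b / s * zeta) Lg K m =
  (Lg * s + 2 * b) * (zeta / xi) * (d%:R * (4 * (b / s) * (zeta / xi))) / Num.sqrt m%:R +
  (Lg * s + 2 * b) * (zeta / xi) * ((b / s) ^+ 2 + zeta / xi * (C2 / s + (b / s) ^+ 2)) * Kd d * cstep s K.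
Proof.
move=> s0 K0 xi0; rewrite /alg_err /Lu (exprS _ 2) (cstep_sq K s0).
have Kn : K%:R != 0 :> R by rewrite pnatr_eq0 -lt0n.
have sn : s != 0 by rewrite gt_eqF.
have xn : xi != 0 by rewrite gt_eqF.
move: (K%:R) Kn (cstep s K) (Kd d) ((Num.sqrt m%:R)^-1) (d%:R : R) => k kn c kd q dd.
by field; rewrite kn sn xn.
Qed.

(** [A] stands for zeta / xi, and [Q1], [Q2] for the two constants of the statement. Both errors are
    at most quadratic in [A], and their remaining factors are absorbed by powers of b / s. *)
Lemma alg_err_le (d : nat) (s A b C2 Lg Q1 Q2 kd c q c' q' : R) : 0 < s -> s < 1 -> 1 <= A -> 0 <= b -> 0 <= C2 ->
  0 <= Lg -> 0 <= kd -> 0 <= c -> c <= c' -> 0 <= q -> q <= q' ->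
  4 * d%:R * (Lg + 2 * b) * (b / s) <= (b / s) ^+ 4 ->
  (Lg + 2 * b) * kd * ((2 * b ^+ 2 + C2) / s ^+ 2) <= (b / s) ^+ 6 ->
  (b / s) ^+ 6 * A ^+ 2 <= Q1 -> (b / s) ^+ 4 * A ^+ 2 <= Q2 ->
  (Lg * s + 2 * b) * A * (d%:R * (4 * (b / s) * A)) * q +
  (Lg * s + 2 * b) * A * ((b / s) ^+ 2 + A * (C2 / s + (b / s) ^+ 2)) * kd * c <= Q1 * c' + Q2 * q'.
Proof.
move=> s0 s1 A1 b0 C20 Lg0 kd0 c0 cc' q0 qq' h1 h2 hQ1 hQ2.
have A0 : 0 <= A by lra.
have l0 : 0 <= Lg * s + 2 * b by rewrite addr_ge0// mulr_ge0// ltW.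
have ll : Lg * s + 2 * b <= Lg + 2 * b by rewrite lerD2r ler_piMr// ltW.
have bs0 : 0 <= b / s by rewrite divr_ge0// ltW.
have p0 : 0 <= (b / s) ^+ 2 + A * (C2 / s + (b / s) ^+ 2).
  apply: addr_ge0; first exact: sqr_ge0.
  by apply: mulr_ge0 => //; apply: addr_ge0; [rewrite divr_ge0// ltW|exact: sqr_ge0].
rewrite addrC; apply: lerD.
  apply: ler_pM => //.
    by apply: mulr_ge0 => //; apply: mulr_ge0 => //; exact: mulr_ge0.
  apply: le_trans hQ1.
  apply: (@le_trans _ _ ((Lg + 2 * b) * kd * ((2 * b ^+ 2 + C2) / s ^+ 2) * A ^+ 2)); last first.
    by rewrite ler_wpM2r// sqr_ge0.
  have hs : C2 / s <= C2 / s ^+ 2.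
    by rewrite ler_wpM2l// lef_pV2 ?posrE// ?exprn_gt0// expr2 ger_pMr// ltW.
  have hx : (b / s) ^+ 2 + A * (C2 / s + (b / s) ^+ 2) <= A * ((2 * b ^+ 2 + C2) / s ^+ 2).
    have e1 : (2 * b ^+ 2 + C2) / s ^+ 2 = 2 * (b / s) ^+ 2 + C2 / s ^+ 2 by field; rewrite gt_eqF.
    rewrite e1.
    have e2 : (b / s) ^+ 2 <= A * (b / s) ^+ 2 by rewrite ler_peMl// sqr_ge0.
    have e3 : A * (C2 / s) <= A * (C2 / s ^+ 2) by rewrite ler_wpM2l.
    by move: e2 e3; move: ((b / s) ^+ 2) (C2 / s) (C2 / s ^+ 2) => u v w; lra.
  rewrite [leLHS](_ : _ = (Lg * s + 2 * b) * (kd * (A * ((b / s) ^+ 2 + A * (C2 / s + (b / s) ^+ 2))))); last by ring.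
  rewrite [leRHS](_ : _ = (Lg + 2 * b) * (kd * (A * (A * ((2 * b ^+ 2 + C2) / s ^+ 2))))); last by ring.
  apply: ler_pM => //.
    by apply: mulr_ge0 => //; exact: mulr_ge0.
  by rewrite ler_wpM2l// ler_wpM2l.
apply: ler_pM => //.
  apply: mulr_ge0; first exact: mulr_ge0.
  by apply: mulr_ge0 => //; apply: mulr_ge0 => //; exact: mulr_ge0.
apply: le_trans hQ2.
apply: (@le_trans _ _ (4 * d%:R * (Lg + 2 * b) * (b / s) * A ^+ 2)); last first.
  by rewrite ler_wpM2r// sqr_ge0.
rewrite [leLHS](_ : _ = (Lg * s + 2 * b) * (4 * d%:R * (b / s) * A ^+ 2)); last by ring.
rewrite [leRHS](_ : _ = (Lg + 2 * b) * (4 * d%:R * (b / s) * A ^+ 2)); last by ring.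
rewrite ler_wpM2r//; apply: mulr_ge0; last exact: sqr_ge0.
by apply: mulr_ge0 => //; exact: mulr_ge0.
Qed.

(* [b] stands for [M2]: when it vanishes so do [v] and all the errors. *)
Lemma small_temperature (d : nat) (b C2 Lg kd : R) : 0 <= b -> 0 <= C2 -> 0 <= Lg -> 0 <= kd ->
  (b = 0 -> C2 = 0) ->
  exists2 s0 : R, 0 < s0 & forall s, 0 < s -> s < 1 -> s < s0 ->
    [/\ (0 < b -> s <= b), 4 * d%:R * (Lg + 2 * b) * (b / s) <= (b / s) ^+ 4 &
     (Lg + 2 * b) * kd * ((2 * b ^+ 2 + C2) / s ^+ 2) <= (b / s) ^+ 6].
Proof.
move=> b0 C20 Lg0 kd0 bC.
have [bz|bnz] := eqVneq b 0.
  exists 1 => // s s0 s1 _; split; first by rewrite bz ltxx.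
    by rewrite bz mul0r mulr0 expr0n.
  by rewrite bC// bz expr2 !(mul0r, mulr0, addr0) expr0n.
have bp : 0 < b by rewrite lt_neqAle eq_sym bnz.
pose q1 := 4 * d%:R * (Lg + 2 * b); pose q2 := (Lg + 2 * b) * kd * (2 * b ^+ 2 + C2).
have q10 : 0 <= q1 by rewrite mulr_ge0// ?mulr_ge0// addr_ge0// mulr_ge0.
have q20 : 0 <= q2.
  by rewrite !mulr_ge0// addr_ge0// ?mulr_ge0// sqr_ge0.
have [p1 p2] : 0 < b ^+ 3 / (q1 + 1) /\ 0 < b ^+ 6 / (q2 + 1).
  by split; rewrite divr_gt0 ?exprn_gt0// ltr_wpDl.
(* As s < 1, the two inequalities follow from q1 s <= b^3 and q2 s <= b^6; the 1 in the denominators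
   allows q1 or q2 to vanish. *)
exists (Num.min b (Num.min (b ^+ 3 / (q1 + 1)) (b ^+ 6 / (q2 + 1)))).
  by rewrite !lt_min bp p1 p2.
move=> s s0 s1; rewrite !lt_min => /and3P[sb h1 h2]; split; first by move=> _; exact: ltW.
  have hs : s ^+ 3 <= s by rewrite exprS ger_pMr// exprn_ile1// ltW.
  have hq : q1 * s ^+ 3 <= b ^+ 3.
    rewrite (@le_trans _ _ (q1 * s))//; first by rewrite ler_wpM2l.
    by move: h1; rewrite ltr_pdivlMr ?ltr_wpDl// => /ltW; apply: le_trans; rewrite mulrC ler_pM2l// lerDl.
  rewrite -/q1 -subr_ge0 (_ : _ - _ = b / s ^+ 4 * (b ^+ 3 - q1 * s ^+ 3)); last by field; rewrite gt_eqF.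
  by apply: mulr_ge0; [rewrite divr_ge0// exprn_ge0// ltW|rewrite subr_ge0].
have hs : s ^+ 4 <= s by rewrite exprS ger_pMr// exprn_ile1// ltW.
have hq : q2 * s ^+ 4 <= b ^+ 6.
  rewrite (@le_trans _ _ (q2 * s))//; first by rewrite ler_wpM2l.
  by move: h2; rewrite ltr_pdivlMr ?ltr_wpDl// => /ltW; apply: le_trans; rewrite mulrC ler_pM2l// lerDl.
rewrite mulrA -/q2 -subr_ge0 (_ : _ - _ = (b ^+ 6 - q2 * s ^+ 4) / s ^+ 6); last by field; rewrite gt_eqF.
by apply: divr_ge0; [rewrite subr_ge0|rewrite exprn_ge0// ltW].
Qed.

Context {d : nat}.
Notation vec := 'rV[R]_d.
Variables (V : vec -> R) (Rad s : R).
Hypotheses (hA : assumptionA V Rad) (s0 : 0 < s).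

Let ratio : R := zeta_s V Rad s / xi_s V Rad s.
Let xi0 : 0 < xi_s V Rad s. Proof. exact: expR_gt0. Qed.
Let zeta0 : 0 < zeta_s V Rad s. Proof. exact: expR_gt0. Qed.

Let G : R := gamma_s V Rad s / xi_s V Rad s.
Let G_ge : (M2 V Rad / s) ^+ 2 * ratio <= G.
Proof.
rewrite /G /gamma_s -/(zeta_s V Rad s) -mulrA -/ratio ler_wpM2r ?divr_ge0 ?(ltW xi0) ?(ltW zeta0)//.
by rewrite lerDl divr_ge0 ?M3_ge0// ltW.
Qed.

Let ratio0 : 0 <= ratio. Proof. by rewrite divr_ge0 ?(ltW xi0) ?(ltW zeta0). Qed.
Let G0 : 0 <= G. Proof. by apply: le_trans G_ge; rewrite mulr_ge0// sqr_ge0. Qed.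
Let gamma0 : 0 <= gamma_s V Rad s.
Proof. by rewrite -(divfK (lt0r_neq0 xi0) (gamma_s V Rad s)) mulr_ge0// ltW. Qed.

Lemma Csharp1_ge0 : 0 <= Csharp1 V Rad s.
Proof. by rewrite /Csharp1 addr_ge0// divr_ge0// ?exprn_ge0// ltW. Qed.

Lemma Csharp2_ge0 : 0 <= Csharp2 V Rad s.
Proof.
by rewrite /Csharp2 addr_ge0// divr_ge0 ?sqr_ge0// mulr_ge0// ltW.
Qed.

(** From gamma / xi >= (M2 / s)^2 ratio, cubed; of the third power of the ratio only the square is
    kept. *)
Lemma Csharp1_ge : 1 <= ratio -> (M2 V Rad / s) ^+ 6 * ratio ^+ 2 <= Csharp1 V Rad s.
Proof.
move=> r1; apply: (@le_trans _ _ (G ^+ 3)); last first.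
  by rewrite /Csharp1 -expr_div_n -/G lerDr.
apply: (@le_trans _ _ (((M2 V Rad / s) ^+ 2 * ratio) ^+ 3)).
  by rewrite [leRHS]exprMn -exprM ler_wpM2l ?exprn_even_ge0// ler_weXn2l.
by rewrite lerXn2r ?nnegrE//; apply: mulr_ge0 => //; exact: sqr_ge0.
Qed.

Lemma Csharp2_ge : (M2 V Rad / s) ^+ 4 * ratio ^+ 2 <= Csharp2 V Rad s.
Proof.
apply: (@le_trans _ _ (G ^+ 2)); last first.
  by rewrite /Csharp2 -expr_div_n -/G lerDl divr_ge0 ?sqr_ge0// mulr_ge0// ltW.
apply: (@le_trans _ _ (((M2 V Rad / s) ^+ 2 * ratio) ^+ 2)).
  by rewrite [leRHS]exprMn -exprM.
by rewrite lerXn2r ?nnegrE//; apply: mulr_ge0 => //; exact: sqr_ge0.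
Qed.

Lemma zeta_xi_ge1 : (0 < d)%N -> 1 <= zeta_s V Rad s / xi_s V Rad s.
Proof.
move=> d0; rewrite ler_pdivlMr// mul1r.
by have /andP[h1 h2] := fhat_bounds hA d0 s0 0; exact: le_trans h2.
Qed.

End constants.

(** * From tail probabilities to expectations, and the final bounds *)

Section markov.
Context {R : realType} {d : nat} {dT : measure_display} {T : measurableType dT}.
Variables (P : probability T R) (V g : 'rV[R]_d -> R) (Y : T -> 'rV[R]_d) (tau : R).

Lemma prob_le_cutoff : mfr V -> mfr g -> vmeas Y -> (forall x, 0 <= g x <= 1) ->
  (forall x, tau < V x -> g x = 1) ->
  (P [set w | (tau < V (Y w))%R] <= (Rintegral P setT (fun w => g (Y w)))%:E)%E.
Proof.
move=> mV mg mY g01 g1.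
have mVY := mV _ _ _ mY; have mgY := mg _ _ _ mY.
pose A := [set w | (tau < V (Y w))%R].
have mA : measurable A.
  have := mVY measurableT _ (measurable_itv `]tau, +oo[); rewrite setTI.
  congr (measurable _); apply/seteqP; split => w /=; by rewrite in_itv/= andbT.
have ig : integ P (fun w => g (Y w)).
  by apply: (integ_bdd P (c := 1)) => // w; have /andP[h1 h2] := g01 (Y w); rewrite ger0_norm.
rewrite -/A -[X in (P X <= _)%E]setIT -(integral_indic P measurableT mA) E_fin//.
apply: ge0_le_integral => //.
- by apply/measurable_EFinP; exact: measurable_indic.
- exact/measurable_EFinP.
- move=> w _; rewrite lee_fin indicE; have [Aw|nA] := pselect (A w).
    by rewrite mem_set//= g1.
  by rewrite memNset//=; case/andP: (g01 (Y w)).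
Qed.

End markov.

Lemma rV0_all_eq (R : realType) (x y : 'rV[R]_0) : x = y.
Proof. by apply/rowP => -[]. Qed.

(** If [M2] is 0 then [dpert] vanishes identically, so its Lipschitz constant can be taken to be 0,
    as [small_temperature] requires. *)
Lemma dpert_lip_vanish (R : realType) (d : nat) (V : 'rV[R]_d -> R) (Rad : R) : assumptionA V Rad ->
  exists C2 : R, [/\ 0 <= C2, forall i, lip C2 (dpert V i) & M2 V Rad = 0 -> C2 = 0].
Proof.
move=> hA; have [C C0 hC] := dpert_lip hA.
have [b0|bn] := eqVneq (M2 V Rad) 0; last by exists C; split => // b0; rewrite b0 eqxx in bn.
exists 0; split => // i x y.
have h z : dpert V i z = 0.
  by apply/eqP; rewrite -normr_le0; have := dpert_bound hA i z; rewrite b0.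
by rewrite !h subrr normr0 mul0r.
Qed.

Lemma le_sqrt_inv_nat (R : realType) (a K : nat) : (0 < a)%N -> Num.sqrt (K%:R^-1) <= Num.sqrt (a%:R * K%:R^-1) :> R.
Proof.
move=> a0; rewrite ler_sqrt ?mulr_ge0 ?invr_ge0//.
by rewrite ler_peMl ?invr_ge0// ler1n.
Qed.

Theorem mainTheorem5 (R : realType) (d : nat) (V : 'rV[R]_d -> R) (Rad : R) :
  assumptionA V Rad ->
  (exists x0, V x0 = 0) -> (forall x, 0 <= V x) ->
  forall tau eps : R, 0 < tau -> 0 < eps < tau ->
  exists C : R, 0 < C /\
  forall (sigma : R) (K m : nat), 0 < sigma < 1 -> (1 <= K)%N -> (1 <= m)%N ->
  forall (dT : measure_display) (T : measurableType dT) (P : probability T R)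
    (W : T -> 'rV[R]_d) (B : T -> R -> 'rV[R]_d) (X : T -> R -> 'rV[R]_d)
    (epsn : nat -> T -> 'rV[R]_d) (Z : nat -> nat -> T -> 'rV[R]_d),
  std_gauss_vec P W ->
  brownian P B ->
  solves_sde P W V sigma B X ->
  (forall i, measurable_fun setT (fun w => X w 1 0 i)) ->
  let noise := fun (a : noise_idx * 'I_d) (w : T) =>
    match a.1 with Eps k => epsn k w 0 a.2 | Zn k j => Z k j w 0 a.2 end in
  let used := [set a : noise_idx * 'I_d |
    match a.1 with Eps k => (1 <= k <= K)%N | Zn k j => (k < K)%N && (j < m)%N end] in
  (forall a, used a -> has_normal_law P (noise a) 0 1) ->
  mutually_indep P used noise ->
  (P [set w | (tau < V (X w 1))%R] <= (C * expR (- (tau - eps) / sigma))%:E)%E /\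
  (P [set w | (tau < V (Ytilde V sigma K m (fun k => epsn k w) (fun k j => Z k j w) K))%R]
     <= (C * expR (- (tau - eps) / sigma)
         + Csharp1 V Rad sigma * Num.sqrt ((d * (2 * d + 3))%:R * K%:R^-1)
         + Csharp2 V Rad sigma * Num.sqrt ((4 * d)%:R / m%:R))%:E)%E.
Proof.
move=> hA [x0 Vx0] V0 tau eps tau0 /andP[e0 et].
(* In dimension 0 the only point is [x0], where V = 0, so both events are empty. The bounds through
   [M1] and [m1] need an axis along which to leave the ball. *)
have [d0|d0] := posnP d.
  subst d; exists 1; split => // s K m /andP[s0 s1] K0 m0 dT T P W B X epsn Z _ _ _ _ noise used _ _.
  have hV (Y : T -> 'rV[R]_0) : [set w | (tau < V (Y w))%R] = set0.
    apply/seteqP; split => w //=; rewrite (rV0_all_eq (Y w) x0) Vx0.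
    by rewrite ltNge ltW.
  split; rewrite (hV (fun w => _)) measure0 lee_fin ?mulr_ge0 ?expR_ge0//.
  rewrite !addr_ge0 ?mulr_ge0 ?expR_ge0 ?sqrtr_ge0 ?Csharp1_ge0 ?Csharp2_ge0//.
have [Cl Cl0 hCl] := laplace_bound hA Vx0 d0 e0 et.
have [C2 [C20 hC2 C2z]] := dpert_lip_vanish hA.
have b0 := M2_ge0 hA; set b := M2 V Rad in b0 C2z *.
set r := cut_radius Rad tau; set t1 := cut_level tau eps.
set g := cutoff V r t1 tau.
have Rr : Rad < r := cut_radius_gt Rad e0 et.
have t1t : t1 < tau := cut_level_lt tau e0.
have tr : tau <= r ^+ 2 / 2 := cut_radius_sq hA e0 et.
have glip := cutoff_lip hA (ltW Rr) t1t.
have g01 := @cutoff_range R d V r t1 tau.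
have g1 x : tau < V x -> g x = 1 by exact: (cutoff1 hA (ltW Rr) t1t tr Rr).
have mg : mfr g := lip_mfr glip.
have mV := mfr_potential hA.
set Lg := (r + b) / (tau - t1).
have Lg0 : 0 <= Lg.
  rewrite divr_ge0 ?subr_ge0 ?(ltW t1t)// addr_ge0//.
  by case: hA => _ [Rad0 _]; exact: ltW (lt_trans Rad0 Rr).
have [sg sg0 hsg] := small_temperature d b0 C20 Lg0 (@Kd_ge0 R d) C2z.
(* The second summand lifts the exponential term to at least 1 as soon as sigma >= [sg]. *)
exists (Cl + expR ((tau - eps) / sg)); split; first by rewrite addr_gt0// expR_gt0.
move=> s K m /andP[s0 s1] K0 m0 dT T P W B X epsn Z hW hB hX mX noise used law indep.
have xi0 : 0 < xi_s V Rad s by exact: expR_gt0.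
have fb := fhat_bounds hA d0 s0.
have flip := fhat_lip hA d0 s0.
have Dlip := grad_fhat_lip hA d0 s0 hC2.
have DB := grad_fhat_bound hA s0.
have taylor := fhat_taylor hA d0 s0 C20 hC2.
have B0 : 0 <= b / s by rewrite divr_ge0// ltW.
have L0 := L_fhat_ge0 V Rad s0 C20.
have Lf0 : 0 <= b / s * zeta_s V Rad s by rewrite mulr_ge0// ltW// expR_gt0.
have hlap := hCl s dT T P W s0 s1 hW.
have CE : Cl * expR (- (tau - eps) / s) <= (Cl + expR ((tau - eps) / sg)) * expR (- (tau - eps) / s).
  by rewrite ler_wpM2r ?expR_ge0// lerDl expR_ge0.
split.
  apply: (le_trans (prob_le_cutoff P mV mg mX g01 g1)); rewrite lee_fin (le_trans _ CE)// (le_trans _ hlap)//.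
  exact: (sde_final hW s0 xi0 fb flip glip g01 Dlip DB B0 L0 Lf0 Lg0 taylor hB hX mX).
have Q1 := Csharp1_ge0 V Rad s0; have Q2 := Csharp2_ge0 V Rad s0.
have q1 := sqrtr_ge0 ((d * (2 * d + 3))%:R * K%:R^-1 : R).
have q2 := sqrtr_ge0 ((4 * d)%:R / m%:R : R).
have C0 : 0 <= (Cl + expR ((tau - eps) / sg)) * expR (- (tau - eps) / s).
  by rewrite mulr_ge0 ?expR_ge0// addr_ge0 ?expR_ge0// ltW.
have mY := alg_vmeas s0 xi0 fb flip Dlip m0 law.
have mE : measurable [set w | (tau < V (Ytilde V s K m (fun k => epsn k w) (fun k j => Z k j w) K))%R].
  have := (mV _ _ _ mY) measurableT _ (measurable_itv `]tau, +oo[); rewrite setTI.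
  by congr (measurable _); apply/seteqP; split => w /=; rewrite in_itv/= andbT.
have [sgs|ssg] := leP sg s.
  (* the exponential term is at least 1 *)
  apply: (@le_trans _ _ 1%:E); first exact: probability_le1.
  rewrite lee_fin -addrA (@le_trans _ _ ((Cl + expR ((tau - eps) / sg)) * expR (- (tau - eps) / s)))//; last first.
    by rewrite lerDl addr_ge0// mulr_ge0.
  rewrite mulrDl -expRD -[leLHS]add0r lerD ?mulr_ge0 ?expR_ge0 ?(ltW Cl0)//.
  rewrite -expR0 ler_expR mulNr subr_ge0 ler_wpM2l ?subr_ge0 ?(ltW et)//.
  by rewrite lef_pV2 ?posrE.
have [sb hs1 hs2] := hsg s s0 s1 ssg.
have A1 := zeta_xi_ge1 hA s0 d0.
have hQ1 := Csharp1_ge s0 A1; have hQ2 := Csharp2_ge V Rad s0.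
have cK : cstep s K <= Num.sqrt K%:R^-1.
  by rewrite /cstep ler_sqrt ?invr_ge0// ler_piMl ?invr_ge0// ltW.
have cc : cstep s K <= Num.sqrt ((d * (2 * d + 3))%:R * K%:R^-1).
  by rewrite (le_trans cK)// le_sqrt_inv_nat// muln_gt0 d0 addn_gt0 orbT.
have c0 := ltW (cstep_gt0 s0 K0).
(* [one_step] requires that the drift move each coordinate by at most one standard deviation of the
   step. *)
have [cB|cB] := leP (cstep s K * (b / s)) 1; last first.
  (* the step is so coarse that the term in Csharp1 is at least 1 *)
  apply: (@le_trans _ _ 1%:E); first exact: probability_le1.
  rewrite lee_fin addrAC (@le_trans _ _ (Csharp1 V Rad s * Num.sqrt ((d * (2 * d + 3))%:R * K%:R^-1)))//; last first.
    by rewrite lerDr addr_ge0// mulr_ge0.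
  have bp : 0 < b.
    by rewrite lt_neqAle b0 andbT eq_sym; apply/eqP => bz; move: cB; rewrite bz mul0r mulr0 ltr10.
  have bs1 : 1 <= b / s by rewrite ler_pdivlMr// mul1r sb.
  rewrite (le_trans (ltW cB))// mulrC; apply: ler_pM => //.
  apply: le_trans hQ1; rewrite -[leLHS]mulr1; apply: ler_pM => //.
    by rewrite exprS ler_peMr// exprn_ege1.
  exact: exprn_ege1.
have hY := alg_final hW s0 K0 xi0 fb flip glip g01 Dlip DB B0 L0 Lf0 Lg0 taylor cB m0 law indep.
apply: (le_trans (prob_le_cutoff P mV mg mY g01 g1)); rewrite lee_fin (le_trans hY)//.
rewrite -[leRHS]addrA; apply: lerD; first exact: le_trans hlap CE.
rewrite alg_errE//.
have qm : (Num.sqrt m%:R)^-1 <= Num.sqrt ((4 * d)%:R / m%:R) :> R.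
  by rewrite -sqrtrV// le_sqrt_inv_nat// muln_gt0.
apply: alg_err_le => //.
- exact: Kd_ge0.
Qed.
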